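(* Every generalized dunce hat is finitely unsplittable.
   Context: Definitions. A generalized dunce hat is a quotient space $\Delta \cup_f J$, where $\Delta$ is a 2-dimensional disk, $J$ is a single circle containing a distinguished point $v$, and $f : \partial\Delta \to J$ is a map such that $f^{-1}(\{v\})$ is a finite set containing at least 3 points and $f$ maps each component of $\partial\Delta - f^{-1}(\{v\})$ homeomorphically onto $J - \{v\}$. Such a space is finitely splittable if it is the union of two proper subpolyhedra each of which has a finite first homology group (integer coefficients; subpolyhedra are not required to be connected). Otherwise it is finitely unsplittable. Convention: piecewise linear structures on $\Delta$ and $J$ are chosen so that $f$ is piecewise linear, and $\Delta\cup_f J$ is regarded as a compact polyhedron with the resulting structure, so that the quotient map $\Delta \to \Delta\cup_f J$ is piecewise linear and $\{v\}$ and $J$ are subpolyhedra. Subpolyhedra are compact. *)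

(* Defs.v *)
From HB Require Import structures.
From Stdlib Require Import Relation_Operators.
From mathcomp Require Import all_boot all_order all_algebra.
From mathcomp Require Import all_classical all_reals all_analysis.
From mathcomp Require Import freeg.

Set Implicit Arguments.
Unset Strict Implicit.
Unset Printing Implicit Defensive.

Import Order.TTheory GRing.Theory Num.Theory.
Import numFieldTopology.Exports.

Local Open Scope classical_set_scope.
Local Open Scope ring_scope.

Definition embedding (S T : topologicalType) (h : S -> T) : Prop :=
  injective h /\
  forall U : set S, open U <-> exists2 V : set T, open V & U = h @^-1` V.

Definition homeomorphism (S T : topologicalType) (h : S -> T) : Prop :=
  embedding h /\ range h = setT.

Definition stdsimplex (R : realType) (n : nat) : set 'rV[R]_n.+1 :=
  [set t | (forall j, 0 <= t ord0 j) /\ \sum_j t ord0 j = 1].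
Arguments stdsimplex : clear implicits.

Section Homology.
Context (R : realType).

Definition insert0 n (i : 'I_n.+2) (t : 'rV[R]_n.+1) : 'rV[R]_n.+2 :=
  \row_j (if unlift i j is Some k then t ord0 k else 0).

Lemma insert0_stdsimplex n (i : 'I_n.+2) (t : stdsimplex R n) :
  insert0 i (set_val t) \in stdsimplex R n.+1.
Proof.
have [t0 t1] := set_mem (valP t).
apply/mem_set; split=> [j|].
  by rewrite mxE; case: unliftP.
rewrite (bigD1_ord i) //= mxE unlift_none add0r -[RHS]t1.
by apply: eq_bigr => k _; rewrite mxE liftK set_valE.
Qed.

(** The inclusion of the face opposite to the [i]-th vertex. *)
Definition face n (i : 'I_n.+2) (t : stdsimplex R n) : stdsimplex R n.+1 :=
  SigSub (insert0_stdsimplex i t).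

Lemma insert0_continuous n (i : 'I_n.+2) : continuous (@insert0 n i).
Proof.
move=> t U /nbhs_ballP[e /= e0 eU]; apply/nbhs_ballP; exists e => //= s [_ ts].
apply: eU; split=> // a b; rewrite !mxE; case: unliftP => [k _|_].
  exact: ts.
exact: ballxx.
Qed.

Lemma face_continuous n (i : 'I_n.+2) : continuous (@face n i).
Proof.
apply/continuousP => _ [V oV <-]; rewrite -comp_preimage.
rewrite (_ : set_val \o _ = @insert0 n i \o set_val); last exact/funext.
apply: open_comp => // t _; apply: continuous_comp.
  exact: initial_continuous.
exact: insert0_continuous.
Qed.

HB.instance Definition _ n (i : 'I_n.+2) :=
  @isContinuous.Build _ _ (@face n i) (@face_continuous n i).

Definition singular (T : topologicalType) (n : nat) : choiceType :=
  continuousType (stdsimplex R n) T.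

Definition chain (T : topologicalType) (n : nat) : lmodType int :=
  {freeg (singular T n) / int}.

Definition boundary (T : topologicalType) (n : nat) :
    chain T n.+1 -> chain T n :=
  fglift (fun s : singular T n.+1 => \sum_(i < n.+2)
    (-1) ^+ i *: (<< (s \o @face n i : singular T n) >> : chain T n)).

(** The set of cosets of [im (boundary : C_2 -> C_1)] in
    [ker (boundary : C_1 -> C_0)]. *)
Definition H1 (T : topologicalType) : set (set (chain T 1)) :=
  [set [set z' | range (@boundary T 1) (z' - z)]
    | z in [set z | @boundary T 0 z = 0]].

End Homology.
Arguments H1 : clear implicits.

Definition polytope (R : realType) n (s : seq 'rV[R]_n) : set 'rV[R]_n :=
  smallest (@convex_set R 'rV[R]_n) [set` s].

Definition polyhedron (R : realType) n (P : set 'rV[R]_n) : Prop :=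
  exists ss : seq (seq 'rV[R]_n), P = \bigcup_(s in [set` ss]) polytope s.

(** A compact polyhedron structure on a space is given by a homeomorphism onto
    a compact Euclidean polyhedron; two such structures are to be identified
    when the identity map is piecewise linear, and everything below is
    invariant under this identification. *)
Record plStructure (R : realType) (T : topologicalType) := PLStructure {
  pl_dim : nat;
  pl_chart :> T -> 'rV[R]_pl_dim;
  pl_chart_embedding : embedding pl_chart;
  pl_chart_range : polyhedron (range pl_chart)
}.

Definition subpolyhedron (R : realType) (T : topologicalType)
    (h : plStructure R T) (A : set T) : Prop :=
  polyhedron (h @` A).

(** A map defined on a subset [D] of a polyhedron is piecewise linear when it
    is continuous and its graph is a compact Euclidean polyhedron; its domain
    [D], a projection of the graph, is then a subpolyhedron. *)
Definition pl_on (R : realType) (S T : topologicalType)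
    (hS : plStructure R S) (hT : plStructure R T)
    (D : set S) (g : D -> T) : Prop :=
  continuous g /\
  polyhedron (range (fun x : D => row_mx (hS (set_val x)) (hT (g x)))).

Definition pl_map (R : realType) (S T : topologicalType)
    (hS : plStructure R S) (hT : plStructure R T) (g : S -> T) : Prop :=
  continuous g /\ polyhedron (range (fun x : S => row_mx (hS x) (hT (g x)))).

Section Adjunction.
Local Open Scope quotient_scope.
Context (D J : topologicalType) (B : set D) (f : B -> J).

Definition disjoint_union : topologicalType :=
  {b : bool & if b then D else J : topologicalType}.

Definition inD (x : D) : disjoint_union :=
  existT (fun b : bool => if b then D else J : topologicalType) true x.

Definition inJ (y : J) : disjoint_union :=
  existT (fun b : bool => if b then D else J : topologicalType) false y.

(** The equivalence relation generated by [inD x ~ inJ (f x)] for [x] in [B]. *)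
Definition adj_equiv (a b : disjoint_union) : Prop :=
  clos_refl_sym_trans disjoint_union
    (fun a b => exists2 x : B, a = inD (set_val x) & b = inJ (f x)) a b.

Let adj_rel' (a b : disjoint_union) : bool := `[< adj_equiv a b >].

Lemma adj_rel_refl : reflexive adj_rel'.
Proof. by move=> a; apply/asboolP; exact: rst_refl. Qed.

Lemma adj_rel_sym : symmetric adj_rel'.
Proof. by move=> a b; apply/asboolP/asboolP; exact: rst_sym. Qed.

Lemma adj_rel_trans : transitive adj_rel'.
Proof.
by move=> b a c /asboolP ab /asboolP bc; apply/asboolP; exact: rst_trans bc.
Qed.

Definition adj_rel := EquivRel _ adj_rel_refl adj_rel_sym adj_rel_trans.

Definition adjunction := {eq_quot adj_rel}.

HB.instance Definition _ :=
  Topological.copy adjunction (quotient_topology adjunction).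
HB.instance Definition _ := Quotient.on adjunction.

Definition adj_disk (x : D) : adjunction := \pi_adjunction (inD x).
Definition adj_circle (y : J) : adjunction := \pi_adjunction (inJ y).

End Adjunction.

Definition unit_disk (R : realType) : set 'rV[R]_2 :=
  [set x | \sum_j x ord0 j ^+ 2 <= 1].
Arguments unit_disk : clear implicits.

Definition unit_circle (R : realType) : set 'rV[R]_2 :=
  [set x | \sum_j x ord0 j ^+ 2 = 1].
Arguments unit_circle : clear implicits.

Record dunceHat (R : realType) := DunceHat {
  disk : topologicalType;
  bdry : set disk;
  circle : topologicalType;
  basept : circle;
  attach : bdry -> circle;
  diskP : exists2 phi : unit_disk R -> disk,
    homeomorphism phi & bdry = phi @` (set_val @^-1` unit_circle R);
  circleP : exists psi : unit_circle R -> circle, homeomorphism psi;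
  attach_continuous : continuous attach;
  attach_finite : finite_set (attach @^-1` [set basept]);
  attach_ge3 : (`I_3 #<= attach @^-1` [set basept])%card;
  attach_component : forall x : bdry, attach x <> basept ->
    let C := connected_component (~` (attach @^-1` [set basept])) x in
    embedding (fun c : C => attach (set_val c)) /\
    attach @` C = ~` [set basept]
}.

Definition hat_space (R : realType) (X : dunceHat R) : topologicalType :=
  adjunction (@attach R X).

(** Piecewise linear structures on the disk, the circle and the quotient space
    for which the attaching map and the two canonical maps to the quotient are
    piecewise linear; the images of the circle and of the distinguished point
    are then subpolyhedra. *)
Record dunceHatPL (R : realType) (X : dunceHat R) := DunceHatPL {
  disk_pl : plStructure R (disk X);
  circle_pl : plStructure R (circle X);
  hat_pl : plStructure R (hat_space X);
  attach_pl : pl_on disk_pl circle_pl (@attach R X);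
  adj_disk_pl : pl_map disk_pl hat_pl (adj_disk (@attach R X));
  adj_circle_pl : pl_map circle_pl hat_pl (adj_circle (@attach R X))
}.

Definition finitely_splittable (R : realType) (T : topologicalType)
    (h : plStructure R T) : Prop :=
  exists A B : set T,
    [/\ subpolyhedron h A /\ A <> setT, subpolyhedron h B /\ B <> setT,
        A `|` B = setT, finite_set (H1 R A) & finite_set (H1 R B)].

Definition finitely_unsplittable (R : realType) (T : topologicalType)
    (h : plStructure R T) : Prop :=
  ~ finitely_splittable h.

(* Main.v *)
From HB Require Import structures.
From Stdlib Require Import Relation_Operators.
From mathcomp Require Import all_boot all_order all_algebra.
From mathcomp Require Import all_classical all_reals all_analysis.
From mathcomp Require Import freeg ring lra zify.
Require Import Defs.

Set Implicit Arguments.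
Unset Strict Implicit.
Unset Printing Implicit Defensive.

Import Order.TTheory GRing.Theory Num.Theory.
Import numFieldNormedType.Exports.

Local Open Scope classical_set_scope.
Local Open Scope ring_scope.

(** Suppose [A] and [B] are proper subpolyhedra covering the dunce hat [X], both
    with finite first homology. A map from such a subpolyhedron to [R / Z] has
    winding number [0] along every cycle, hence lifts to [R]. Neither [A] nor [B]
    contains [J]: radial projection from a missed point of the disk would retract
    [A] onto [J], and the coordinate of [J] would lift. Choose along [J] a maximal
    sequence of [M >= 2] points lying alternately outside [A] and outside [B]; it
    exists because [J] meets [A] in finitely many connected pieces. By maximality
    consecutive points are separated by a switch, before which the arc stays in
    one of the sets and after which it stays in the other. The boundary circle of
    the disk runs over [J] [n >= 3] times; merging the [n] copies of the sequence
    gives a cyclic alternating sequence of [2 k >= n (M - 1)] points.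

    Each run of the circle inside [A] gives, by lifting the bump function carried
    by that run, an integer function on the preimage of [A] which differs from the
    bump by a function of the label; likewise for [B]. An integer function
    [alpha] on the first preimage and [beta] on the second satisfy
    [\sum_j alpha_j (beta_j - beta_(j-1)) = 0] around the circle, since
    [alpha d beta] is closed on the disk. The resulting identity has the form
    [(I + V) (I - S) (I + W)^T = 0] with [S] a cyclic shift of size [k], and the
    ranks of [V] and [W], bounded by the numbers of labels, add up to at most
    [M - 2]. As [I - S] has rank [k - 1], this forces [k < M], contradicting
    [n >= 3]. *)

(** * Maps to the circle [R / Z] *)

(** A bump carried by an arc of the boundary circle with ends outside [A] takes only the values [0]
    and [1] on the part of that circle lying over [A]. Modulo the integers it therefore vanishes
    wherever distinct points are identified, so it descends to [A], and finite homology lifts it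
    there to a real function. The bump corrected by the pullback of that function is integer valued.
    The correction depends only on the image in the hat, hence at a marked point only on its label:
    this is why [V] and [W] have few distinct columns. Subtracting a constant makes one of these
    columns zero in each matrix, which turns the [M] labels into the bound [M - 2].

    The bumps must end at points missed by a set, whereas the pairing needs the circle cut into arcs
    each inside one set. Maximality reconciles the two demands by supplying the switches.

    The count leaves no slack: [2 k >= n (M - 1)] forces [k >= M] when [n >= 3] and [M >= 2], but
    would allow [k = M - 1] if [n = 2] or [M = 1]. *)

Section CentredRemainder.
Context {R : realType}.
Implicit Types a b d x : R.

(** [|crem d|] is the distance from [d] to the nearest integer; it measures distances in [R / Z]
    while all functions stay real valued. *)
Definition crem d : R := d - (Num.floor (d + 2^-1))%:~R.

Lemma crem_le d : `|crem d| <= 2^-1.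
Proof.
have /andP[] := floor_itv (d + 2^-1); rewrite intrD /crem.
set n := _%:~R; rewrite ler_norml => *; lra.
Qed.

Lemma crem_sub_int d : d - crem d \is a Num.int.
Proof. by rewrite /crem subKr intr_int. Qed.

Lemma crem_id d : `|d| < 2^-1 -> crem d = d.
Proof.
rewrite ltr_norml => d2; rewrite /crem (floor_def (m := 0)) ?subr0//.
by rewrite mulr0z mulr1z; lra.
Qed.

Lemma crem_congr a b : a - b \is a Num.int -> crem a = crem b.
Proof.
move=> ab; have -> : a = b + (a - b) by rewrite subrKC.
rewrite /crem (addrAC b (a - b) 2^-1) floorDrz// intrD.
by move: ab; rewrite intrEfloor => /eqP ->; ring.
Qed.

Lemma crem_min d k : k \is a Num.int -> `|crem d| <= `|d - k|.
Proof.
move=> kZ; have [dk|dk] := ltP `|d - k| 2^-1; last exact: le_trans (crem_le _) dk.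
by rewrite (@crem_congr d (d - k)) ?subKr// crem_id.
Qed.

Lemma cremD a b : `|crem (a + b)| <= `|crem a| + `|crem b|.
Proof.
apply: le_trans (ler_normD _ _).
have -> : crem a + crem b = a + b - (a - crem a + (b - crem b)) by ring.
by apply: crem_min; rewrite rpredD ?crem_sub_int.
Qed.

Lemma cremN a : `|crem (- a)| = `|crem a|.
Proof.
have H b : `|crem (- b)| <= `|crem b|.
  have -> : `|crem b| = `|- b + (b - crem b)|.
    by rewrite addrA addNr add0r normrN.
  by rewrite -[X in - b + X]opprK; apply: crem_min; rewrite rpredN crem_sub_int.
by apply/eqP; rewrite eq_le H -{1}[a]opprK H.
Qed.

(** Remainders below a quarter differ by less than one half, so their difference does not wrap
    around. *)
Lemma crem_dist a b : `|crem a| < 4^-1 -> `|crem b| < 4^-1 ->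
  `|crem a - crem b| = `|crem (a - b)|.
Proof.
move=> a4 b4; rewrite -(@crem_id (crem a - crem b)); last first.
  by apply: le_lt_trans (ler_normB _ _) _; lra.
congr `|_|; apply: crem_congr.
have -> : crem a - crem b - (a - b) = (b - crem b) - (a - crem a) by ring.
by rewrite rpredB ?crem_sub_int.
Qed.

End CentredRemainder.

Section ModuloContinuity.
Context {R : realType}.

(* [modcont u] says that [u] is continuous as a map to the circle [R / Z]. *)
Definition modcont (T : topologicalType) (u : T -> R) : Prop :=
  forall x e, 0 < e -> \forall y \near x, `|crem (u y - u x)| < e.

Lemma continuous_modcont (T : topologicalType) (u : T -> R) :
  continuous u -> modcont u.
Proof.
move=> cu x e e0; move/cvgrPdist_lt : (cu x) => /(_ _ e0).
apply: filterS => y; rewrite distrC; apply: le_lt_trans.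
by rewrite -[X in _ <= `|X|]subr0; apply: crem_min.
Qed.

Lemma modcont_comp (S T : topologicalType) (u : T -> R) (g : S -> T) :
  modcont u -> continuous g -> modcont (u \o g).
Proof. by move=> mu cg x e e0; exact: (cg x _ (mu (g x) e e0)). Qed.

Lemma continuous_int_cst (g : R -> R) a b : a <= b ->
  {within `[a, b], continuous g} ->
  (forall x, a <= x <= b -> g x \is a Num.int) -> g a = g b.
Proof.
move=> ab cg gZ.
have aI : a <= a <= b by rewrite lexx.
have bI : a <= b <= b by rewrite ab lexx.
wlog lt_ab : g cg gZ / g a < g b => [th|].
  have [//|lt|->//] := ltgtP (g a) (g b); first exact: th.
  apply/oppr_inj; apply: (th (fun x => - g x)).
  - by move=> x; exact: (cvgN (cg x)).
  - by move=> x /gZ; rewrite rpredN.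
  - by rewrite ltrN2.
have dZ : g b - g a \is a Num.int by rewrite rpredB// gZ.
have d1 : 1 <= g b - g a.
  by have := norm_intr_ge1 dZ; rewrite gtr0_norm ?subr_gt0// subr_eq0 gt_eqF//; exact.
have [|c cab gc] := @IVT R g a b (g a + 2^-1) ab cg.
  by rewrite minElt maxElt lt_ab; lra.
have /gZ cZ : a <= c <= b by move: cab; rewrite in_itv.
have : g c - g a \is a Num.int by rewrite rpredB// gZ.
move/norm_intr_ge1; rewrite gc addrC addKr invr_eq0 pnatr_eq0 => /(_ isT).
by rewrite ger0_norm ?invr_ge0//; lra.
Qed.

(** The lift at [x] follows [u] along the track of the contraction from [x0] to [x], adding up
    centred increments over equal time steps. Compactness makes one step length fine enough for all
    tracks; each increment then stays below a quarter and varies continuously with [x]. *)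
Lemma lift_contractible (T : topologicalType) (h : T * R -> T) (x0 : T)
    (u : T -> R) :
  compact [set: T] -> continuous h ->
  (forall x, h (x, 0) = x0) -> (forall x, h (x, 1) = x) ->
  modcont u ->
  exists2 th : T -> R, continuous th & forall x, th x - u x \is a Num.int.
Proof.
move=> cT ch h0 h1 mu.
have muh : modcont (u \o h) by exact: modcont_comp.
have cTI : compact ([set: T] `*` `[0, 1]%classic : set (T * R)).
  by apply: compact_setX => //; exact: segment_compact.
have [N small] : exists N, forall x k, (k < N.+1)%N ->
    `|crem (u (h (x, k.+1%:R / N.+1%:R)) - u (h (x, k%:R / N.+1%:R)))| < 4^-1.
  pose P (N : nat) (z : T * R) := forall s, `|s - z.2| <= N.+1%:R^-1 ->
    `|crem (u (h (z.1, s)) - u (h z))| < 4^-1.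
  have [] : \forall N \near \oo, ([set: T] `*` `[0, 1]%classic : set (T * R)) `<=` P N.
    apply: (proj1 (compact_near_coveringP _) cTI) => -[x s] _.
    (* The two times [r] and [t] are both compared with [s], and two errors of one eighth make the
       required quarter. *)
    have := muh (x, s) 8^-1; rewrite invr_gt0 ltr0n => /(_ isT)[[/= U V] [Ux]].
    move=> /nbhs_ballP[e/= e0 eV] UV.
    have e2 : 0 < e / 2 by rewrite divr_gt0.
    exists (U `*` ball s (e / 2), [set n : nat | n.+1%:R^-1 < e / 2]).
      split=> /=; last exact: near_infty_natSinv_lt (PosNum e2).
      by exists (U, ball s (e / 2)) => //; split => //; exact: nbhsx_ballx.
    move=> [[y t] n] /= [[/= Uy st] ne] r /= rt.
    have -> : u (h (y, r)) - u (h (y, t)) = (u (h (y, r)) - u (h (x, s))) -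
      (u (h (y, t)) - u (h (x, s))) by ring.
    have H1 : `|crem (u (h (y, r)) - u (h (x, s)))| < 8^-1.
      apply: (UV (y, r)); split => //=; apply: eV; rewrite /ball/= in st *.
      have -> : s - r = (s - t) - (r - t) by ring.
      apply: le_lt_trans (ler_normB _ _) _.
      by rewrite [e]splitr ltrD// (le_lt_trans rt ne).
    have H2 : `|crem (u (h (y, t)) - u (h (x, s)))| < 8^-1.
      apply: (UV (y, t)); split => //=; apply: eV; rewrite /ball/= in st *.
      by apply: lt_trans st _; lra.
    by apply: le_lt_trans (cremD _ _) _; rewrite cremN; lra.
  move=> N _ /(_ N (leqnn N)) PN; exists N => x k kN.
  apply: (PN (x, k%:R / N.+1%:R)) => /=.
    split => //=; rewrite in_itv/= divr_ge0//= ler_pdivrMr ?ltr0n// mul1r ler_nat.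
    exact: ltnW.
  by rewrite -mulrBl -natrB// subSnn mul1r ger0_norm.
pose p k x := u (h (x, k%:R / N.+1%:R)).
pose th x := u x0 + \sum_(0 <= k < N.+1) crem (p k.+1 x - p k x).
exists th => x.
  rewrite /th; apply: cvgD; first exact: cvg_cst.
  under eq_cvg do rewrite big_mkord; rewrite big_mkord.
  apply: cvg_big => [|k _]; first exact: add_continuous.
  apply/cvgrPdist_lt => e e0.
  have e2 : 0 < e / 2 by rewrite divr_gt0.
  have mp j : modcont (p j).
    apply: (@modcont_comp _ _ _ (fun x => h (x, j%:R / N.+1%:R)) mu) => y.
    apply: (cvg_comp (fun x => (x, j%:R / N.+1%:R)) h _ (ch _)).
    exact: (cvg_pair cvg_id (cvg_cst _)).
  apply: filterS2 (mp k.+1 x _ e2) (mp k x _ e2) => y y1 y2.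
  rewrite distrC crem_dist ?small//.
  have -> : p k.+1 y - p k y - (p k.+1 x - p k x) =
    (p k.+1 y - p k.+1 x) - (p k y - p k x) by ring.
  by apply: le_lt_trans (cremD _ _) _; rewrite cremN; lra.
have -> : u x = u x0 + \sum_(0 <= k < N.+1) (p k.+1 x - p k x).
  by rewrite telescope_sumr// /p mul0r h0 divff// h1 subrKC.
rewrite /th opprD addrACA subrr add0r -sumrB big_seq rpred_sum// => k _.
by rewrite -opprB rpredN crem_sub_int.
Qed.

End ModuloContinuity.

(** * Embeddings, and lifting on compact convex sets *)

Section Embeddings.
Context {S T : topologicalType} (e : S -> T).
Hypothesis emb_e : embedding e.

Lemma embedding_continuous : continuous e.
Proof.
by case: emb_e => _ oe; apply/continuousP => V oV; apply/oe; exists V.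
Qed.

Lemma embedding_nbhs (s : S) (U : set S) : nbhs s U ->
  exists2 V, nbhs (e s) V & e @^-1` V `<=` U.
Proof.
case: emb_e => _ oe; rewrite nbhsE => -[W [/oe[V oV ->] Ws] WU].
by exists V => //; exact: open_nbhs_nbhs.
Qed.

Lemma embedding_compact : compact (range e) -> compact [set: S].
Proof.
move=> /compact_near_coveringP ce.
apply/compact_near_coveringP => J F P FF near_P.
suff : \forall i \near F, range e `<=` [set t | forall s, e s = t -> P i s].
  by apply: filterS => i Pi s _; apply: (Pi (e s)) => //; exists s.
apply: ce => _ [s _ <-]; have [[/= U W] [Us FW] UW] := near_P s I.
have [V Vs VU] := embedding_nbhs Us.
exists (V, W); first by split.
move=> [t i] /= [Vt Wi] s' st; apply: (UW (s', i)); split => //=.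
by apply: VU; rewrite /= st.
Qed.

Lemma embedding_hausdorff : hausdorff_space T -> hausdorff_space S.
Proof.
move=> hT x y clxy; case: emb_e => inj_e _; apply: inj_e; apply: hT => A B Ax By.
have [z [Az Bz]] := clxy _ _ (embedding_continuous Ax) (embedding_continuous By).
by exists (e z).
Qed.

Lemma continuous_embedding (U : topologicalType) (g : U -> S) :
  continuous (e \o g) -> continuous g.
Proof.
case: emb_e => _ oe cg; apply/continuousP => _ /oe[V oV ->].
by rewrite -comp_preimage; move/continuousP : cg; exact.
Qed.

End Embeddings.

Lemma set_val_SigSub (T : Type) (A : set T) (x : T) (Ax : x \in A) :
  set_val (SigSub Ax : A) = x.
Proof. by rewrite set_valE. Qed.

Lemma embedding_set_val (T : topologicalType) (A : set T) :
  embedding (set_val : A -> T).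
Proof.
split; first by move=> x y; rewrite set_valE => /val_inj.
by move=> U; split => -[V oV eV]; exists V.
Qed.

Section Convex.
Context {R : realType} {n : nat}.
Implicit Type K : set 'rV[R]_n.

Definition segment_closed K := forall x y (t : R),
  K x -> K y -> 0 <= t <= 1 -> K (x + t *: (y - x)).

Lemma convex_contraction K (x0 : K) : segment_closed K ->
  exists h : K * R -> K, [/\ continuous h, forall x, h (x, 0) = x0 &
    forall x, h (x, 1) = x].
Proof.
(* [h] is to be continuous for every real time, so the time is clamped to the unit interval, where
   the segment stays in [K]. *)
move=> convK; pose clamp (t : R) := Num.min (Num.max t 0) 1.
have clamp_cont : continuous (clamp : R -> R).
  move=> t; apply: (@continuous_min R R (fun s => Num.max s 0) (fun=> 1)).
    apply: (@continuous_max R R id (fun=> 0)); first exact: cvg_id.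
    exact: cvg_cst.
  exact: cvg_cst.
have clampI t : 0 <= clamp t <= 1.
  by rewrite /clamp ge_min lexx orbT andbT le_min ler01 andbT le_max lexx orbT.
have Kh (z : K * R) :
    set_val x0 + clamp z.2 *: (set_val z.1 - set_val x0) \in K.
  by apply/mem_set; apply: convK (clampI _); exact: set_valP.
pose h z : K := SigSub (Kh z); exists h; split.
- apply: (continuous_embedding (@embedding_set_val _ K)) => z.
  apply: cvgD; first exact: cvg_cst.
  apply: cvgZ.
    exact: (cvg_comp snd clamp cvg_snd (clamp_cont _)).
  apply: cvgB; last exact: cvg_cst.
  apply: (cvg_comp fst set_val); first exact: cvg_fst.
  exact: (embedding_continuous (@embedding_set_val _ K)).
- move=> x; apply: val_inj; rewrite /= /clamp maxxx min_l ?ler01//.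
  by rewrite scale0r addr0 set_valE.
- move=> x; apply: val_inj; rewrite /= /clamp max_l ?ler01// minxx scale1r.
  by rewrite subrKC set_valE.
Qed.

Lemma compact_set_type K : compact K -> compact [set: K].
Proof.
move=> cK; apply: (embedding_compact (@embedding_set_val _ K)).
rewrite (_ : range _ = K)//; apply/seteqP; split => [_ [x _ <-]|x Kx].
  exact: set_valP.
by exists (SigSub (mem_set Kx)).
Qed.

Lemma lift_convex K (u : K -> R) : compact K -> segment_closed K -> modcont u ->
  exists2 th : K -> R, continuous th & forall x, th x - u x \is a Num.int.
Proof.
move=> cK convK mu.
have [[x0 _]|noK] := pselect (exists x : K, True); last first.
  by exists u => x; exfalso; apply: noK; exists x.
have [h [ch h0 h1]] := convex_contraction x0 convK.
exact: (lift_contractible (compact_set_type cK) ch h0 h1).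
Qed.

Lemma convex_continuous_int_cst K (g : K -> R) : segment_closed K ->
  continuous g -> (forall x, g x \is a Num.int) -> forall x y, g x = g y.
Proof.
move=> convK cg gZ x y; have [h [ch h0 h1]] := convex_contraction x convK.
rewrite -(h0 y) -[in RHS](h1 y).
apply: (@continuous_int_cst _ (fun s => g (h (y, s)))) => //.
apply: continuous_subspaceT => s.
have cgh z : g (h t) @[t --> z] --> g (h z) := cvg_comp h g (ch z) (cg (h z)).
have cy : (fun t : R => (y, t)) t @[t --> s] --> (y, s).
  exact: (cvg_pair (cvg_cst _) cvg_id).
exact: (cvg_comp _ _ cy (cgh _)).
Qed.

Lemma lift_increment K (th1 th2 u : K -> R) : segment_closed K ->
  continuous th1 -> continuous th2 ->
  (forall x, th1 x - u x \is a Num.int) ->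
  (forall x, th2 x - u x \is a Num.int) ->
  forall x y, th1 x - th1 y = th2 x - th2 y.
Proof.
move=> convK c1 c2 u1 u2 x y.
suff : th1 x - th2 x = th1 y - th2 y by lra.
apply: (@convex_continuous_int_cst K (fun x => th1 x - th2 x)) => // z.
  exact: (cvgB (c1 z) (c2 z)).
have -> : th1 z - th2 z = (th1 z - u z) - (th2 z - u z) by ring.
by rewrite rpredB.
Qed.

End Convex.

(** * Winding numbers of singular chains *)

Section StandardSimplex.
Context {R : realType}.

Lemma segment_closed_stdsimplex n : segment_closed (stdsimplex R n).
Proof.
move=> x y t [x0 x1] [y0 y1] /andP[t0 t1]; split => [j|].
  rewrite !mxE; have -> : x ord0 j + t * (y ord0 j - x ord0 j) =
    (1 - t) * x ord0 j + t * y ord0 j by ring.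
  by rewrite addr_ge0// mulr_ge0// subr_ge0.
under eq_bigr do rewrite !mxE.
by rewrite big_split/= -mulr_sumr sumrB x1 y1 subrr mulr0 addr0.
Qed.

Lemma compact_stdsimplex n : compact (stdsimplex R n).
Proof.
have closed_simplex : closed (stdsimplex R n).
  have -> : stdsimplex R n = \bigcap_j [set t : 'rV_n.+1 | 0 <= t ord0 j] `&`
      [set t : 'rV_n.+1 | \sum_j t ord0 j = 1].
    apply/seteqP; split => t /= [t0 t1]; split => //; first by move=> j _; exact: t0.
    by move=> j; exact: t0.
  apply: closedI.
    apply: closed_bigI => j _.
    exact: (proj1 (continuous_closedP _) (@coord_continuous _ _ _ _ _)
      _ (@closed_ge _ 0)).
  apply: (proj1 (continuous_closedP (fun t : 'rV[R]_n.+1 => \sum_j t ord0 j)) _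
    _ (@closed_eq _ 1)).
  apply: continuous_big => [|j _]; first exact: add_continuous.
  exact: coord_continuous.
have cube : compact [set v : 'rV[R]_n.+1 | forall j, `[0, 1]%classic (v ord0 j)].
  by apply: (@rV_compact R _ (fun=> _)) => _; exact: segment_compact.
apply: (subclosed_compact closed_simplex cube).
move=> t /= [t0 t1] j; rewrite in_itv/= t0/= -t1 (bigD1 j)//=.
by rewrite lerDl sumr_ge0.
Qed.

Lemma vertex_stdsimplex n (j : 'I_n.+1) : delta_mx ord0 j \in stdsimplex R n.
Proof.
apply/mem_set; split => [k|]; first by rewrite mxE.
rewrite (bigD1 j)//= mxE !eqxx big1 ?addr0// => k kj.
by rewrite mxE (negbTE kj) andbF.
Qed.

Definition vertex n (j : 'I_n.+1) : stdsimplex R n :=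
  SigSub (vertex_stdsimplex j).

Lemma face_vertex n (i : 'I_n.+2) (j : 'I_n.+1) :
  face i (vertex j) = vertex (fintype.lift i j).
Proof.
apply: val_inj; apply/rowP => k; rewrite /= !mxE set_valE/=.
case: unliftP => [l ->|->]; last by rewrite eq_liftF.
by rewrite mxE (inj_eq lift_inj).
Qed.

Lemma stdsimplex0_eq (x y : stdsimplex R 0) : x = y.
Proof.
apply: val_inj; apply/rowP => k; rewrite ord1.
have [_] := set_valP x; have [_] := set_valP y.
by rewrite !big_ord1 => -> ->.
Qed.

Lemma lift_stdsimplex n (u : stdsimplex R n -> R) : modcont u ->
  exists2 th, continuous th & forall x, th x - u x \is a Num.int.
Proof.
exact: lift_convex (@compact_stdsimplex n) (@segment_closed_stdsimplex n).
Qed.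

End StandardSimplex.

(** Two properties are proved this way, vanishing and integrality; both are preserved by
    subtraction, and a chain is an integer combination of generators. *)
Lemma freeg_additive_ind (K : choiceType) (M : zmodType) (P : M -> Prop)
    (F : {freeg K / int} -> M) :
  P 0 -> (forall x y, P x -> P y -> P (x - y)) -> additive F ->
  (forall x, P (F << x >>)) -> forall c, P (F c).
Proof.
move=> P0 PB addF PU c.
pose Fa : {additive {freeg K / int} -> M} :=
  HB.pack F (GRing.isZmodMorphism.Build _ _ F addF).
have PN x : P x -> P (- x) by rewrite -sub0r; exact: PB.
have PD x y : P x -> P y -> P (x + y) by rewrite -{2}[y]opprK => Px /PN; exact: PB.
have Pn x n : P x -> P (x *+ n).
  by move=> Px; elim: n => [|n IHn]; rewrite ?mulr0n// mulrS; exact: PD.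
rewrite -(freeg_sumE c) -[F _]/(Fa _) raddf_sum; apply: big_ind => // x _.
rewrite -[coeff x c]intz -freegU_mulz raddfMz /=; case: (coeff x c) => m /=; first exact: Pn.
by apply: PN; exact: Pn.
Qed.

Section Winding.
Context {R : realType} {T : topologicalType} (u : T -> R).
Hypothesis mu : modcont u.

Lemma lift_singular n (s : singular R T n) :
  exists2 th : stdsimplex R n -> R, continuous th &
    forall x, th x - u (s x) \is a Num.int.
Proof.
by apply: lift_stdsimplex; apply: modcont_comp => //; exact: cts_fun.
Qed.

(** By [lift_increment] the choice of the lift is immaterial. The codomain is [R] seen as a module
    over the integers, as the linear extension [fglift] expects. *)
Definition winding (s : singular R T 1) : zmodule R :=
  let th := projT1 (cid2 (lift_singular s)) in
  th (vertex ord_max) - th (vertex ord0).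

Lemma windingE (s : singular R T 1) (th : stdsimplex R 1 -> R) :
  continuous th -> (forall x, th x - u (s x) \is a Num.int) ->
  winding s = th (vertex ord_max) - th (vertex ord0).
Proof.
move=> cth thu; rewrite /winding; case: cid2 => th' cth' th'u /=.
exact: (lift_increment (@segment_closed_stdsimplex _ _) cth' cth th'u thu).
Qed.

Definition chain_winding : chain R T 1 -> R := fglift winding.

Lemma chain_winding_additive : additive chain_winding.
Proof.
exact: (@lift_is_additive int (singular R T 1) (zmodule R) winding).
Qed.

Lemma boundary_additive n : additive (@boundary R T n).
Proof. exact: lift_is_additive. Qed.

(** A lift along the whole singular triangle turns the windings of its three faces into differences
    of values at the vertices, and these cancel. *)
Lemma chain_winding_boundary c : chain_winding (@boundary R T 1 c) = 0.
Proof.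
apply: (@freeg_additive_ind _ _ (fun x : R => x = 0)
  (chain_winding \o @boundary R T 1)) => //.
- by move=> x y -> ->; rewrite subrr.
- by move=> x y /=; rewrite boundary_additive chain_winding_additive.
move=> s /=; rewrite /boundary liftU scale1r !big_ord_recl big_ord0 /=.
rewrite addr0 expr0 expr1 scale1r scaleN1r sqrrN expr1n scale1r.
rewrite [X in chain_winding (_ + X)]addrC -opprB.
have W x : chain_winding << x >> = winding x.
  by rewrite /chain_winding liftU scale1r.
have [th cth thu] := lift_singular s.
have Wf (i : 'I_3) : winding (s \o @face R 1 i) =
    th (face i (vertex ord_max)) - th (face i (vertex ord0)).
  apply: (@windingE (s \o @face R 1 i) (th \o @face R 1 i)) => x.
    exact: (cvg_comp _ _ (@face_continuous R 1 i x) (cth _)).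
  exact: thu.
rewrite !(chain_winding_additive, W) !Wf !face_vertex.
have e1 : fintype.lift ord0 ord_max = ord_max :> 'I_3 by exact: val_inj.
have e2 : fintype.lift ord0 ord0 = 1 :> 'I_3 by exact: val_inj.
have e3 : fintype.lift (fintype.lift ord0 ord0) ord_max = ord_max :> 'I_3.
  exact: val_inj.
have e4 : fintype.lift (fintype.lift ord0 ord0) ord0 = ord0 :> 'I_3.
  exact: val_inj.
have e5 : fintype.lift (fintype.lift ord0 (fintype.lift ord0 ord0)) ord_max = 1
  :> 'I_3 by exact: val_inj.
have e6 : fintype.lift (fintype.lift ord0 (fintype.lift ord0 ord0)) ord0 = ord0
  :> 'I_3 by exact: val_inj.
by rewrite e1 e5 e6 e3 e4 e2; ring.
Qed.

End Winding.

Section FiniteH1.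
Context {R : realType} {T : topologicalType} (u : T -> R).
Hypothesis mu : modcont u.
Local Notation W := (chain_winding mu).

Definition vertex_sum : chain R T 0 -> R :=
  fglift (fun s : singular R T 0 => u (s (vertex ord0)) : zmodule R).

Lemma vertex_sum_additive : additive vertex_sum.
Proof.
exact: (@lift_is_additive int (singular R T 0) (zmodule R)
  (fun s => u (s (vertex ord0)))).
Qed.

Definition point_simplex (x : T) : singular R T 0 :=
  mkcts (@cst_continuous (stdsimplex R 0) T x).

Lemma singular0E (s : singular R T 0) : s = point_simplex (s (vertex ord0)).
Proof.
by apply/continuousEP => x; rewrite (stdsimplex0_eq x (vertex ord0)).
Qed.

Definition point_chain (x : T) : chain R T 0 := << point_simplex x >>.

Lemma vertex_sum_point x : vertex_sum (point_chain x) = u x.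
Proof. by rewrite /vertex_sum liftU scale1r. Qed.

Lemma chain_winding_singular (s : singular R T 1) : W << s >> = winding mu s.
Proof. by rewrite /chain_winding liftU scale1r. Qed.

Lemma boundary_singular1 (s : singular R T 1) :
  @boundary R T 0 << s >> =
  point_chain (s (vertex ord_max)) - point_chain (s (vertex ord0)).
Proof.
rewrite /boundary liftU scale1r !big_ord_recl big_ord0 addr0 /=.
rewrite expr0 expr1 scale1r scaleN1r.
rewrite [X in << X >> - _]singular0E [X in _ - << X >>]singular0E /= !face_vertex.
by congr (point_chain (s (vertex _)) - point_chain (s (vertex _))); exact: val_inj.
Qed.

Lemma boundary0 n : @boundary R T n 0 = 0.
Proof. by rewrite -[X in boundary X](subrr 0) boundary_additive subrr. Qed.

Lemma chain_winding_int c : W c - vertex_sum (@boundary R T 0 c) \is a Num.int.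
Proof.
apply: (@freeg_additive_ind _ _ (fun x : R => x \is a Num.int)
  (fun c => W c - vertex_sum (@boundary R T 0 c))) => //.
- by move=> x y; exact: rpredB.
- move=> x y /=.
  by rewrite boundary_additive vertex_sum_additive chain_winding_additive; ring.
move=> s; rewrite boundary_singular1 vertex_sum_additive !vertex_sum_point.
rewrite chain_winding_singular; have [th cth thu] := lift_singular mu s.
rewrite (windingE mu cth thu).
set x := vertex _; set y := vertex _.
have -> : th x - th y - (u (s x) - u (s y)) =
  (th x - u (s x)) - (th y - u (s y)) by ring.
by rewrite rpredB.
Qed.

Lemma finite_H1_chain_winding z : finite_set (H1 R T) ->
  @boundary R T 0 z = 0 -> W z = 0.
Proof.
move=> finH z0.
(* All multiples of the cycle [z] are cycles. Finiteness makes two of their cosets agree, so a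
   nonzero multiple of the winding of [z] vanishes. *)
pose coset (k : nat) := [set z' | range (@boundary R T 1) (z' - z *+ k)].
have Wmul k : W (z *+ k) = W z *+ k.
  pose Wa : {additive chain R T 1 -> R} :=
    HB.pack W (GRing.isZmodMorphism.Build _ _ W (chain_winding_additive mu)).
  by rewrite -[W]/(Wa : _ -> _) raddfMn.
have [k [l [kl ckl]]] : exists k l, k <> l /\ coset k = coset l.
  apply: contrapT => noKL; apply: infinite_nat.
  have cosetH1 : coset @^-1` H1 R T = setT.
    apply/seteqP; split=> // k _; exists (z *+ k) => //=.
    pose da : {additive chain R T 1 -> chain R T 0} :=
      HB.pack (@boundary R T 0)
        (GRing.isZmodMorphism.Build _ _ _ (@boundary_additive R T 0)).
    by rewrite -[boundary _]/(da _) raddfMn /= z0 mul0rn.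
  rewrite -cosetH1; apply: finite_preimage finH => k l _ _ ckl.
  by apply: contrapT => kl; apply: noKL; exists k, l.
have [c _ ce] : coset l (z *+ k) by rewrite -ckl /coset /= subrr; exists 0; rewrite ?boundary0.
have : W (z *+ k) - W (z *+ l) = 0.
  by rewrite -chain_winding_additive -ce chain_winding_boundary.
rewrite !Wmul; move: (W z) => w /eqP.
by rewrite -(mulr_natr w k) -(mulr_natr w l) -mulrBr mulf_eq0 subr_eq0 eqr_nat => /orP[/eqP//|/eqP].
Qed.

(** The lift adds to [u] at a base point the winding of a chain from there; cycles have winding
    zero, so the choice of chain is immaterial. Continuity is tested on the finitely many compact
    images of simplices, where the result differs by a constant from a continuous lift on the
    simplex. *)
Lemma lift_of_finite_H1 (ss : seq (set T)) :
  hausdorff_space T -> finite_set (H1 R T) ->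
  (forall x, exists2 K, K \in ss & K x) ->
  (forall K, K \in ss -> exists n (rho : stdsimplex R n -> T),
     continuous rho /\ range rho = K) ->
  exists2 th : T -> R, continuous th & forall x, th x - u x \is a Num.int.
Proof.
move=> hT finH cover simp.
have [[x0 _]|noT] := pselect (exists x : T, True); last first.
  by exists u => x; exfalso; apply: noT; exists x.
(* Linked points are homologous as 0-chains. Picking the base point from the whole class makes it
   the same for all points of the class. *)
pose linked x y := exists c, @boundary R T 0 c = point_chain x - point_chain y.
have linked_sym x y : linked x y -> linked y x.
  move=> [c ce]; exists (0 - c).
  by rewrite boundary_additive ce boundary0 sub0r opprB.
have linked_trans y x z : linked x y -> linked y z -> linked x z.
  move=> [c ce] [d de]; exists (c - (0 - d)).
  by rewrite !boundary_additive ce de boundary0; rewrite sub0r opprK addrA subrK.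
have [rep repP] : {rep : set T -> T & forall S, S !=set0 -> S (rep S)}.
  apply: (@choice _ _ (fun S y => S !=set0 -> S y)) => S.
  by have [[y Sy]|S0] := pselect (S !=set0); [exists y|exists x0].
pose base x := rep (linked x).
have [cx cxP] : {cx : T -> chain R T 1 &
    forall x, @boundary R T 0 (cx x) = point_chain x - point_chain (base x)}.
  apply: (@choice _ _ (fun x c =>
    @boundary R T 0 c = point_chain x - point_chain (base x))) => x.
  apply: (repP (linked x)); exists x; exists 0.
  by rewrite boundary0 subrr.
have linked_base x y : linked x y -> base x = base y.
  move=> xy; congr rep; apply/seteqP; split => z /=.
    by apply: linked_trans; exact: linked_sym.
  exact: linked_trans.
pose th x := u (base x) + W (cx x).
have thB c x y : @boundary R T 0 c = point_chain x - point_chain y ->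
    th x - th y = W c.
  move=> ce; rewrite /th (linked_base x y); last by exists c.
  have : W (cx x - cx y - c) = 0.
    apply: finite_H1_chain_winding => //.
    rewrite !boundary_additive !cxP ce (linked_base x y); last by exists c.
    by rewrite opprB addrA subrK subrr.
  rewrite !chain_winding_additive; lra.
have thu x : th x - u x \is a Num.int.
  have := chain_winding_int (cx x).
  rewrite cxP vertex_sum_additive !vertex_sum_point.
  by rewrite (_ : W _ - _ = th x - u x)// /th; ring.
exists th => //.
have thK n (rho : stdsimplex R n -> T) : continuous rho -> continuous (th \o rho).
  move=> crho.
  have [a0 _] : exists a : stdsimplex R n, True by exists (vertex ord0).
  have [nu cnu nuu] := lift_stdsimplex (modcont_comp mu crho).
  have -> : th \o rho = fun a => nu a + (th (rho a0) - nu a0).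
    apply/funext => a /=.
    have [h [ch h0 h1]] := convex_contraction a0 (@segment_closed_stdsimplex R n).
    pose last_coord (t : stdsimplex R 1) : R := set_val t ord0 ord_max.
    have ccoord : continuous last_coord.
      move=> t; exact: (cvg_comp _ _
        (embedding_continuous (@embedding_set_val _ (stdsimplex R 1)) (x := t))
        (@coord_continuous R 1 2 ord0 ord_max (set_val t))).
    (* The segment from [a0] to [a] as a singular path, with the last barycentric coordinate as
       time. *)
    pose gam (t : stdsimplex R 1) := h (a, last_coord t).
    have cgam : continuous gam.
      move=> t.
      have cpair : (a, last_coord s) @[s --> t] --> (a, last_coord t).
        exact: (cvg_pair (cvg_cst _) (ccoord t)).
      exact: (cvg_comp _ h cpair (ch _)).
    have gam0 : gam (vertex ord0) = a0 by rewrite /gam /last_coord set_valE mxE/= h0.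
    have gam1 : gam (vertex ord_max) = a by rewrite /gam /last_coord set_valE mxE/= h1.
    have crg : continuous (rho \o gam).
      by move=> t; exact: (cvg_comp gam rho (cgam t) (crho _)).
    pose s : singular R T 1 := mkcts crg.
    have s0 : s (vertex ord0) = rho a0 by rewrite -[in RHS]gam0.
    have s1 : s (vertex ord_max) = rho a by rewrite -[in RHS]gam1.
    have := @thB << s >> (rho a) (rho a0); rewrite boundary_singular1 s0 s1.
    move=> /(_ erefl); rewrite chain_winding_singular.
    have cng : continuous (nu \o gam).
      by move=> t; exact: (cvg_comp gam nu (cgam t) (cnu _)).
    rewrite (@windingE _ _ u mu s (nu \o gam) cng); last by move=> t; exact: nuu.
    rewrite /= gam0 gam1; lra.
  by move=> a; exact: (cvgD (cnu a) (cvg_cst _)).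
apply/continuous_closedP => C cC.
have -> : th @^-1` C = \bigcup_(K in [set` ss]) (K `&` th @^-1` C).
  apply/seteqP; split=> [x Cx|x [K _ []]//].
  by have [K Kss Kx] := cover x; exists K.
apply: closed_bigcup => [|K /= Kss]; first exact: finite_seq.
have [n [rho [crho <-]]] := simp K Kss.
apply: compact_closed => //.
have -> : range rho `&` th @^-1` C = rho @` ((th \o rho) @^-1` C).
  apply/seteqP; split=> [_ [[a _ <-] Ca]|_ [a Ca <-]]; first by exists a.
  by split => //; exists a.
apply: continuous_compact; first exact: continuous_subspaceT.
apply: (subclosed_compact _ (compact_set_type (@compact_stdsimplex R n))) => //.
by move/continuous_closedP : (thK n rho crho); exact.
Qed.

End FiniteH1.

(** * Polyhedra *)

Section Polytopes.
Context {R : realType} {n : nat}.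
Implicit Types (K : set 'rV[R]_n) (s : seq 'rV[R]_n).

Lemma segment_closedP K : convex_set K <-> segment_closed K.
Proof.
split=> [cK x y t Kx Ky t01|sK x y l /set_mem Kx /set_mem Ky].
  have [t0 t1] := andP t01.
  have := cK y x (Itv01 t0 t1) (mem_set Ky) (mem_set Kx).
  move/set_mem; congr (K _).
  by rewrite /conv/= scalerBr scalerBl scale1r addrCA.
apply/mem_set; have := sK _ _ l%:num Ky Kx.
rewrite ge0 le1 => /(_ isT); congr (K _).
by rewrite /conv/= scalerBr scalerBl scale1r addrCA.
Qed.

Lemma segment_closed_polytope s : segment_closed (polytope s).
Proof.
move=> x y t sx sy t01 K [cK sK].
by apply: (proj1 (segment_closedP K) cK) => //; [exact: sx|exact: sy].
Qed.

Lemma polytope_min s K : segment_closed K -> (forall x, x \in s -> K x) ->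
  polytope s `<=` K.
Proof. by move=> cK sK; apply: smallest_sub => //; exact/segment_closedP. Qed.

Lemma mem_polytope s x : x \in s -> polytope s x.
Proof. by move=> xs K [_]; exact. Qed.

Lemma polytope_nil : polytope [::] = set0 :> set 'rV[R]_n.
Proof. by rewrite -subset0; apply: polytope_min. Qed.

Lemma convex_combination m K (p : 'I_m.+1 -> 'rV[R]_n) (c : 'I_m.+1 -> R) :
  segment_closed K -> (forall i, K (p i)) -> (forall i, 0 <= c i) ->
  \sum_i c i = 1 -> K (\sum_i c i *: p i).
Proof.
move=> cK; elim: m p c => [|m IHm] p c Kp c0 c1.
  by move: c1; rewrite !big_ord1 => ->; rewrite scale1r.
rewrite big_ord_recl; set d := \sum_(i < m.+1) c (fintype.lift ord0 i).
have cd : c ord0 + d = 1 by rewrite -c1 big_ord_recl.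
have d0 : 0 <= d by exact: sumr_ge0.
have [dz|dn] := eqVneq d 0.
  rewrite big1 ?addr0.
    by move: cd; rewrite dz addr0 => ->; rewrite scale1r.
  move=> i _; have /eqP := dz; rewrite psumr_eq0//.
  by move=> /allP /(_ i); rewrite mem_index_enum => /(_ isT)/eqP ->; rewrite scale0r.
have -> : \sum_(i < m.+1) c (fintype.lift ord0 i) *: p (fintype.lift ord0 i) =
    d *: \sum_(i < m.+1) (c (fintype.lift ord0 i) / d) *: p (fintype.lift ord0 i).
  rewrite scaler_sumr; apply: eq_bigr => i _.
  by rewrite scalerA mulrCA divff// mulr1.
set y := \sum_(i < m.+1) _.
have -> : c ord0 *: p ord0 + d *: y = p ord0 + d *: (y - p ord0).
  have -> : c ord0 = 1 - d by rewrite -cd addrK.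
  by rewrite scalerBr scalerBl scale1r -addrA [X in _ + X]addrC.
apply: cK => //; last by rewrite d0 -cd lerDr c0.
apply: IHm => // [i|]; first by rewrite divr_ge0.
by rewrite -mulr_suml divff.
Qed.

(** The index [(size s).-1] gives the simplex [size s] vertices when [s] is not empty. For the empty
    list one vertex remains although the polytope is empty, whence the hypothesis on [size s] in
    [polytopeE]. *)
Definition combination s (c : stdsimplex R (size s).-1) : 'rV[R]_n :=
  \sum_j set_val c ord0 j *: s`_j.

Lemma combination_continuous s : continuous (@combination s).
Proof.
pose f (t : 'rV[R]_(size s).-1.+1) := \sum_j t ord0 j *: s`_j.
have cf : continuous f.
  apply: continuous_big => [|j _ t]; first exact: add_continuous.
  exact: cvgZ (@coord_continuous _ _ _ _ _ _) (cvg_cst _).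
move=> c; exact: (cvg_comp _ _
  (embedding_continuous (@embedding_set_val _ (stdsimplex R _)) (x := c))
  (cf (set_val c))).
Qed.

Lemma polytopeE s : (0 < size s)%N -> polytope s = range (@combination s).
Proof.
move=> s0; apply/seteqP; split => [|_ [c _ <-]].
  apply: polytope_min => [_ _ t [x _ <-] [y _ <-] t01|x xs].
    have xyt := segment_closed_stdsimplex (set_valP x) (set_valP y) t01.
    exists (SigSub (mem_set xyt)) => //; rewrite /combination.
    rewrite -sumrB scaler_sumr -big_split/=; apply: eq_bigr => j _.
    by rewrite set_valE/= !mxE scalerDl -scalerA scalerBl.
  have xi : (index x s < (size s).-1.+1)%N by rewrite prednK// index_mem.
  exists (vertex (Ordinal xi)) => //; rewrite /combination (bigD1 (Ordinal xi))//=.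
  rewrite big1 ?addr0 => [|j jx].
    by rewrite set_valE/= mxE !eqxx scale1r nth_index.
  by rewrite set_valE/= mxE (negbTE jx) scale0r.
have [c0 c1] := set_valP c.
apply: (convex_combination (@segment_closed_polytope s)) => // i.
apply: mem_polytope; apply: mem_nth.
exact: leq_trans (ltn_ord i) (eq_leq (prednK s0)).
Qed.

Lemma polytope_closed s : closed (polytope s).
Proof.
have [/size0nil ->|s0] := posnP (size s).
  by rewrite polytope_nil; exact: closed0.
apply: compact_closed; first exact: norm_hausdorff.
rewrite polytopeE//; apply: continuous_compact.
  by apply: continuous_subspaceT; exact: combination_continuous.
exact: (compact_set_type (@compact_stdsimplex R _)).
Qed.

Lemma polyhedron_closed K : polyhedron K -> closed K.
Proof.
move=> [ss ->]; apply: closed_bigcup => [|s _]; first exact: finite_seq.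
exact: polytope_closed.
Qed.

End Polytopes.

Section Subpolyhedra.
Context {R : realType} {T : topologicalType} (h : plStructure R T).

Lemma pl_hausdorff : hausdorff_space T.
Proof.
exact: embedding_hausdorff (pl_chart_embedding h) (@norm_hausdorff _ _).
Qed.

Lemma subpolyhedron_closed (A : set T) : subpolyhedron h A -> closed A.
Proof.
move=> pA; have -> : A = h @^-1` (h @` A).
  apply/seteqP; split=> [x Ax|x [y Ay]]; first by exists x.
  by case: (pl_chart_embedding h) => inj_h _ /inj_h <-.
have := embedding_continuous (pl_chart_embedding h) => /continuous_closedP; apply.
exact: polyhedron_closed.
Qed.

Lemma lift_subpolyhedron (A : set T) (u : A -> R) :
  subpolyhedron h A -> finite_set (H1 R A) -> modcont u ->
  exists2 th : A -> R, continuous th & forall x, th x - u x \is a Num.int.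
Proof.
move=> [ss hA] finH mu; have emb_h := pl_chart_embedding h.
have emb_A : embedding (set_val : A -> T) := @embedding_set_val _ A.
pose piece s : set A := [set x | polytope s (h (set_val x))].
(* Empty lists are dropped: their polytope is empty, hence not the image of a simplex. *)
apply: (@lift_of_finite_H1 _ _ u mu [seq piece s | s <- ss & (0 < size s)%N]) => //.
- exact: embedding_hausdorff emb_A pl_hausdorff.
- move=> x; have : (h @` A) (h (set_val x)) by exists (set_val x) => //; exact: set_valP.
  rewrite hA => -[s /= sss sx]; exists (piece s) => //.
  apply/mapP; exists s => //; rewrite mem_filter sss andbT lt0n.
  by apply/eqP => /size0nil s0; move: sx; rewrite s0 polytope_nil.
move=> K /mapP[s]; rewrite mem_filter => /andP[s0 sss] ->.
have [rho rhoP] : {rho : stdsimplex R (size s).-1 -> A &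
    forall c, h (set_val (rho c)) = combination c}.
  apply: (@choice _ _ (fun c x => h (set_val x) = combination c)) => c.
  have : (h @` A) (combination c).
    by rewrite hA; exists s => //; rewrite polytopeE//; exists c.
  by move=> [x Ax <-]; exists (SigSub (mem_set Ax)); rewrite set_valE.
exists (size s).-1, rho; split.
  apply: (continuous_embedding emb_A); apply: (continuous_embedding emb_h).
  rewrite (_ : _ \o _ = @combination _ _ s); first exact: combination_continuous.
  by apply/funext => c /=; exact: rhoP.
apply/seteqP; split=> [_ [c _ <-]|x]; first by rewrite /piece/= rhoP polytopeE//; exists c.
rewrite /piece/= polytopeE// => -[c _ cx]; exists c => //.
by apply: (proj1 emb_A); apply: (proj1 emb_h); rewrite rhoP.
Qed.

End Subpolyhedra.

(** * The pairing around the circle *)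

Section CyclicPairing.
Context {F : fieldType}.

(** Column [j] is determined by [kap j] and vanishes when [kap j] is [0], so [p + 1] possible values
    of [kap] leave only [p] dimensions. *)
Lemma mxrank_repeated_columns k p (g : 'I_k -> nat -> F) (kap : 'I_k -> nat) :
  (forall j, kap j <= p)%N ->
  (\rank (\matrix_(i, j) (g i (kap j) - g i 0%N) : 'M[F]_k)%R <= p)%N.
Proof.
move=> kp.
have -> : \matrix_(i, j) (g i (kap j) - g i 0%N) =
    \matrix_(i < k, s < p) (g i s.+1 - g i 0%N) *m
    \matrix_(s < p, j < k) (kap j == s.+1)%:R.
  apply/matrixP => i j; rewrite !mxE.
  case kj : (kap j) (kp j) => [|m] mp.
    by rewrite subrr big1// => s _; rewrite !mxE kj mulr0.
  rewrite (bigD1 (Ordinal mp))//= !mxE kj eqxx mulr1 big1 ?addr0// => s sm.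
  move: sm; rewrite -val_eqE /= => /negbTE sm.
  by rewrite !mxE kj eqSS eq_sym sm mulr0.
exact: leq_trans (mxrankM_maxr _ _) (rank_leq_row _).
Qed.

Lemma mxrank_add_scalar1 k (X : 'M[F]_k) : (k <= \rank (1%:M + X)%R + \rank X)%N.
Proof.
rewrite -{1}(mxrank1 F k) -{1}(addrK X 1%:M) -[in X in (_ <= _ + X)%N]mxrank_opp.
exact: mxrank_add.
Qed.

Definition cyclic_difference k : 'M[F]_k :=
  \matrix_(i, j) ((i == j)%:R - (j == ord_pred i)%:R).

(** A row vector killed by the difference is invariant under the cyclic shift, hence constant. *)
Lemma mxrank_cyclic_difference k : (k <= \rank (cyclic_difference k.+1))%N.
Proof.
suff : (\rank (kermx (cyclic_difference k.+1)) <= 1)%N.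
  by rewrite mxrank_ker; lia.
apply: leq_trans (rank_leq_row (const_mx 1 : 'rV[F]_k.+1)).
apply: mxrankS; apply/rV_subP => v /sub_kermxP vD.
have step j : v ord0 (ordS j) = v ord0 j.
  have /matrixP/(_ ord0 j) := vD; rewrite !mxE.
  under eq_bigr do rewrite mxE mulrBr.
  rewrite sumrB (bigD1 j)//= eqxx mulr1 big1 ?addr0 => [|i ij]; last first.
    by rewrite (negbTE ij) mulr0.
  rewrite (bigD1 (ordS j))//= ordSK eqxx mulr1 big1 ?addr0 => [/eqP|i ij].
    by rewrite subr_eq0 => /eqP.
  by rewrite -[j]ordSK (inj_eq (can_inj (@ord_predK _))) eq_sym (negbTE ij) mulr0.
have vE m (mk : (m < k.+1)%N) : v ord0 (Ordinal mk) = v ord0 ord0.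
  elim: m mk => [|m IHm] mk; first by congr (v _ _); exact: val_inj.
  rewrite -(IHm (ltnW mk)) -(step (Ordinal (ltnW mk))); congr (v _ _); apply: val_inj => /=.
  by rewrite modn_small.
apply/sub_rVP; exists (v ord0 ord0); apply/rowP => -[m mk].
by rewrite !mxE mulr1 vE.
Qed.

(** In size [k + 1] the outer factors have ranks at least [k + 1 - pA] and [k + 1 - pB], the middle
    one at least [k]. Sylvester's inequality, used twice, bounds the rank of the zero product below
    by [k - pA - pB]. *)
Lemma cyclic_pairing_bound k pA pB (a b : 'I_k.+1 -> 'I_k.+1 -> F)
    (gA gB : 'I_k.+1 -> nat -> F) (kapA kapB : 'I_k.+1 -> nat) :
  (forall j, kapA j <= pA)%N -> (forall j, kapB j <= pB)%N ->
  (forall i j, a i j = (i == j)%:R + (gA i (kapA j) - gA i 0%N)) ->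
  (forall i j, b i j = (i == j)%:R + (gB i (kapB j) - gB i 0%N)) ->
  (forall i i', \sum_j a i j * (b i' j - b i' (ord_pred j)) = 0) ->
  (k <= pA + pB)%N.
Proof.
move=> kA kB aE bE ab0.
have rA := mxrank_repeated_columns gA kA.
have rB := mxrank_repeated_columns gB kB.
set X := \matrix_(i, j) _ in rA; set Y := \matrix_(i, j) _ in rB.
have rX := mxrank_add_scalar1 X; have rY := mxrank_add_scalar1 Y.
have rD := mxrank_cyclic_difference k.
have D0 : (1%:M + X) *m (cyclic_difference k.+1 *m (1%:M + Y)^T) = 0.
  apply/matrixP => i i'; rewrite !mxE -[RHS](ab0 i i').
  apply: eq_bigr => j _; congr (_ * _); first by rewrite aE !mxE.
  rewrite mxE; under eq_bigr do rewrite mxE mulrBl.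
  rewrite sumrB (bigD1 j)//= eqxx mul1r big1 ?addr0 => [|l lj]; last first.
    by rewrite eq_sym (negbTE lj) mul0r.
  rewrite (bigD1 (ord_pred j))//= eqxx mul1r big1 ?addr0 => [|l lj]; last first.
    by rewrite (negbTE lj) mul0r.
  by rewrite !bE !mxE.
have := mxrank_mul_min (1%:M + X) (cyclic_difference k.+1 *m (1%:M + Y)^T).
have := mxrank_mul_min (cyclic_difference k.+1) (1%:M + Y)^T.
rewrite D0 mxrank0 mxrank_tr.
lia.
Qed.

End CyclicPairing.

Lemma continuous_within_image (U V W : topologicalType) (C : set V) (D : set U)
    (f : V -> W) (g : U -> V) : {within C, continuous f} -> continuous g ->
  (forall x, D x -> C (g x)) -> {within D, continuous (f \o g)}.
Proof.
move=> /subspace_continuousP cf cg DC; apply/subspace_continuousP => x Dx N Nx.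
have H : \forall y \near x, C (g y) -> N (f (g y)).
  exact: (cg x _ (cf (g x) (DC _ Dx) N Nx)).
change (\forall y \near x, D y -> N (f (g y))).
by apply: filterS H => y H Dy; exact: H (DC _ Dy).
Qed.

Lemma within_continuousM (R : realType) (S : topologicalType) (A : set S)
    (f g : S -> R) : {within A, continuous f} -> {within A, continuous g} ->
  {within A, continuous (fun x => f x * g x)}.
Proof.
by move=> cf cg x; have cfx := cf x; have cgx := cg x; exact: (cvgM cfx cgx).
Qed.

Lemma within_continuousB (R : realType) (S : topologicalType) (A : set S)
    (f g : S -> R) : {within A, continuous f} -> {within A, continuous g} ->
  {within A, continuous (fun x => f x - g x)}.
Proof.
by move=> cf cg x; have cfx := cf x; have cgx := cg x; exact: (cvgB cfx cgx).
Qed.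

Section Pairing.
Context {R : realType} {S : topologicalType}.
Hypothesis liftS : forall u : S -> R, modcont u ->
  exists2 th : S -> R, continuous th & forall x, th x - u x \is a Num.int.
Variables (A B : set S) (alpha beta : S -> R).
Hypotheses (clA : closed A) (clB : closed B) (AB : A `|` B = setT).
Hypotheses (calpha : {within A, continuous alpha}) (cbeta : continuous beta).
Hypotheses (Zalpha : forall x, A x -> alpha x \is a Num.int)
  (Zbeta : forall x, B x -> beta x \is a Num.int).

(* [d alpha = 0] on [A] and [d beta = 0] on [B], so [alpha (d beta)] is closed;
   [th] is a primitive of it modulo the integers. *)
Lemma pairing_primitive : exists th : S -> R,
  [/\ continuous th, forall x, A x -> th x - alpha x * beta x \is a Num.int &
    forall x, B x -> th x \is a Num.int].
Proof.
pose u x := if x \in A then alpha x * beta x else 0.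
have uA x : A x -> u x = alpha x * beta x by move=> Ax; rewrite /u mem_set.
have uB x : B x -> u x \is a Num.int.
  move=> Bx; rewrite /u; case: ifPn => [/set_mem Ax|_]; last exact: rpred0.
  by rewrite rpredM ?Zalpha ?Zbeta.
(* [u] may jump where [A] is left, but this happens inside [B], where [u] is an integer and the jump
   is invisible modulo the integers. *)
have mu : modcont u.
  move=> x e e0.
  have nearA : \forall y \near x, A y -> A x /\ `|u y - u x| < e.
    have [Ax|nAx] := pselect (A x); last first.
      have : \forall y \near x, (~` A) y by apply: open_nbhs_nbhs; split => //; exact: closed_openC.
      by apply: filterS => y nAy Ay; case: nAy.
    have cab : {within A, continuous (fun x => alpha x * beta x)}.
      have cbw : {within A, continuous beta} by exact: continuous_subspaceT.
      exact: within_continuousM.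
    move/subspace_continuousP : cab => /(_ x Ax)/cvgrPdist_lt/(_ _ e0).
    move=> H; have {H} : \forall y \near x, A y ->
      `|alpha x * beta x - alpha y * beta y| < e by exact: H.
    by apply: filterS => y H Ay; split => //; rewrite uA// uA// distrC; exact: H.
  have nearB : \forall y \near x, B y -> B x.
    have [Bx|nBx] := pselect (B x); first exact: nearW.
    have : \forall y \near x, (~` B) y by apply: open_nbhs_nbhs; split => //; exact: closed_openC.
    by apply: filterS => y nBy By; case: nBy.
  apply: filterS2 nearA nearB => y yA yB.
  have [Ay|nAy] := pselect (A y).
    have [_ H] := yA Ay; apply: le_lt_trans H.
    by rewrite -[X in _ <= `|X|]subr0; exact: crem_min.
  have By : B y by have : (A `|` B) y by [rewrite AB|]; case.
  apply: le_lt_trans e0.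
  have := @crem_min _ (u y - u x) (u y - u x).
  rewrite subrr normr0; apply.
  by apply: rpredB; apply: uB => //; exact: yB.
have [th cth thu] := liftS mu; exists th; split => // x Xx.
  by rewrite -uA//; exact: thu.
by rewrite -[th x](subrK (u x)) rpredD// uB.
Qed.

Variables (E : R -> S) (K : nat) (y : nat -> R).
Hypotheses (cE : continuous E) (E01 : E 0 = E 1).
Hypotheses (y0 : 0 <= y 0%N) (y1 : y K.*2.+1 <= 1).
Hypothesis y_mono : forall j, (j < K.*2.+1)%N -> y j <= y j.+1.
Hypotheses (Astart : forall t, 0 <= t <= y 0%N -> A (E t))
  (Aend : forall t, y K.*2.+1 <= t <= 1 -> A (E t)).
Hypotheses
  (Bstep : forall j t, (j <= K)%N -> y j.*2 <= t <= y j.*2.+1 -> B (E t))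
  (Astep : forall j t, (j < K)%N -> y j.*2.+1 <= t <= y j.*2.+2 -> A (E t)).

Lemma int_on_arc_cst (C : set S) (f : S -> R) (s t : R) : s <= t ->
  {within C, continuous f} -> (forall x, C x -> f x \is a Num.int) ->
  (forall r, s <= r <= t -> C (E r)) -> f (E s) = f (E t).
Proof.
move=> st cf Zf CE; apply: (@continuous_int_cst R (f \o E)) => // [|r srt].
  exact: (@continuous_within_image _ _ _ C).
by apply: Zf; exact: CE.
Qed.

(** The increment of the primitive is [0] over a [B] arc and [alpha] times the increment of [beta]
    over an [A] arc, so the sum telescopes around the circle. The term [j = 0], where [ord_pred]
    wraps around to [K], collects the two end arcs, which join at [E 0 = E 1]. *)
Lemma alternating_pairing_eq0 :
  \sum_(j < K.+1) alpha (E (y j.*2)) *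
    (beta (E (y j.*2)) - beta (E (y (ord_pred j).*2))) = 0.
Proof.
have [th [cth thA thB]] := pairing_primitive.
have cthw C : {within C, continuous th} by exact: continuous_subspaceT.
have cbetaw C : {within C, continuous beta} by exact: continuous_subspaceT.
have onA s t : s <= t -> (forall r, s <= r <= t -> A (E r)) ->
    alpha (E s) = alpha (E t) /\
    th (E t) - th (E s) = alpha (E s) * (beta (E t) - beta (E s)).
  move=> st AE; have alphaE := int_on_arc_cst st calpha Zalpha AE; split => //.
  have := @int_on_arc_cst A (fun x => th x - alpha x * beta x) _ _ st _ thA AE.
  rewrite -alphaE => H.
  suff : th (E s) - alpha (E s) * beta (E s) = th (E t) - alpha (E s) * beta (E t).
    by lra.
  by apply: H; apply: within_continuousB => //; exact: within_continuousM.
have onB j : (j <= K)%N -> beta (E (y j.*2)) = beta (E (y j.*2.+1)) /\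
    th (E (y j.*2)) = th (E (y j.*2.+1)).
  move=> jK; have yj : y j.*2 <= y j.*2.+1 by apply: y_mono; lia.
  have BE t : y j.*2 <= t <= y j.*2.+1 -> B (E t) by exact: Bstep.
  by split; [exact: (int_on_arc_cst yj (cbetaw B) Zbeta BE)|
    exact: (int_on_arc_cst yj (cthw B) thB BE)].
have [a0 th0] := onA _ _ y0 Astart; have [a1 th1] := onA _ _ y1 Aend.
have sum_th m : (m <= K)%N -> \sum_(j < m) alpha (E (y j.+1.*2)) *
    (beta (E (y j.+1.*2)) - beta (E (y j.*2))) = th (E (y m.*2)) - th (E (y 0%N)).
  elim: m => [|m IHm] mK; first by rewrite big_ord0 subrr.
  rewrite big_ord_recr/= IHm ?(ltnW mK)//.
  have [bB tB] := onB m (ltnW mK).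
  have ym : y m.*2.+1 <= y m.*2.+2 by apply: y_mono; lia.
  have [aA tA] := onA _ _ ym (fun t => @Astep m t mK).
  rewrite doubleS -aA bB -tA -tB; ring.
rewrite big_ord_recl/=.
have -> : \sum_(i < K) alpha (E (y (fintype.lift ord0 i).*2)) *
     (beta (E (y (fintype.lift ord0 i).*2)) -
      beta (E (y (ord_pred (fintype.lift ord0 i)).*2))) =
    \sum_(j < K) alpha (E (y j.+1.*2)) *
      (beta (E (y j.+1.*2)) - beta (E (y j.*2))).
  apply: eq_bigr => i _; congr (_ * (_ - beta (E (y _.*2)))).
  by rewrite /= add0n modnDr modn_small// ltnS ltnW.
rewrite (sum_th K (leqnn K)) modn_small ?ltnS//.
have [bB tB] := onB K (leqnn K).
move: th0 th1; rewrite a1 -E01 a0 -tB -bB double0; lra.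
Qed.

End Pairing.

(** * Alternating chains *)

Section Chains.
Context {R : realType} {X : Type} (q : R -> X) (C : bool -> set X)
  (ty : nat -> bool) (pt : nat -> X).
Implicit Types (u v w x y z : R) (s : seq (R * nat * R)).

(* A block [(x, l, y)] of a chain starting at [u] is the interval [[u, y]] with
   the marked point [x], a lift of the [l]-th marker. *)
Fixpoint chain_of u s w : Prop :=
  if s is (x, l, y) :: s' then
    [/\ u <= x <= y, q x = pt l, forall z, u <= z <= y -> C (ty l) (q z) &
      chain_of y s' w]
  else u = w.

Definition labels s : seq nat := [seq b.1.2 | b <- s].
Definition alternates s : bool :=
  sorted (fun l l' => ty l != ty l') (labels s).

Lemma chain_of_le u s w : chain_of u s w -> u <= w.
Proof.
elim: s u => [u ->//|[[x l] y] s IHs u /= [/andP[ux xy] _ _ /IHs]].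
exact/le_trans/(le_trans ux).
Qed.

Lemma chain_of_cat u s v s' w :
  chain_of u s v -> chain_of v s' w -> chain_of u (s ++ s') w.
Proof.
elim: s u => [u ->//|[[x l] y] s IHs u /= [uxy qx Cl cs] cs'].
by split => //; exact: IHs.
Qed.

(** If the chains meet with equal types, the adjoining blocks fuse and one mark is lost; otherwise
    none is. The clause on [ohead] lets the induction put a block back in front without breaking
    alternation. *)
Lemma chain_of_merge u s v s' w : s != [::] -> s' != [::] ->
  chain_of u s v -> chain_of v s' w -> alternates s -> alternates s' ->
  exists s2, [/\ chain_of u s2 w, alternates s2,
    (size s + size s' <= (size s2).+1)%N, ohead (labels s2) = ohead (labels s) &
    {subset labels s2 <= labels s ++ labels s'}].
Proof.
move=> + s'0 + cs' + as'; elim: s u => // -[[x l] y] [|b s] IHs u _.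
  clear IHs; move=> /= [/andP[ux xy] qx Cl yv] _; case: s' s'0 cs' as' => // -[[x' l'] y'] s' _.
  move=> /= [/andP[vx' xy'] qx' Cl' cs'] as'.
  have [tyl|tyl] := eqVneq (ty l) (ty l').
    exists ((x, l, y') :: s'); split => //=; first 1 last.
    - by move: as'; rewrite /alternates /=; case: (labels s') => //= ? ?; rewrite tyl.
    - by move=> k; rewrite !inE => /orP[->//|->]; rewrite !orbT.
    split => //; first by rewrite ux (le_trans xy)// yv (le_trans vx').
    move=> z /andP[uz zy']; have [zy|yz] := leP z y; first by apply: Cl; rewrite uz.
    by rewrite tyl; apply: Cl'; rewrite -yv ltW.
  exists [:: (x, l, y), (x', l', y') & s']; split => //=; last by rewrite /alternates /= tyl.
  by split => //; [rewrite ux|split; rewrite ?yv ?vx'].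
move=> [uxy qx Cl cs] as1.
have {as1} [tyl as1] : ty l != ty b.1.2 /\ alternates (b :: s).
  by move: as1; rewrite /alternates /= => /andP.
have [//|s2 [cs2 as2 size2 head2 sub2]] := IHs y _ cs as1.
exists ((x, l, y) :: s2); split => //; last first.
  by move=> k; rewrite /= !inE => /orP[->//|/sub2]; rewrite /= inE => ->; rewrite orbT.
  move: head2 as2; rewrite /alternates/=; case: (labels s2) => //= l2 ls [->].
  by rewrite tyl.
Qed.

End Chains.

Section ChainImage.
Context {R : realType} {X : Type} (q : R -> X) (C : bool -> set X)
  (ty : nat -> bool) (pt : nat -> X).
Variables (a b a' b' : R) (sig : R -> R).
Hypothesis q_sig : forall t, a <= t <= b -> q (sig t) = q t.
Hypothesis sig_surj : forall z, a' <= z <= b' ->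
  exists2 t, a <= t <= b & sig t = z.
Hypothesis sig_in : forall t, a <= t <= b -> a' <= sig t <= b'.
Implicit Types (u v w x y z : R) (s : seq (R * nat * R)).

Lemma chain_of_increasing s u w :
  {in `[a, b] &, {mono sig : x y / x <= y}} ->
  a <= u -> w <= b -> chain_of q C ty pt u s w ->
  exists s', [/\ chain_of q C ty pt (sig u) s' (sig w) & labels s' = labels s].
Proof.
move=> sig_mono; elim: s u => [|[[x l] y] s IHs] u au wb /=.
  by move=> ->; exists [::].
move=> [/andP[ux xy] qx Cl cs]; have yw := chain_of_le cs.
have yb := le_trans yw wb; have xb := le_trans xy yb; have ub := le_trans ux xb.
have ax := le_trans au ux; have ay := le_trans ax xy.
have inI t : a <= t -> t <= b -> t \in `[a, b] by rewrite in_itv/= => -> ->.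
have [s' [cs' ls']] := IHs y ay wb cs.
exists ((sig x, l, sig y) :: s'); split => /=; last by rewrite -ls'.
split => //.
- by rewrite !sig_mono ?inI// ux xy.
- by rewrite q_sig// ax xb.
- move=> z /andP[uz zy].
  have /andP[_ ya'] : a' <= sig y <= b' by rewrite sig_in// ay yb.
  have /andP[au' _] : a' <= sig u <= b' by rewrite sig_in// au ub.
  have [|t /andP[at_ tb] tz] := sig_surj (z := z).
    by rewrite (le_trans au')// (le_trans zy).
  move: uz zy; rewrite -tz !sig_mono ?inI// => ut ty'.
  by rewrite q_sig ?at_//; apply: Cl; rewrite ut.
Qed.

Lemma chain_of_decreasing s u w :
  {in `[a, b] &, {mono sig : x y /~ x <= y}} ->
  a <= u -> w <= b -> chain_of q C ty pt u s w ->
  exists s', [/\ chain_of q C ty pt (sig w) s' (sig u) & labels s' = rev (labels s)].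
Proof.
move=> sig_mono; elim: s u => [|[[x l] y] s IHs] u au wb /=.
  by move=> ->; exists [::].
move=> [/andP[ux xy] qx Cl cs]; have yw := chain_of_le cs.
have yb := le_trans yw wb; have xb := le_trans xy yb; have ub := le_trans ux xb.
have ax := le_trans au ux; have ay := le_trans ax xy.
have inI t : a <= t -> t <= b -> t \in `[a, b] by rewrite in_itv/= => -> ->.
have [s' [cs' ls']] := IHs y ay wb cs.
exists (s' ++ [:: (sig x, l, sig u)]); split => /=; last first.
  by rewrite /labels map_cat/= -/(labels _) ls' rev_cons -cats1.
apply: chain_of_cat cs' _ => /=; split => //.
- by rewrite !sig_mono ?inI// ux xy.
- by rewrite q_sig// ax xb.
- move=> z /andP[uz zy].
  have /andP[ya' _] : a' <= sig y <= b' by rewrite sig_in// ay yb.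
  have /andP[_ au'] : a' <= sig u <= b' by rewrite sig_in// au ub.
  have [|t /andP[at_ tb] tz] := sig_surj (z := z).
    by rewrite (le_trans ya')// (le_trans zy).
  move: uz zy; rewrite -tz !sig_mono ?inI// => ut ty'.
  by rewrite q_sig ?at_//; apply: Cl; rewrite ut ty'.
Qed.

End ChainImage.

(** * From a maximal alternation to a chain *)

Section MaximalAlternation.
Context {R : realType} {X : Type} (q : R -> X) (C : bool -> set X) (a b : R).
Hypotheses (ab : a < b) (clC : forall c, closed [set z | C c (q z)])
  (coverC : forall x c, C c x \/ C (~~ c) x).
Implicit Types (T : seq (R * bool)) (p : R * bool) (z : R).

(** The colour [p.2] names the set that has to contain the point because the other one misses it. *)
Definition marker p : Prop := [/\ a < p.1, p.1 < b & ~ C (~~ p.2) (q p.1)].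

Definition switches p p' : bool := (p.1 < p'.1) && (p'.2 != p.2).

Definition alternation T : bool :=
  sorted switches T && all (fun p => `[< marker p >]) T.

Lemma marker_mem p : marker p -> C p.2 (q p.1).
Proof. by case=> _ _ nC; case: (coverC (q p.1) p.2). Qed.

Lemma not_near z c : ~ C c (q z) ->
  exists2 e, 0 < e & forall y, `|z - y| < e -> ~ C c (q y).
Proof.
move=> nC; have : nbhs z (~` [set z | C c (q z)]).
  by apply: open_nbhs_nbhs; split => //; exact: closed_openC.
by move=> /nbhs_ballP[e /= e0 eC]; exists e => // y; exact: eC.
Qed.

(** [m] is the infimum of the points, up to the second marker, that miss the first set. A point
    beyond [m] missing the second set would come after a point missing the first, which is the
    excluded pair; closedness settles [m] itself. *)
Lemma switch_point p p' : marker p -> marker p' -> switches p p' ->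
  (forall x y, p.1 < x -> x < y -> y < p'.1 ->
     ~ (~ C p.2 (q x) /\ ~ C p'.2 (q y))) ->
  exists m, [/\ p.1 <= m <= p'.1, forall z, p.1 <= z <= m -> C p.2 (q z) &
    forall z, m <= z <= p'.1 -> C p'.2 (q z)].
Proof.
move=> mp mp' /andP[pp' cc'] noins.
have Cp := marker_mem mp; have Cp' := marker_mem mp'.
have nCp' : ~ C p.2 (q p'.1).
  by case: mp' => _ _; move: cc'; case: p'.2; case: p.2.
pose S := [set z | p.1 <= z <= p'.1 /\ ~ C p.2 (q z)].
have Sp' : S p'.1 by split => //; rewrite (ltW pp') lexx.
have infS : has_inf S by split; [exists p'.1|exists p.1 => z [/andP[]]].
pose m := inf S.
have pm : p.1 <= m by apply: lb_le_inf; [exists p'.1|move=> z [/andP[]]].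
have mp1 : m <= p'.1 by apply: ge_inf => //; case: infS.
have below z : p.1 <= z -> z < m -> C p.2 (q z).
  move=> pz zm; apply: contrapT => nC.
  have : m <= z.
    apply: ge_inf; first by case: infS.
    by split => //; rewrite pz (le_trans (ltW zm)).
  by rewrite leNgt zm.
have above z : m < z -> z <= p'.1 -> C p'.2 (q z).
  move=> mz; rewrite le_eqVlt => /orP[/eqP->//|zp'].
  apply: contrapT => nC; have [x Sx xz] := inf_lt (proj1 infS) mz.
  case: Sx => /andP[px xp'] nCx.
  apply: (noins x z) => //.
  by rewrite lt_neqAle px andbT; apply/eqP => pxE; apply: nCx; rewrite -pxE.
exists m; split; first by rewrite pm.
- move=> z /andP[pz]; rewrite le_eqVlt => /orP[/eqP->|zm]; last exact: below.
  apply: contrapT => nC; have [e e0 eC] := not_near nC.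
  have pm' : p.1 < m.
    by rewrite lt_neqAle pm andbT; apply/eqP => pE; apply: nC; rewrite -pE.
  pose y := Num.max p.1 (m - e / 2).
  have ym : y < m by rewrite /y gt_max pm'; lra.
  apply: (eC y); last by apply: below => //; rewrite /y le_max lexx.
  rewrite gtr0_norm ?subr_gt0//.
  have : m - e / 2 <= y by rewrite /y le_max lexx orbT.
  lra.
- move=> z /andP[]; rewrite le_eqVlt => /orP[/eqP<- _|mz zp']; last exact: above.
  apply: contrapT => nC; have [e e0 eC] := not_near nC.
  have mp'' : m < p'.1.
    by rewrite lt_neqAle mp1 andbT; apply/eqP => pE; apply: nC; rewrite pE.
  pose y := Num.min p'.1 (m + e / 2).
  have ym : m < y by rewrite /y lt_min mp''; lra.
  apply: (eC y); last by apply: above => //; rewrite /y ge_min lexx.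
  rewrite ltr0_norm ?subr_lt0//.
  have : y <= m + e / 2 by rewrite /y ge_min lexx orbT.
  lra.
Qed.

Variable T : seq (R * bool).
Hypotheses (altT : alternation T)
  (maxT : forall T', alternation T' -> (size T' <= size T)%N).

Let ty l := (nth (a, true) T l).2.
Let pt l := q (nth (a, true) T l).1.

Let marker_T p : p \in T -> marker p.
Proof. by move=> pT; have /andP[_ /allP/(_ p pT)/asboolP] := altT. Qed.

(** A later point missing [C p.2] could be appended as a marker of the other colour. The end [b],
    where no marker may lie, follows by closedness. *)
Lemma last_marker_interval T1 p : T = rcons T1 p ->
  forall z, p.1 <= z <= b -> C p.2 (q z).
Proof.
move=> TE; have mp : marker p by apply: marker_T; rewrite TE mem_rcons mem_head.
have below z : p.1 <= z -> z < b -> C p.2 (q z).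
  rewrite le_eqVlt => /orP[/eqP<- _|pz zb]; first exact: marker_mem.
  apply: contrapT => nC; suff : alternation (rcons T (z, ~~ p.2)).
    by move=> /maxT; rewrite size_rcons ltnn.
  have /andP[sT aT] := altT; apply/andP; split; last first.
    rewrite all_rcons aT andbT; apply/asboolP; split => //=; last by rewrite negbK.
    by case: mp => ap _ _; exact: lt_trans pz.
  move: sT; rewrite TE -cats1 -cats1 -catA /= => sT.
  rewrite sorted_cat_cons -cats1 sT /= andbT /switches /= pz /=.
  by case: (p.2).
move=> z /andP[pz]; rewrite le_eqVlt => /orP[/eqP->|]; last exact: below.
apply: contrapT => /not_near[e e0 eC]; have pb : p.1 < b by case: mp.
pose y := Num.max p.1 (b - e / 2).
have yb : y < b by rewrite /y gt_max pb; lra.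
apply: (eC y); last by apply: below => //; rewrite /y le_max lexx.
rewrite gtr0_norm ?subr_gt0//.
have : b - e / 2 <= y by rewrite /y le_max lexx orbT.
lra.
Qed.

Lemma first_marker_interval p T2 : T = p :: T2 ->
  forall z, a <= z <= p.1 -> C p.2 (q z).
Proof.
move=> TE; have mp : marker p by apply: marker_T; rewrite TE mem_head.
have above z : a < z -> z <= p.1 -> C p.2 (q z).
  rewrite le_eqVlt => az /orP[/eqP->|zp]; first exact: marker_mem.
  apply: contrapT => nC; suff : alternation ((z, ~~ p.2) :: T).
    by move=> /maxT /=; rewrite ltnn.
  have /andP[sT aT] := altT; apply/andP; split => /=; last first.
    rewrite aT andbT; apply/asboolP; split => //=; last by rewrite negbK.
    by case: mp => _ pb _; exact: lt_trans pb.
  move: sT; rewrite TE /= => ->; rewrite andbT /switches /= zp /=.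
  by case: (p.2).
move=> z /andP[]; rewrite le_eqVlt => /orP[/eqP<- _|]; last exact: above.
apply: contrapT => /not_near[e e0 eC]; have ap : a < p.1 by case: mp.
pose y := Num.min p.1 (a + e / 2).
have ay : a < y by rewrite /y lt_min ap; lra.
apply: (eC y); last by apply: above => //; rewrite /y ge_min lexx.
rewrite ltr0_norm ?subr_lt0//.
have : y <= a + e / 2 by rewrite /y ge_min lexx orbT.
lra.
Qed.

Lemma alternation_chain_from T2 T1 p u : T = T1 ++ p :: T2 -> u <= p.1 ->
  (forall z, u <= z <= p.1 -> C p.2 (q z)) ->
  exists s, chain_of q C ty pt u s b /\ labels s = iota (size T1) (size T2).+1.
Proof.
elim: T2 T1 p u => [|p' T2 IHT] T1 p u TE up Cup.
  have mp : marker p by apply: marker_T; rewrite TE mem_cat mem_head orbT.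
  exists [:: (p.1, size T1, b)]; split => //=.
  have tyE : ty (size T1) = p.2 by rewrite /ty TE nth_cat ltnn subnn.
  split => //; first by have [_ /ltW pb _] := mp; rewrite up pb.
    by rewrite /pt TE nth_cat ltnn subnn.
  move=> z /andP[uz zb]; rewrite tyE; have [zp|pz] := leP z p.1.
    by apply: Cup; rewrite uz.
  apply: (@last_marker_interval T1); first by rewrite TE cats1.
  by rewrite (ltW pz).
have mp : marker p by apply: marker_T; rewrite TE mem_cat mem_head orbT.
have mp' : marker p' by apply: marker_T; rewrite TE mem_cat !inE eqxx !orbT.
have sT : sorted switches T by have /andP[] := altT.
have pp' : switches p p'.
  by move: sT; rewrite TE sorted_cat_cons => /andP[_] /= /andP[].
have [m [/andP[pm mp1] Cpm Cmp]] : exists m, [/\ p.1 <= m <= p'.1,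
    forall z, p.1 <= z <= m -> C p.2 (q z) &
    forall z, m <= z <= p'.1 -> C p'.2 (q z)].
  apply: switch_point => // x y px xy yp' [nCx nCy].
  have /andP[_ cc'] := pp'.
  have e1 : ~~ p'.2 = p.2 by move: cc'; case: (p.2); case: (p'.2).
  have e2 : ~~ p.2 = p'.2 by rewrite -e1 negbK.
  have ap : a < p.1 by case: mp.
  have pb : p'.1 < b by case: mp'.
  (* Since [x] misses the set of [p] and [y] that of [p'], inserting both keeps the colours
     alternating and contradicts maximality. *)
  suff : alternation (T1 ++ [:: p, (x, p'.2), (y, p.2), p' & T2]).
    by move=> /maxT; rewrite TE !size_cat /= !addnS ltnNge leqnSn.
  have /andP[_ aT] := altT; apply/andP; split; last first.
    move: aT; rewrite TE !all_cat /= => /and4P[-> -> -> ->]; rewrite /= andbT.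
    apply/andP; split; apply/asboolP; split => //=; rewrite ?e1 ?e2 //.
    - exact: lt_trans px.
    - by rewrite (lt_trans xy)// (lt_trans yp').
    - by rewrite (lt_trans ap)// (lt_trans px).
    - exact: lt_trans pb.
  move: sT; rewrite TE !sorted_cat_cons /= => /and3P[-> _ ->].
  by rewrite /switches /= px xy yp'; move: cc'; case: (p.2); case: (p'.2).
have [|s [cs ls]] := IHT (rcons T1 p) p' m _ mp1 Cmp; first by rewrite cat_rcons.
exists ((p.1, size T1, m) :: s); split; last first.
  by rewrite /labels /= -/(labels s) ls size_rcons.
have tyE : ty (size T1) = p.2 by rewrite /ty TE nth_cat ltnn subnn.
split => //; first by rewrite up.
  by rewrite /pt TE nth_cat ltnn subnn.
move=> z /andP[uz zm]; rewrite tyE; have [zp|pz] := leP z p.1.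
  by apply: Cup; rewrite uz.
by apply: Cpm; rewrite (ltW pz).
Qed.

Lemma alternation_chain : (0 < size T)%N ->
  exists s, chain_of q C ty pt a s b /\ labels s = iota 0 (size T).
Proof.
case TE : T => [//|p T2] _.
have mp : marker p by apply: marker_T; rewrite TE mem_head.
rewrite -TE; have ap : a <= p.1 by have [/ltW] := mp.
have [s [cs ls]] := @alternation_chain_from T2 [::] p a TE ap
  (first_marker_interval TE).
by exists s; split => //; rewrite ls TE.
Qed.

Lemma alternation_type l : (l < size T)%N -> ty l = ty 0%N (+) odd l.
Proof.
elim: l => [|l IHl] lT; first by rewrite addbF.
have /andP[sT _] := altT.
have /(sortedP (a, true))/(_ _ lT)/andP[_] := sT; rewrite -/(ty l) -/(ty l.+1).
by rewrite IHl ?(ltnW lT)//= addbN; case: (_ (+) _); case: (ty l.+1).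
Qed.

End MaximalAlternation.

Lemma continuous_comp_set_val (T U : topologicalType) (A : set T) (f : T -> U) :
  continuous f -> continuous (fun x : A => f (set_val x)).
Proof. by move=> cf; exact/subspace_sigL_continuousP/continuous_subspaceT. Qed.

(** * Cyclic alternating chains are short *)

Section Descent.
Context {R : realType} {S T : topologicalType} (Q : S -> T).
Hypotheses (cS : compact [set: S]) (hT : hausdorff_space T)
  (cQ : continuous Q) (Qsurj : forall t, exists s, Q s = t).

(** The values of [u] on any section of [Q] will do. The points of [S] where [u] is far, modulo the
    integers, from its value over [t] form a compact set, whose image is closed and misses [t]. *)
Lemma modcont_descend (u : S -> R) : modcont u ->
  (forall x y, Q x = Q y -> u x - u y \is a Num.int) ->
  exists2 v : T -> R, modcont v & forall x, v (Q x) - u x \is a Num.int.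
Proof.
move=> mu uQ; have [r rK] : {r : T -> S & forall t, Q (r t) = t}.
  exact: (@choice _ _ (fun t s => Q s = t)).
exists (u \o r) => [t e e0|x]; last by rewrite /= uQ// rK.
pose far := [set x | e <= `|crem (u x - u (r t))|].
have clfar : closed far.
  rewrite -[far]setCK; apply: open_closedC; rewrite openE => x /= nfar.
  have d0 : 0 < e - `|crem (u x - u (r t))|.
    by rewrite subr_gt0 ltNge; exact/negP.
  apply: filterS (mu x _ d0) => y xy; apply/negP; rewrite -ltNge.
  have -> : u y - u (r t) = (u y - u x) + (u x - u (r t)) by ring.
  by apply: le_lt_trans (cremD _ _) _; rewrite -ltrBrDr.
have clQfar : closed (Q @` far).
  apply: compact_closed => //; apply: continuous_compact.
    exact: continuous_subspaceT.
  exact: (subclosed_compact clfar cS).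
have : nbhs t (~` (Q @` far)).
  apply: open_nbhs_nbhs; split; first exact: closed_openC.
  move=> [x far_x xt]; move: far_x; rewrite /far/=.
  rewrite (@crem_congr _ _ 0) ?subr0 ?uQ ?rK//.
  by rewrite crem_id ?normr0 ?invr_gt0// leNgt e0.
apply: filterS => t' nfar /=; rewrite ltNge; apply/negP => efar; apply: nfar.
by exists (r t').
Qed.

End Descent.

Section Core.
Context {R : realType} {S X : topologicalType} (Q : S -> X) (E : R -> S).
Hypotheses (cS : compact [set: S]) (hS : hausdorff_space S)
  (hX : hausdorff_space X) (cQ : continuous Q)
  (Qsurj : forall x, exists s, Q s = x) (cE : continuous E).
Hypothesis E_inj : forall s t : R, 0 <= s <= 1 -> 0 <= t <= 1 -> E s = E t ->
  [\/ s = t, s = 0 /\ t = 1 | s = 1 /\ t = 0].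
Hypothesis Q_fibre : forall x y, Q x = Q y ->
  x = y \/ exists s t : R, [/\ 0 <= s <= 1, 0 <= t <= 1, x = E s & y = E t].
Local Notation q := (Q \o E).

(** As both ends of the arc lie outside [A], the arc and the rest of the circle are disjoint closed
    sets over [A]; Urysohn's lemma separates them by a function on all of [S]. *)
Lemma arc_indicator (A : set X) (l r : R) : closed A ->
  0 < l -> l <= r -> r < 1 -> ~ A (q l) -> ~ A (q r) ->
  exists2 u : S -> R, continuous u &
    forall s : R, 0 <= s <= 1 -> A (q s) -> u (E s) = (l < s < r)%R%:R.
Proof.
move=> clA l0 lr r1 nAl nAr.
have clAh : closed (Q @^-1` A) by move/continuous_closedP : cQ; exact.
have clE c d : closed (E @` `[c, d]).
  apply: compact_closed => //; apply: continuous_compact.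
    exact: continuous_subspaceT.
  exact: segment_compact.
pose F1 := Q @^-1` A `&` E @` `[l, r].
pose F0 := Q @^-1` A `&` (E @` `[0, l] `|` E @` `[r, 1]).
have F01 : F0 `&` F1 = set0.
  rewrite -subset0 => x [[Ax F0x] [_ [s /= + sx]]]; rewrite in_itv/= => /andP[ls sr].
  have s01 : 0 <= s <= 1 by rewrite (le_trans (ltW l0))// (le_trans sr)// ltW.
  have eqE t : 0 <= t <= 1 -> E t = x -> s = t.
    rewrite -sx => t01 ts; have [//|[s0 _]|[s1 _]] := E_inj s01 t01 (esym ts).
      by move: l0; rewrite ltNge -s0 ls.
    by move: r1; rewrite ltNge -s1 sr.
  case: F0x => -[t /=]; rewrite in_itv/= => /andP[t1 t2] tx.
    have st := eqE t; rewrite t1 (le_trans t2)// in st; last first.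
      by rewrite (le_trans lr)// ltW.
    have sl : s = l by apply/eqP; rewrite eq_le ls st// t2.
    by apply: nAl; rewrite -sl /= sx.
  have st := eqE t; rewrite t2 (le_trans _ t1) in st; last first.
    by rewrite (le_trans (ltW l0)).
  have sl : s = r by apply/eqP; rewrite eq_le sr st// t1.
  by apply: nAr; rewrite -sl /= sx.
have [f [cf f0 f1 _]] := @urysohn_ext_itv S R (compact_normal hS cS) _ _ 0 1
  (closedI clAh (closedU (clE 0 l) (clE r 1))) (closedI clAh (clE l r)) F01 ltr01.
exists f => // s /andP[s0 s1] As; have [ls|sl] := ltP l s; last first.
  rewrite /=; apply: f0; exists (E s) => //; split => //; left.
  by exists s => //=; rewrite in_itv/= s0.
have [sr|rs] := ltP s r; rewrite /=.
  by apply: f1; exists (E s) => //; split => //; exists s => //=; rewrite in_itv/= !ltW.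
apply: f0; exists (E s) => //; split => //; right.
by exists s => //=; rewrite in_itv/= rs.
Qed.

Variables (A : set X).
Hypotheses (clA : closed A) (liftA : forall u : A -> R, modcont u ->
  exists2 th, continuous th & forall x, th x - u x \is a Num.int).

Lemma modcont_descend_within (u : Q @^-1` A -> R) : modcont u ->
  (forall x y, Q (set_val x) = Q (set_val y) -> u x - u y \is a Num.int) ->
  exists2 g : X -> R, {within A, continuous g} &
    forall x, g (Q (set_val x)) - u x \is a Num.int.
Proof.
move=> mu uQ.
have Qr (x : Q @^-1` A) : Q (set_val x) \in A by apply/mem_set; exact: (set_valP x).
pose Q' (x : Q @^-1` A) : A := SigSub (Qr x).
have Q'E x : set_val (Q' x) = Q (set_val x) by rewrite set_valE.
have cQ' : continuous Q'.
  apply: (continuous_embedding (@embedding_set_val _ A)).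
  rewrite (_ : _ \o Q' = Q \o set_val); last by apply/funext => z; exact: Q'E.
  exact: continuous_comp_set_val.
have clAh : closed (Q @^-1` A) by move/continuous_closedP : cQ; exact.
have cAh : compact [set: Q @^-1` A].
  apply: (embedding_compact (@embedding_set_val _ (Q @^-1` A))).
  rewrite (_ : range _ = Q @^-1` A); first exact: (subclosed_compact clAh cS).
  apply/seteqP; split => [_ [x _ <-]|x Ax]; first exact: (set_valP x).
  by exists (SigSub (mem_set Ax)).
have Q'surj (t : A) : exists x, Q' x = t.
  have [x xt] := Qsurj (set_val t).
  have Ax : x \in Q @^-1` A by apply/mem_set; rewrite /= xt; exact: (set_valP t).
  by exists (SigSub Ax); apply: val_inj; rewrite /= set_valE/= xt set_valE.
have uQ' (x y : Q @^-1` A) : Q' x = Q' y -> u x - u y \is a Num.int.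
  by move=> /(congr1 (set_val : A -> X)); rewrite !Q'E; exact: uQ.
have [v mv vu] := modcont_descend cAh (embedding_hausdorff (@embedding_set_val _ A) hX)
  cQ' Q'surj mu uQ'.
have [th cth thv] := liftA mv.
(* The value [0] outside [A] is only a default; continuity is claimed within [A]. *)
pose g x := if pselect (A x) is left Ax then th (SigSub (mem_set Ax)) else 0.
have gE (a : A) : g (set_val a) = th a.
  rewrite /g; case: pselect => [Aa|[]]; last exact: (set_valP a).
  by congr th; apply: val_inj; rewrite /= set_valE.
exists g => [|x].
  apply/subspace_sigL_continuousP; rewrite (_ : sigL A g = th)//.
  by apply/funext => a; rewrite /sigL /= gE.
rewrite -Q'E gE.
have -> : th (Q' x) - u x = (th (Q' x) - v (Q' x)) + (v (Q' x) - u x) by ring.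
by rewrite rpredD.
Qed.

(** Distinct points identified by [Q] lie on the circle, where [u] is an integer over [A]. So [- u]
    descends modulo the integers, and [g] is a real lift of it on [A]; the sign makes the sum
    integral. *)
Lemma descended_function (u : S -> R) : continuous u ->
  (forall s : R, 0 <= s <= 1 -> A (q s) -> u (E s) \is a Num.int) ->
  exists g : X -> R, {within Q @^-1` A, continuous (fun x => g (Q x) + u x)} /\
    forall x, A (Q x) -> g (Q x) + u x \is a Num.int.
Proof.
move=> cu uZ.
have cu' : continuous (fun x : Q @^-1` A => - u (set_val x)).
  by move=> x; exact: (cvgN (@continuous_comp_set_val _ _ (Q @^-1` A) u cu x)).
have uQ' (x y : Q @^-1` A) : Q (set_val x) = Q (set_val y) ->
    - u (set_val x) - - u (set_val y) \is a Num.int.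
  move=> xy.
  have Ax : A (Q (set_val x)) := set_valP x.
  have Ay : A (Q (set_val y)) := set_valP y.
  have [->|[s [t [s01 t01 xs yt]]]] := Q_fibre xy; first by rewrite subrr.
  move: Ax Ay; rewrite xs yt => Ax Ay.
  by rewrite rpredB// rpredN uZ.
have [g cg gu] := modcont_descend_within (continuous_modcont cu') uQ'.
exists g; split => [|x Ax]; last first.
  by have := gu (SigSub (mem_set Ax)); rewrite set_valE/= opprK.
rewrite (_ : (fun x => _) = (fun x => (g \o Q) x - (- u x))).
  apply: within_continuousB; first exact: continuous_within_image cg cQ _.
  by apply: continuous_subspaceT => x; exact: (cvgN (cu x)).
by apply/funext => x; rewrite opprK.
Qed.

End Core.

Lemma chain_of_nth (R : realType) (X : Type) (q : R -> X) (C : bool -> set X)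
    (ty : nat -> bool) (pt : nat -> X) (s : seq (R * nat * R)) (u w : R) :
  chain_of q C ty pt u s w ->
  let Y := nth 0 (u :: [seq b.2 | b <- s]) in
  (forall j, (j < size s)%N -> let b := nth (0, 0%N, 0) s j in
    [/\ Y j <= b.1.1 <= Y j.+1, q b.1.1 = pt b.1.2 &
      forall z, Y j <= z <= Y j.+1 -> C (ty b.1.2) (q z)]) /\ Y (size s) = w.
Proof.
elim: s u => [|[[x l] y] s IHs] u /=; first by move=> ->.
move=> [uxy qx Cl /IHs[IH1 IH2]]; split => // -[|j] js; first by split.
exact: IH1.
Qed.

Lemma tietze_compact (R : realType) (S : topologicalType) (F : set S) (f : S -> R) :
  compact [set: S] -> hausdorff_space S -> closed F ->
  {within F, continuous f} ->
  exists2 g : S -> R, continuous g & forall x, F x -> g x = f x.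
Proof.
move=> cS hS clF cf.
have cF : compact F by apply: (subclosed_compact clF cS).
have /compact_bounded[M [_ bM]] := continuous_compact cf cF.
have fM x : F x -> `|f x| <= `|M| + 1.
  move=> Fx; have := bM (`|M| + 1); rewrite (le_lt_trans (ler_norm M)) ?ltrDl//.
  by move=> /(_ isT); apply; exists x.
have M0 : 0 < `|M| + 1 by rewrite ltr_wpDl.
have [g [fg cg _]] := @continuous_bounded_extension S R (compact_normal hS cS) F clF
  f (`|M| + 1) M0 cf fM.
by exists g => // x Fx; rewrite fg// mem_set.
Qed.

Lemma addb_odd_neq (b b' : bool) : b' (+) odd (b != b') = b.
Proof. by case: b; case: b'. Qed.

Section CoreTheorem.
Context {R : realType} {S X : topologicalType} (Q : S -> X) (E : R -> S).
Hypotheses (cS : compact [set: S]) (hS : hausdorff_space S)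
  (hX : hausdorff_space X) (cQ : continuous Q)
  (Qsurj : forall x, exists s, Q s = x) (cE : continuous E) (E01 : E 0 = E 1).
Hypothesis E_inj : forall s t : R, 0 <= s <= 1 -> 0 <= t <= 1 -> E s = E t ->
  [\/ s = t, s = 0 /\ t = 1 | s = 1 /\ t = 0].
Hypothesis Q_fibre : forall x y, Q x = Q y ->
  x = y \/ exists s t : R, [/\ 0 <= s <= 1, 0 <= t <= 1, x = E s & y = E t].
Hypothesis liftS : forall u : S -> R, modcont u ->
  exists2 th : S -> R, continuous th & forall x, th x - u x \is a Num.int.
Local Notation q := (Q \o E).

Variables (C : bool -> set X).
Hypotheses (clC : forall c, closed (C c)) (coverC : forall x c, C c x \/ C (~~ c) x)
  (liftC : forall c (u : C c -> R), modcont u ->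
    exists2 th, continuous th & forall x, th x - u x \is a Num.int).

Variables (M : nat) (ty : nat -> bool) (pt : nat -> X).
Hypotheses (M2 : (1 < M)%N) (tyE : forall l, (l < M)%N -> ty l = ty 0%N (+) odd l)
  (ptC : forall l, (l < M)%N -> ~ C (~~ ty l) (pt l))
  (ptq : forall l, (l < M)%N -> exists2 t, 0 <= t <= 1 & q t = pt l)
  (pt_neq0 : forall l, (l < M)%N -> pt l <> q 0).

(** The correction to [u] at a mark is a function of [pt l]. Its value at the first label of type
    [c] is an integer; subtracting it keeps [alpha] integral and makes the correction vanish there,
    which saves one dimension in the rank bound. *)
Lemma marked_function c (u : S -> R) : continuous u ->
  (forall s, 0 <= s <= 1 -> C c (q s) -> u (E s) \is a Num.int) ->
  exists (alpha : S -> R) (g : nat -> R),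
  [/\ {within Q @^-1` C c, continuous alpha},
      forall x, C c (Q x) -> alpha x \is a Num.int &
      forall s l, 0 <= s <= 1 -> (l < M)%N -> ty l = c -> q s = pt l ->
        alpha (E s) = u (E s) + (g l./2 - g 0%N)].
Proof.
move=> cu uZ; have [g [cg gZ]] := descended_function cS hX cQ Qsurj Q_fibre
  (@clC c) (@liftC c) cu uZ.
(* Types alternate along the labels, so those of type [c] are [base + 2 k] with [base] equal to [0]
   or [1], and [l./2] recovers [k]. *)
pose base : nat := (c != ty 0%N).
have baseM : (base < M)%N by rewrite /base; case: (_ != _) => //; exact: ltnW.
have ty_base : ty base = c.
  by rewrite tyE// /base addb_odd_neq.
have g0Z : g (pt base) \is a Num.int.
  have [t t01 qt] := ptq baseM.
  have Cpt : C c (pt base).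
    by have [//|Cn] := coverC (pt base) c; case: (ptC baseM); rewrite ty_base.
  rewrite -qt in Cpt *; have := gZ _ Cpt => gu.
  by rewrite -[g _](addrK (u (E t))) rpredB// uZ.
exists (fun x => g (Q x) + u x - g (pt base)), (fun k => g (pt (k.*2 + base)%N)).
split => [|x Cx|s l s01 lM tyl qs].
- by apply: within_continuousB => //; apply: continuous_subspaceT => x; exact: cvg_cst.
- by rewrite rpredB// gZ.
have lE : (l./2.*2 + base = l)%N.
  rewrite -[RHS]odd_double_half addnC; congr (nat_of_bool _ + _)%N.
  by rewrite -tyl tyE//; case: (ty 0%N); case: (odd l).
by rewrite lE add0n -qs /= addrAC addrC addrA addrAC.
Qed.

(** The bound is the number of labels of the same type minus one; over the two types these bounds
    add up to [M - 2]. *)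
Lemma label_half_bound l : (l < M)%N ->
  (l./2 <= (M.-1 - (ty l != ty 0%N))./2)%N.
Proof.
move=> lM; rewrite tyE//.
have -> : (ty 0%N (+) odd l != ty 0%N) = odd l by case: (ty 0%N); case: (odd l).
by have := odd_double_half l; case: (odd l) => /=; lia.
Qed.

Variable (s : seq (R * nat * R)).
Hypotheses (cs : chain_of q C ty pt 0 s 1) (as_ : alternates ty s)
  (ls : forall l, l \in labels s -> (l < M)%N) (size_s : (3 * M.-1 < size s)%N).

Let Y := nth 0 (0 :: [seq b.2 | b <- s]).
Let x j := (nth (0, 0%N, 0) s j).1.1.
Let L j := (nth (0, 0%N, 0) s j).1.2.
Let N := size s.
(** The marks are used in [K + 1] pairs. For odd [N] one block is left over; it has the type of
    block [0] and joins it across [E 0 = E 1]. *)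
Let K := N./2.-1.

Let blocks j : (j < N)%N -> [/\ Y j <= x j <= Y j.+1, q (x j) = pt (L j) &
  forall z, Y j <= z <= Y j.+1 -> C (ty (L j)) (q z)].
Proof. exact: (chain_of_nth cs).1. Qed.

Let YN : Y N = 1. Proof. exact: (chain_of_nth cs).2. Qed.

Let LM j : (j < N)%N -> (L j < M)%N.
Proof.
move=> jN; apply: ls; have -> : L j = nth 0%N (labels s) j.
  by rewrite (nth_map (0, 0%N, 0)).
by rewrite mem_nth// size_map.
Qed.

Let tyL j : (j < N)%N -> ty (L j) = ty (L 0%N) (+) odd j.
Proof.
elim: j => [|j IHj] jN; first by rewrite addbF.
have /(sortedP 0%N)/(_ j) := as_; rewrite size_map => /(_ jN).
rewrite !(nth_map (0, 0%N, 0)) ?(ltnW jN)// -/(L j) -/(L j.+1) IHj ?(ltnW jN)//=.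
by rewrite addbN; case: (_ (+) _); case: (ty _).
Qed.

Let Y_mono j : (j < N)%N -> Y j <= Y j.+1.
Proof. by move=> /blocks[/andP[H1 H2] _ _]; exact: le_trans H2. Qed.

Let Y_ge0 j : (j <= N)%N -> 0 <= Y j.
Proof. by elim: j => // j IHj jN; rewrite (le_trans (IHj (ltnW jN)))// Y_mono. Qed.

Let Y_le1 j : (j <= N)%N -> Y j <= 1.
Proof.
move=> jN; move: (subnKC jN); move: (N - j)%N => d.
elim: d j {jN} => [|d IHd] j; first by rewrite addn0 => ->; rewrite YN.
by rewrite addnS -addSn => /[dup]/IHd jd jN; apply: le_trans jd; apply: Y_mono; lia.
Qed.

Let x01 j : (j < N)%N -> 0 <= x j <= 1.
Proof.
move=> jN; have [/andP[yx xy] _ _] := blocks jN.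
by rewrite (le_trans _ yx) ?Y_ge0 1?ltnW// (le_trans xy)// Y_le1.
Qed.

Let x_gt0 j : (j < N)%N -> 0 < x j.
Proof.
move=> jN; have /andP[x0 _] := x01 jN; rewrite lt_neqAle x0 andbT.
apply/eqP => x0E; have [_ qx _] := blocks jN.
by apply: (pt_neq0 (LM jN)); rewrite -qx -x0E.
Qed.

Let x_lt1 j : (j < N)%N -> x j < 1.
Proof.
move=> jN; have /andP[_ x1] := x01 jN; rewrite lt_neqAle x1 andbT.
apply/eqP => x1E; have [_ qx _] := blocks jN.
by apply: (pt_neq0 (LM jN)); rewrite -qx x1E /= E01.
Qed.

Let nCx j : (j < N)%N -> ~ C (~~ ty (L j)) (q (x j)).
Proof. by move=> jN; have [_ -> _] := blocks jN; exact: ptC (LM jN). Qed.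

Let xS j : (j.+1 < N)%N -> x j < x j.+1.
Proof.
move=> jN; have [/andP[_ xy] _ _] := blocks (ltnW jN).
have [/andP[yx _] _ Cj] := blocks jN.
rewrite lt_neqAle (le_trans xy yx) andbT; apply/eqP => xE.
apply: (nCx (ltnW jN)); rewrite xE.
have -> : ~~ ty (L j) = ty (L j.+1) by rewrite (tyL jN) (tyL (ltnW jN)) /= addbN.
by apply: Cj; rewrite yx; have [/andP[]] := blocks jN.
Qed.

Let x_lt i j : (i < N)%N -> (j < N)%N -> (x i < x j) = (i < j)%N.
Proof.
have mono a d : (a + d.+1 < N)%N -> x a < x (a + d.+1)%N.
  elim: d => [|d IHd] adN; first by rewrite addn1; apply: xS; lia.
  by rewrite addnS; apply: lt_trans (IHd _) (xS _); lia.
move=> iN jN; have [ij|ji|->] := ltngtP i j; last by rewrite ltxx.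
  have -> : j = (i + (j - i).-1.+1)%N by lia.
  by apply: mono; lia.
apply/negbTE; rewrite -leNgt ltW//.
have -> : i = (j + (i - j).-1.+1)%N by lia.
by apply: mono; lia.
Qed.

Let N4 : (4 <= N)%N. Proof. by move: size_s M2; rewrite -/N; lia. Qed.

Let KN : (K.*2.+2 <= N)%N.
Proof. by rewrite /K; move: N4 (odd_double_half N); lia. Qed.

Let arc c i j : (i <= j)%N -> (j < N)%N -> ty (L i) = ~~ c -> ty (L j) = ~~ c ->
  exists2 u : S -> R, continuous u & forall t, 0 <= t <= 1 -> C c (q t) ->
    u (E t) = (x i < t < x j)%R%:R.
Proof.
move=> ij jN tyi tyj; have iN := leq_ltn_trans ij jN.
apply: (arc_indicator cS hS cQ cE E_inj (@clC c) (x_gt0 iN) _ (x_lt1 jN)).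
- by rewrite leNgt x_lt// -leqNgt.
- by have := nCx iN; rewrite tyi negbK.
- by have := nCx jN; rewrite tyj negbK.
Qed.

(** An even mark is isolated from the other even marks by its two odd neighbours, which miss
    [C (ty (L 0))] and so may bound the arc of a bump. *)
Let even_indicator i : (i <= K)%N -> exists2 u : S -> R, continuous u &
  (forall t, 0 <= t <= 1 -> C (ty (L 0%N)) (q t) -> u (E t) \is a Num.int) /\
  forall j, (j <= K)%N -> u (E (x j.*2)) = (i == j)%:R.
Proof.
move=> iK; set c := ty (L 0%N).
have Cx j : (j <= K)%N -> C c (q (x j.*2)).
  move=> jK; have jN : (j.*2 < N)%N by lia.
  have [/andP[yx xy] _ Cj] := blocks jN; move: (Cj (x j.*2)).
  by rewrite tyL// odd_double addbF yx xy; apply.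
have tyo j : (j.*2.+1 < N)%N -> ty (L j.*2.+1) = ~~ c.
  by move=> jN; rewrite tyL//= odd_double addbT.
case: i iK => [_|i iK].
  (* The arc around mark [0] passes through [E 0]; its bump is taken as [1] minus that of the
     complementary arc. *)
  have [||||u cu uE] := @arc c 1 K.*2.+1; rewrite ?(tyo 0%N) ?tyo; try lia => //.
  exists (fun z => 1 - u z); first by move=> z; apply: cvgB (cvg_cst _) (cu z).
  split => [t t01 Ct|j jK]; first by rewrite uE// rpredB ?rpred1 ?natr_int.
  have jN : (j.*2 < N)%N by lia.
  rewrite (uE _ (x01 jN) (Cx j jK)).
  rewrite !x_lt; try lia.
  have -> : ((1 < j.*2) && (j.*2 < K.*2.+1))%N = (0 < j)%N by lia.
  by case: (j) => [|?]; rewrite ?subr0 ?subrr.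
have [||||u cu uE] := @arc c i.*2.+1 i.*2.+3; rewrite ?tyo -?doubleS ?tyo; try lia => //.
exists u => //; split => [t t01 Ct|j jK]; first by rewrite uE ?natr_int.
have jN : (j.*2 < N)%N by lia.
rewrite (uE _ (x01 jN) (Cx j jK)).
rewrite !x_lt; try lia.
by congr (nat_of_bool _)%:R; lia.
Qed.

Let odd_indicator i : (i <= K)%N -> exists2 u : S -> R, continuous u &
  (forall t, 0 <= t <= 1 -> C (~~ ty (L 0%N)) (q t) -> u (E t) \is a Num.int) /\
  forall j, (j <= K)%N -> u (E (x j.*2.+1)) = (i == j)%:R.
Proof.
move=> iK; set c := ~~ ty (L 0%N).
have Cx j : (j <= K)%N -> C c (q (x j.*2.+1)).
  move=> jK; have jN : (j.*2.+1 < N)%N by lia.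
  have [/andP[yx xy] _ Cj] := blocks jN; move: (Cj (x j.*2.+1)).
  by rewrite tyL//= odd_double addbT yx xy; apply.
have tye j : (j.*2 < N)%N -> ty (L j.*2) = ~~ c.
  by move=> jN; rewrite tyL//= odd_double addbF /c negbK.
have [iK'|iK'] := ltnP i K; last first.
  have {iK iK'} -> : i = K by lia.
  (* Around the last odd mark it is again the arc through [E 0], reached by complement. *)
  have [||||u cu uE] := @arc c 0 K.*2; rewrite ?(tye 0%N) ?tye; try lia => //.
  exists (fun z => 1 - u z); first by move=> z; apply: cvgB (cvg_cst _) (cu z).
  split => [t t01 Ct|j jK]; first by rewrite uE// rpredB ?rpred1 ?natr_int.
  have jN : (j.*2.+1 < N)%N by lia.
  rewrite (uE _ (x01 jN) (Cx j jK)).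
  rewrite !x_lt; try lia.
  have -> : ((0 < j.*2.+1) && (j.*2.+1 < K.*2))%N = (K != j)%N by lia.
  by case: (K == j); rewrite ?subr0 ?subrr.
have [||||u cu uE] := @arc c i.*2 i.*2.+2; rewrite -?doubleS ?tye; try lia => //.
exists u => //; split => [t t01 Ct|j jK]; first by rewrite uE ?natr_int.
have jN : (j.*2.+1 < N)%N by lia.
rewrite (uE _ (x01 jN) (Cx j jK)).
rewrite !x_lt; try lia.
by congr (nat_of_bool _)%:R; lia.
Qed.

Lemma no_long_alternating_chain : False.
Proof.
set cA := ty (L 0%N); set cB := ~~ cA.
have oK (j : 'I_K.+1) : (j <= K)%N by rewrite -ltnS.
have AB : Q @^-1` C cA `|` Q @^-1` C cB = setT.
  by apply/seteqP; split => // z _; exact: coverC.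
have clQ c : closed (Q @^-1` C c).
  by move/continuous_closedP : cQ; apply; exact: clC.
have Cblock j : (j < N)%N -> forall t, Y j <= t <= Y j.+1 ->
    C (if odd j then cB else cA) (q t).
  move=> jN; have [_ _ Cj] := blocks jN; move: Cj; rewrite tyL//.
  by case: (odd j); rewrite ?addbT ?addbF.
have [alpha [gA alphaP]] : exists (alpha : 'I_K.+1 -> S -> R) (gA : 'I_K.+1 -> nat -> R),
    forall i, [/\ {within Q @^-1` C cA, continuous (alpha i)},
      forall z, C cA (Q z) -> alpha i z \is a Num.int &
      forall j, (j <= K)%N -> alpha i (E (x j.*2)) =
        (i == j :> nat)%:R + (gA i (L j.*2)./2 - gA i 0%N)].
  have : forall i : 'I_K.+1, exists ag : (S -> R) * (nat -> R),
      [/\ {within Q @^-1` C cA, continuous ag.1},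
      forall z, C cA (Q z) -> ag.1 z \is a Num.int &
      forall j, (j <= K)%N -> ag.1 (E (x j.*2)) =
        (i == j :> nat)%:R + (ag.2 (L j.*2)./2 - ag.2 0%N)].
    move=> i; have iK := oK i.
    have [u cu [uZ uE]] := even_indicator iK.
    have [al [g [cal alZ alE]]] := marked_function cu uZ.
    exists (al, g); split => // j jK /=; have jN : (j.*2 < N)%N by lia.
    rewrite (alE _ _ (x01 jN) (LM jN)) ?uE//; last by have [] := blocks jN.
    by rewrite tyL// odd_double addbF.
  move=> /choice[ag agP].
  by exists (fun i => (ag i).1), (fun i => (ag i).2).
have [beta [gB betaP]] : exists (beta : 'I_K.+1 -> S -> R) (gB : 'I_K.+1 -> nat -> R),
    forall i, [/\ continuous (beta i),
      forall z, C cB (Q z) -> beta i z \is a Num.int &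
      forall j, (j <= K)%N -> beta i (E (x j.*2.+1)) =
        (i == j :> nat)%:R + (gB i (L j.*2.+1)./2 - gB i 0%N)].
  have : forall i : 'I_K.+1, exists ag : (S -> R) * (nat -> R),
      [/\ continuous ag.1,
      forall z, C cB (Q z) -> ag.1 z \is a Num.int &
      forall j, (j <= K)%N -> ag.1 (E (x j.*2.+1)) =
        (i == j :> nat)%:R + (ag.2 (L j.*2.+1)./2 - ag.2 0%N)].
    move=> i; have iK := oK i.
    have [u cu [uZ uE]] := odd_indicator iK.
    have [al [g [cal alZ alE]]] := marked_function cu uZ.
    (* The pairing differentiates the second function on all of [S], so it is extended off the
       preimage of [C cB]. *)
    have [be cbe beE] := tietze_compact cS hS (@clQ cB) cal.
    exists (be, g); split => //= [z Cz|j jK]; first by rewrite beE// alZ.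
    have jN : (j.*2.+1 < N)%N by lia.
    have tyj : ty (L j.*2.+1) = cB by rewrite tyL//= odd_double addbT.
    rewrite beE; last first.
      by have := nCx jN; have [] := coverC (q (x j.*2.+1)) (ty (L j.*2.+1)); rewrite tyj.
    by rewrite (alE _ _ (x01 jN) (LM jN)) ?uE//; have [] := blocks jN.
  move=> /choice[ag agP].
  by exists (fun i => (ag i).1), (fun i => (ag i).2).
have pair0 (i i' : 'I_K.+1) : \sum_(j < K.+1) alpha i (E (x j.*2)) *
    (beta i' (E (x j.*2.+1)) - beta i' (E (x (ord_pred j).*2.+1))) = 0.
  have [cal alZ _] := alphaP i; have [cbe beZ _] := betaP i'.
  (* An integer function is constant on an arc inside its set, so its value at a mark equals its
     value at a neighbouring end of the block. *)
  have alxy j : (j <= K)%N -> alpha i (E (x j.*2)) = alpha i (E (Y j.*2.+1)).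
    move=> jK; have jN : (j.*2 < N)%N by lia.
    have [/andP[yx xy] _ _] := blocks jN.
    apply: (int_on_arc_cst cE xy cal) => // t /andP[xt ty'].
    by have := Cblock _ jN t; rewrite odd_double; apply; rewrite (le_trans yx).
  have bexy j : (j <= K)%N -> beta i' (E (x j.*2.+1)) = beta i' (E (Y j.*2.+1)).
    move=> jK; have jN : (j.*2.+1 < N)%N by lia.
    have [/andP[yx xy] _ _] := blocks jN; apply/esym.
    apply: (int_on_arc_cst cE yx (C := Q @^-1` C cB)) => //.
      exact: continuous_subspaceT.
    move=> t /andP[yt tx].
    by have := Cblock _ jN t; rewrite /= odd_double; apply; rewrite yt (le_trans tx).
  (* The partition starts at the end of block [0], so that an arc in [C cA] passes through [E 0]. *)
  have := @alternating_pairing_eq0 R S liftS _ _ (alpha i) (beta i') (@clQ cA) (@clQ cB)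
    AB cal cbe alZ beZ E K (fun j => Y j.+1) cE E01.
  under eq_bigr => j _.
    rewrite -(alxy j (oK j)) -(bexy j (oK j)) -(bexy (ord_pred j) (oK _)).
    over.
  move=> /= H; apply: H.
  - by apply: Y_ge0; lia.
  - by apply: Y_le1; lia.
  - by move=> j jK; apply: Y_mono; lia.
  - by move=> t t01; apply: (Cblock 0%N); last exact: t01; lia.
  - move=> t /andP[yt t1]; have [KN'|KN'] := ltnP K.*2.+2 N; last first.
      have NE : N = K.*2.+2 by lia.
      have -> : t = 1 by apply/eqP; rewrite eq_le t1 -YN NE.
      rewrite /= -E01; apply: (Cblock 0%N); first lia.
      by rewrite lexx /= -[leLHS]/(Y 0%N); apply: Y_mono; lia.
    have NE : N = K.*2.+3 by lia.
    by have := Cblock _ KN' t; rewrite /= odd_double; apply; rewrite yt -NE YN.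
  - move=> j t jK yt; have jN : (j.*2.+1 < N)%N by lia.
    by have := Cblock _ jN t; rewrite /= odd_double; exact.
  - move=> j t jK yt; have jN : (j.*2.+2 < N)%N by lia.
    by have := Cblock _ jN t; rewrite /= odd_double; exact.
pose p c := ((M.-1 - (c != ty 0%N))./2)%N.
have := @cyclic_pairing_bound R K (p cA) (p cB)
  (fun i j => alpha i (E (x j.*2))) (fun i j => beta i (E (x j.*2.+1)))
  gA gB (fun j => (L j.*2)./2) (fun j => (L j.*2.+1)./2) _ _ _ _ pair0.
(* [size_s] gives [N >= 3 M - 2], so [N / 2 >= M] as [M >= 2]; hence [K >= M - 1], while the two
   ranks total at most [M - 2]. *)
have KM : (p cA + p cB < K)%N.
  have : (p cA + p cB <= M.-2)%N.
    rewrite /p /cB; case: (cA); case: (ty 0%N) => /=; lia.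
  by rewrite /K -/N; move: size_s M2 (odd_double_half N); rewrite -/N; case: (odd N); lia.
move=> H; suff : (K <= p cA + p cB)%N by rewrite leqNgt KM.
apply: H.
- move=> j; have jN : (j.*2 < N)%N by have := ltn_ord j; lia.
  have := label_half_bound (LM jN); rewrite tyL// odd_double addbF; exact.
- move=> j; have jN : (j.*2.+1 < N)%N by have := ltn_ord j; lia.
  have := label_half_bound (LM jN); rewrite tyL//= odd_double addbT; exact.
- by move=> i j; have [_ _ ->] := alphaP i.
- by move=> i j; have [_ _ ->] := betaP i.
Qed.

End CoreTheorem.

(** * The adjunction space and the disk *)

Section AdjunctionFibres.
Local Open Scope quotient_scope.
Context {D J : topologicalType} {B : set D} (f : B -> J).

Lemma adj_glue (x : B) : adj_disk f (set_val x) = adj_circle f (f x).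
Proof. by apply/eqmodP/asboolP/rst_step; exists x. Qed.

(* Each class has at most one representative that is not a point of [B]. *)
Let normal (a : disjoint_union D J) : disjoint_union D J :=
  match a with
  | existT true x =>
      if pselect (B x) is left Bx then inJ D (f (SigSub (mem_set Bx)))
      else inD J x
  | existT false y => inJ D y
  end.

Let normal_equiv a b : adj_equiv f a b -> normal a = normal b.
Proof.
elim=> {a b} [a b [x -> ->]| | |]; [|by []|by []|by move=> ? ? ? _ -> _ ->].
rewrite /normal /=; case: pselect => [Bx|[]]; last exact: set_valP.
by congr (inJ D (f _)); apply: val_inj => /=; rewrite set_valE.
Qed.

Let normal_pi (a b : disjoint_union D J) :
  \pi_(adjunction f) a = \pi b -> normal a = normal b.
Proof. by move=> /eqmodP/asboolP; exact: normal_equiv. Qed.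

Let inJ_inj : injective (@inJ D J).
Proof. by move=> x y xy; exact: (existT_inj2 xy). Qed.

Lemma adj_circle_inj : injective (adj_circle f).
Proof. by move=> x y /normal_pi /inJ_inj. Qed.

Lemma adj_disk_inj (x y : D) : adj_disk f x = adj_disk f y ->
  x = y \/ (B x /\ B y).
Proof.
move=> /normal_pi; rewrite /normal /=.
case: pselect => [Bx|nBx]; case: pselect => [By|nBy] //; first by right.
by move=> xy; left; exact: (existT_inj2 xy).
Qed.

Lemma adjunction_cover (z : adjunction f) :
  (exists x, z = adj_disk f x) \/ exists y, z = adj_circle f y.
Proof.
by elim/quotW: z => -[[] x]; [left|right]; exists x.
Qed.

End AdjunctionFibres.

(** * A parametrization of the unit circle *)

Section CircleParametrization.
Context {R : realType}.
Implicit Types (v w : 'rV[R]_2) (a b t : R).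

Definition vec2 a b : 'rV[R]_2 :=
  a *: delta_mx ord0 ord0 + b *: delta_mx ord0 ord_max.

Lemma vec2_0 a b : vec2 a b ord0 ord0 = a.
Proof. by rewrite !mxE /= mulr1 mulr0 addr0. Qed.

Lemma vec2_1 a b : vec2 a b ord0 ord_max = b.
Proof. by rewrite !mxE /= mulr1 mulr0 add0r. Qed.

Lemma vec2E v : v = vec2 (v ord0 ord0) (v ord0 ord_max).
Proof.
apply/rowP => -[[|[|//]] p].
  by rewrite (_ : Ordinal p = ord0) ?vec2_0//; exact: val_inj.
by rewrite (_ : Ordinal p = ord_max) ?vec2_1//; exact: val_inj.
Qed.

Lemma sum_sqr2 v : \sum_j v ord0 j ^+ 2 = v ord0 ord0 ^+ 2 + v ord0 ord_max ^+ 2.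
Proof.
rewrite !big_ord_recl big_ord0 addr0.
by rewrite (_ : fintype.lift ord0 ord0 = ord_max :> 'I_2)//; exact: val_inj.
Qed.

Lemma vec2_continuous (T : topologicalType) (f g : T -> R) :
  continuous f -> continuous g -> continuous (fun x => vec2 (f x) (g x)).
Proof.
move=> cf cg x; have cfx := cf x; have cgx := cg x.
exact: (cvgD (cvgZ cfx (cvg_cst _)) (cvgZ cgx (cvg_cst _))).
Qed.

(* The circle is traversed once for [t] in [[0, 1]], from [(1, 0)], with
   abscissa [|4 t - 2| - 1]; no trigonometry is needed. *)
Let clamp t := Num.min (Num.max t 0) 1.
Let dev t := 4 * clamp t - 2.
Let absc t := `|dev t| - 1.
Let ordi t := Num.sqrt (Num.max 0 (- dev t) * (2 - `|dev t|)) -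
              Num.sqrt (Num.max 0 (dev t) * (2 - `|dev t|)).

Let clampE t : 0 <= t <= 1 -> clamp t = t.
Proof. by move=> /andP[t0 t1]; rewrite /clamp max_l// min_l. Qed.

Let dev_le2 t : `|dev t| <= 2.
Proof.
have : 0 <= clamp t <= 1.
  by rewrite /clamp ge_min lexx orbT andbT le_min ler01 andbT le_max lexx orbT.
by rewrite /dev ler_norml => /andP[]; lra.
Qed.

Let absc_ordi t : absc t ^+ 2 + ordi t ^+ 2 = 1.
Proof.
have d2 := dev_le2 t; rewrite /absc /ordi.
have [d0|d0] := leP 0 (dev t).
  rewrite ger0_norm// in d2 *.
  rewrite (max_l (_ : - dev t <= 0)) ?oppr_le0// mul0r sqrtr0 sub0r sqrrN.
  have h : 0 <= dev t * (2 - dev t) by rewrite mulr_ge0// subr_ge0.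
  by rewrite sqr_sqrtr//; ring.
rewrite ltr0_norm// in d2 *.
rewrite mul0r sqrtr0 subr0 max_r; last by rewrite oppr_ge0 ltW.
have h : 0 <= - dev t * (2 - - dev t).
  by rewrite mulr_ge0 ?subr_ge0 ?oppr_ge0 ?(ltW d0).
by rewrite sqr_sqrtr//; ring.
Qed.

Let clamp_cont : continuous (clamp : R -> R).
Proof.
move=> t; apply: (@continuous_min R R (fun s => Num.max s 0) (fun=> 1)).
  apply: (@continuous_max R R id (fun=> 0)); first exact: cvg_id.
  exact: cvg_cst.
exact: cvg_cst.
Qed.

Let dev_cont : continuous dev.
Proof.
move=> t; apply: cvgB; last exact: cvg_cst.
by apply: cvgM; [exact: cvg_cst|exact: clamp_cont].
Qed.

Let absc_cont : continuous absc.
Proof.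
by move=> t; apply: cvgB; [apply: cvg_norm; exact: dev_cont|exact: cvg_cst].
Qed.

Let ordi_cont : continuous ordi.
Proof.
have half (f : R -> R) : continuous f ->
    continuous (fun t => Num.sqrt (Num.max 0 (f t) * (2 - `|dev t|))).
  move=> cf t; apply: (cvg_comp _ Num.sqrt _ (@sqrt_continuous _ _)).
  have cmax : {for t, continuous (fun t => Num.max 0 (f t))}.
    by apply: (@continuous_max R R (fun=> 0) f); [exact: cvg_cst|exact: cf].
  apply: cvgM; first exact: cmax.
  by apply: cvgB; [exact: cvg_cst|apply: cvg_norm; exact: dev_cont].
move=> t; have h1 := half _ dev_cont t.
have h2 := half (fun t => - dev t) (fun t => cvgN (dev_cont (x := t))) t.
by apply: cvgB; [exact: h2|exact: h1].
Qed.

Let ordi_neg t : dev t <= 0 -> ordi t = Num.sqrt (- dev t * (2 - `|dev t|)).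
Proof.
move=> d0; rewrite /ordi (max_l d0) mul0r sqrtr0 subr0 max_r//.
by rewrite oppr_ge0.
Qed.

Let ordi_pos t : 0 <= dev t -> ordi t = - Num.sqrt (dev t * (2 - `|dev t|)).
Proof.
by move=> d0; rewrite /ordi (max_l (_ : - dev t <= 0)) ?oppr_le0// mul0r sqrtr0 sub0r max_r.
Qed.

Let param_inj s t : 0 <= s <= 1 -> 0 <= t <= 1 -> absc s = absc t ->
  ordi s = ordi t -> [\/ s = t, s = 0 /\ t = 1 | s = 1 /\ t = 0].
Proof.
wlog st : s t / dev s <= dev t => [th s01 t01 a o|s01 t01].
  have [st|ts] := leP (dev s) (dev t); first exact: th.
  by have [->|[-> ->]|[-> ->]] := th t s (ltW ts) t01 s01 (esym a) (esym o);
    [exact: Or31|exact: Or33|exact: Or32].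
move=> /addIr dst ost; have devE u : 0 <= u <= 1 -> dev u = 4 * u - 2.
  by move=> u01; rewrite /dev clampE.
have [sE|sN] := eqVneq (dev s) (dev t).
  by apply: Or31; move: sE; rewrite !devE//; lra.
have {st}lt_st : dev s < dev t by rewrite lt_neqAle sN.
have [s0 t0 dsE] : [/\ dev s <= 0, 0 <= dev t & dev s = - dev t].
  move: dst; have [s0|s0] := leP 0 (dev s); have [t0|t0] := leP 0 (dev t).
  - by rewrite !ger0_norm// => sE; rewrite sE ltxx in lt_st.
  - by move: (lt_trans lt_st t0); rewrite ltNge s0.
  - by rewrite ltr0_norm// ger0_norm// => sE; split => //; [exact: ltW|lra].
  - by rewrite !ltr0_norm// => /oppr_inj sE; rewrite sE ltxx in lt_st.
move: ost; rewrite ordi_neg// ordi_pos// dsE normrN opprK ger0_norm// => sq0.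
have : Num.sqrt (dev t * (2 - dev t)) = 0 by move: sq0; lra.
move/eqP; rewrite sqrtr_eq0 => le0.
have d2 := dev_le2 t; rewrite ger0_norm// in d2.
have /eqP : dev t * (2 - dev t) = 0.
  by apply/eqP; rewrite eq_le le0 mulr_ge0// subr_ge0.
rewrite mulf_eq0 => /orP[/eqP dt0|/eqP dt2].
  by move: lt_st; rewrite dsE dt0 oppr0 ltxx.
apply: Or32; move: dsE dt2; rewrite !devE// => *; split; lra.
Qed.

Let param_surj a b : a ^+ 2 + b ^+ 2 = 1 ->
  exists2 t, 0 <= t <= 1 & absc t = a /\ ordi t = b.
Proof.
move=> ab1; have a1 : -1 <= a <= 1.
  have b2 := sqr_ge0 b; rewrite -ler_norml -(@ler_pXn2r _ 2) ?nnegrE//.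
  by rewrite expr1n real_normK ?num_real//; lra.
have [b0|b0] := leP 0 b.
  (* This solves [absc t = a] on the half where [dev t <= 0], on which the ordinate is nonnegative;
     the other witness solves it on the other half. *)
  exists ((1 - a) / 4); first lra.
  have dE : dev ((1 - a) / 4) = - (1 + a) by rewrite /dev clampE; lra.
  have d0 : dev ((1 - a) / 4) <= 0 by rewrite dE; lra.
  split; first by rewrite /absc ler0_norm// dE; ring.
  rewrite ordi_neg// ler0_norm// dE opprK.
  rewrite (_ : (1 + a) * (2 - (1 + a)) = b ^+ 2) ?sqrtr_sqr ?ger0_norm//.
  by rewrite (_ : b ^+ 2 = 1 - a ^+ 2); [ring|lra].
exists ((a + 3) / 4); first lra.
have dE : dev ((a + 3) / 4) = 1 + a by rewrite /dev clampE; lra.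
have d0 : 0 <= dev ((a + 3) / 4) by rewrite dE; lra.
split; first by rewrite /absc ger0_norm// dE; ring.
rewrite ordi_pos// ger0_norm// dE.
rewrite (_ : (1 + a) * (2 - (1 + a)) = b ^+ 2) ?sqrtr_sqr ?ltr0_norm ?opprK//.
by rewrite (_ : b ^+ 2 = 1 - a ^+ 2); [ring|lra].
Qed.

Lemma circle_parametrization (z : unit_disk R) : unit_circle R (set_val z) ->
  exists E : R -> unit_disk R, [/\ continuous E,
    forall t, unit_circle R (set_val (E t)), E 0 = z /\ E 1 = z,
    forall s t, 0 <= s <= 1 -> 0 <= t <= 1 -> E s = E t ->
      [\/ s = t, s = 0 /\ t = 1 | s = 1 /\ t = 0] &
    forall w : unit_disk R, unit_circle R (set_val w) ->
      exists2 t, 0 <= t <= 1 & E t = w].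
Proof.
rewrite /unit_circle /= sum_sqr2; set p := set_val z ord0 ord0.
set r := set_val z ord0 ord_max => pr1.
(* Complex multiplication by [z = p + i r] rotates the standard curve so that it starts at [z]. *)
pose e t := vec2 (p * absc t - r * ordi t) (p * ordi t + r * absc t).
have e_circle t : \sum_j e t ord0 j ^+ 2 = 1.
  rewrite sum_sqr2 vec2_0 vec2_1 -[RHS]mulr1 -{1}pr1 -(absc_ordi t); ring.
have e_disk t : e t \in unit_disk R by apply/mem_set; rewrite /unit_disk/= e_circle.
pose E t : unit_disk R := SigSub (e_disk t).
have valE t : set_val (E t) = e t by rewrite set_valE.
have [a0 o0] : absc 0 = 1 /\ ordi 0 = 0.
  rewrite /absc /ordi /dev clampE ?lexx ?ler01// mulr0 sub0r normrN.
  rewrite ger0_norm// opprK subrr !mulr0 sqrtr0 subrr; split => //; ring.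
have [a1 o1] : absc 1 = 1 /\ ordi 1 = 0.
  rewrite /absc /ordi /dev clampE ?lexx ?ler01// mulr1 (_ : 4 - 2 = 2); last ring.
  rewrite ger0_norm// subrr !mulr0 sqrtr0 subrr; split => //; ring.
have Ez t : absc t = 1 -> ordi t = 0 -> E t = z.
  move=> at1 ot0; apply: (proj1 (@embedding_set_val _ (unit_disk R))).
  by rewrite valE /e at1 ot0 !mulr1 !mulr0 subr0 add0r -vec2E.
exists E; split.
- apply: (continuous_embedding (@embedding_set_val _ (unit_disk R))).
  rewrite (_ : _ \o E = e); last by apply/funext => t; exact: valE.
  apply: vec2_continuous => t.
    exact: (cvgB (cvgM (cvg_cst p) (absc_cont (x := t)))
      (cvgM (cvg_cst r) (ordi_cont (x := t)))).
  exact: (cvgD (cvgM (cvg_cst p) (ordi_cont (x := t)))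
    (cvgM (cvg_cst r) (absc_cont (x := t)))).
- by move=> t; rewrite valE.
- by split; exact: Ez.
- move=> s t s01 t01 /(congr1 set_val); rewrite !valE => est.
  have := congr1 (fun v => v ord0 ord0) est; have := congr1 (fun v => v ord0 ord_max) est.
  rewrite !vec2_0 !vec2_1 => e1 e2; apply: param_inj => //.
    have H u : absc u = p * (p * absc u - r * ordi u) + r * (p * ordi u + r * absc u).
      by rewrite -[LHS]mul1r -pr1; ring.
    by rewrite (H s) (H t) e1 e2.
  have H u : ordi u = p * (p * ordi u + r * absc u) - r * (p * absc u - r * ordi u).
    by rewrite -[LHS]mul1r -pr1; ring.
  by rewrite (H s) (H t) e1 e2.
- move=> w; rewrite sum_sqr2; set a := set_val w ord0 ord0.
  set b := set_val w ord0 ord_max => ab1.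
  have [|t t01 [ta tb]] := @param_surj (p * a + r * b) (p * b - r * a).
    by rewrite -[RHS]mulr1 -{1}pr1 -ab1; ring.
  exists t => //; apply: (proj1 (@embedding_set_val _ (unit_disk R))).
  rewrite valE /e ta tb [RHS]vec2E -/a -/b; congr vec2.
    by rewrite -[RHS]mul1r -pr1; ring.
  by rewrite -[RHS]mul1r -pr1; ring.
Qed.

End CircleParametrization.

(** * Edges of the boundary circle *)

Section Edges.
Context {R : realType} {J : topologicalType} (F : R -> J) (v : J).
Hypotheses (hJ : hausdorff_space J) (cF : continuous F).

Definition edge (u w : R) : Prop :=
  [/\ u < w, F u = v, F w = v, forall s t, u < s < w -> u < t < w ->
    F s = F t -> s = t & F @` `]u, w[ = ~` [set v]].

Lemma closed_image_segment a b : closed (F @` `[a, b]).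
Proof.
apply: compact_closed => //; apply: continuous_compact.
  exact: continuous_subspaceT.
exact: segment_compact.
Qed.

Lemma edge_neq u w t : edge u w -> u < t < w -> F t <> v.
Proof.
move=> [_ _ _ _ FE] ut; have : (F @` `]u, w[) (F t).
  by exists t => //=; rewrite in_itv.
by rewrite FE.
Qed.

(** Two edges cover [J] once each, so a bijection [tau] between the open intervals relates them. It
    is continuous by compactness, hence monotone, and it extends to the ends; either direction can
    occur. *)
Lemma edge_map u w u' w' : edge u w -> edge u' w' ->
  exists sig : R -> R, [/\ forall t, u <= t <= w -> u' <= sig t <= w',
    forall t, u <= t <= w -> F (sig t) = F t,
    forall z, u' <= z <= w' -> exists2 t, u <= t <= w & sig t = z &
    {in `[u, w] &, {mono sig : x y / x <= y}} \/
    {in `[u, w] &, {mono sig : x y /~ x <= y}}].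
Proof.
move=> e1 e2; have [uw Fu Fw Finj FE] := e1; have [uw' Fu' Fw' Finj' FE'] := e2.
have ex t : exists t', u < t < w -> u' < t' < w' /\ F t' = F t.
  have [tuw|tuw] := pselect (u < t < w); last by exists 0.
  have : (F @` `]u', w'[) (F t) by rewrite FE'; exact: edge_neq tuw.
  by move=> [t' /=]; rewrite in_itv/= => t'uw t't; exists t'.
have [tau tauP] := choice ex.
have tau_inj : {in `]u, w[ &, injective tau}.
  move=> s t; rewrite !in_itv/= => sI tI st; apply: Finj => //.
  by rewrite -(proj2 (tauP s sI)) -(proj2 (tauP t tI)) st.
have tau_cont : {within `]u, w[, continuous tau}.
  apply/subspace_continuousP => t /=; rewrite in_itv/= => tI.
  have [tI' Ft] := tauP t tI; apply/cvgrPdist_lt => e e0.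
  (* The image of all parameters at distance at least [e] from [tau t] is closed and misses [F t],
     so points near [t] have [tau] values near [tau t]. *)
  pose K := F @` `[u', tau t - e] `|` F @` `[tau t + e, w'].
  have nK : ~ K (F t).
    rewrite -Ft; move=> [] [r /=]; rewrite in_itv/= => /andP[r1 r2] rt.
      have [ur|ru] := ltP u' r; last first.
        have re : r = u' by apply/eqP; rewrite eq_le ru.
        by apply: (edge_neq e2 tI'); rewrite -rt re.
      have rI : u' < r < w'.
        by rewrite ur (le_lt_trans r2)//; case/andP: tI' => _ ?; lra.
      by have := Finj' _ _ rI tI' rt => re; lra.
    have [rw|wr] := ltP r w'; last first.
      have re : r = w' by apply/eqP; rewrite eq_le r2.
      by apply: (edge_neq e2 tI'); rewrite -rt re.
    have rI : u' < r < w'.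
      by rewrite rw andbT (lt_le_trans _ r1)//; case/andP: tI' => ? _; lra.
    by have := Finj' _ _ rI tI' rt => re; lra.
  have : \forall s \near t, (~` K) (F s).
    apply: cF; apply: open_nbhs_nbhs; split => //; apply: closed_openC.
    by apply: closedU; exact: closed_image_segment.
  move=> nearK; change (\forall s \near t, u < s < w -> `|tau t - tau s| < e).
  apply: filterS nearK => s nKs sI; have [sI' Fs] := tauP s sI.
  rewrite ltNge; apply/negP => le_e; apply: nKs; rewrite -Fs.
  have [ts|st] := leP (tau t) (tau s).
    right; exists (tau s) => //=; rewrite in_itv/=.
    case/andP: sI' => _ /ltW ->; rewrite andbT.
    by move: le_e; rewrite ler0_norm ?subr_le0//; lra.
  left; exists (tau s) => //=; rewrite in_itv/=.
  case/andP: sI' => /ltW -> _ /=.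
  by move: le_e; rewrite gtr0_norm ?subr_gt0//; lra.
have tau_surj z : u' < z < w' -> exists2 t, u < t < w & tau t = z.
  move=> zI; have : (F @` `]u, w[) (F z) by rewrite FE; exact: edge_neq zI.
  move=> [t /=]; rewrite in_itv/= => tI tz; exists t => //.
  by have [tI' Ft] := tauP t tI; apply: Finj' => //; rewrite Ft.
(* All four ends are sent to [v], so they may be matched in either order; the direction of [tau]
   decides which one is monotone. *)
have extend a b : (a, b) = (u', w') \/ (a, b) = (w', u') ->
    exists sig : R -> R, [/\ forall t, u <= t <= w -> u' <= sig t <= w',
      forall t, u <= t <= w -> F (sig t) = F t,
      forall z, u' <= z <= w' -> exists2 t, u <= t <= w & sig t = z,
      sig u = a /\ sig w = b & forall t, u < t < w -> sig t = tau t].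
  move=> ab; pose sig t := if t <= u then a else if w <= t then b else tau t.
  have su : sig u = a by rewrite /sig lexx.
  have sw : sig w = b by rewrite /sig lexx leNgt uw.
  have st t : u < t < w -> sig t = tau t.
    by move=> /andP[ut tw]; rewrite /sig leNgt ut leNgt tw.
  have cases t : u <= t <= w -> [\/ t = u, t = w | u < t < w].
    move=> /andP[]; rewrite le_eqVlt => /orP[/eqP<- _|ut]; first exact: Or31.
    by rewrite le_eqVlt => /orP[/eqP->|tw]; [exact: Or32|apply: Or33; rewrite ut].
  have aI : u' <= a <= w' by case: ab => -[-> _]; rewrite lexx (ltW uw').
  have bI : u' <= b <= w' by case: ab => -[_ ->]; rewrite lexx (ltW uw').
  have Fa : F a = v by case: ab => -[-> _].
  have Fb : F b = v by case: ab => -[_ ->].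
  exists sig; split => //.
  - move=> t /cases[->|->|tI]; rewrite ?su ?sw ?st//.
    by have [/andP[/ltW-> /ltW->]] := tauP t tI.
  - move=> t /cases[->|->|tI]; rewrite ?su ?sw ?st ?Fa ?Fb ?Fu ?Fw//.
    by have [] := tauP t tI.
  - move=> z /andP[]; rewrite le_eqVlt => /orP[/eqP<- _|uz].
      by case: ab => -[ae be]; [exists u|exists w];
        rewrite ?lexx ?(ltW uw)// ?su ?sw.
    rewrite le_eqVlt => /orP[/eqP->|zw].
      by case: ab => -[ae be]; [exists w|exists u];
        rewrite ?lexx ?(ltW uw)// ?su ?sw.
    have [|t tI tz] := tau_surj z; first by rewrite uz.
    by exists t; rewrite ?st//; case/andP: tI => /ltW-> /ltW->.
have tauI t : u < t < w -> u' < tau t /\ tau t < w'.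
  by move=> /tauP[/andP[]].
have cases s t : s \in `[u, w] -> t \in `[u, w] -> s < t ->
    (s = u \/ u < s < w) /\ (t = w \/ u < t < w).
  rewrite !in_itv/= => /andP[us sw] /andP[ut tw] st; split.
    move: us; rewrite le_eqVlt => /orP[/eqP<-|us]; [by left|right].
    by rewrite us (lt_le_trans st).
  move: tw; rewrite le_eqVlt => /orP[/eqP->|tw]; [by left|right].
  by rewrite tw (le_lt_trans us).
have [tau_mono|tau_mono] := itv_continuous_inj_mono tau_cont tau_inj.
  have [sig [s1 s2 s3 [su sw] s5]] := extend u' w' (or_introl erefl).
  exists sig; split => //; left; apply: le_mono_in => s t sI tI st.
  have [sc tc] := cases s t sI tI st.
  case: sc st => [->|sJ] st; case: tc st => [->|tJ] st; rewrite ?su ?sw ?s5//.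
  - by case: (tauI t tJ).
  - by case: (tauI s sJ).
  - by apply: tau_mono; rewrite // in_itv.
have [sig [s1 s2 s3 [su sw] s5]] := extend w' u' (or_intror erefl).
exists sig; split => //; right; apply: le_nmono_in => t s tI sI st.
have [sc tc] := cases s t sI tI st.
case: sc st => [->|sJ] st; case: tc st => [->|tJ] st; rewrite ?su ?sw ?s5//.
- by case: (tauI t tJ).
- by case: (tauI s sJ).
- by apply: tau_mono; rewrite // in_itv.
Qed.

End Edges.

Section ChainOverEdges.
Context {R : realType} {J : topologicalType} {X : Type} (F : R -> J) (v : J)
  (G : J -> X) (C : bool -> set X) (ty : nat -> bool) (pt : nat -> X).
Hypotheses (hJ : hausdorff_space J) (cF : continuous F).
Local Notation q := (G \o F).
Local Notation edges u ps := (path (fun a b => `[< edge F v a b >]) u ps).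

(** An edge traversed backwards reverses the chain, which still alternates; only the set of labels
    survives in both cases. *)
Lemma chain_on_edge M u0 w0 s u w : edge F v u0 w0 -> edge F v u w ->
  chain_of q C ty pt u0 s w0 -> alternates ty s -> labels s = iota 0 M ->
  exists s', [/\ chain_of q C ty pt u s' w, alternates ty s', size s' = M &
    {subset labels s' <= iota 0 M}].
Proof.
move=> e0 e1 cs as_ ls; have uw0 : u0 < w0 by case: e0.
have [sig [sigI Fsig sig_surj sig_mono]] := edge_map hJ cF e0 e1.
have qsig t : u0 <= t <= w0 -> q (sig t) = q t by move=> /Fsig /= ->.
have uw : u < w by case: e1.
have end_in t : u0 <= t <= w0 -> t \in `[u0, w0] by rewrite in_itv.
have [t0 t0I t0u] : exists2 t, u0 <= t <= w0 & sig t = u.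
  by apply: sig_surj; rewrite lexx ltW.
have [t1 t1I t1w] : exists2 t, u0 <= t <= w0 & sig t = w.
  by apply: sig_surj; rewrite lexx ltW.
have u0I : u0 <= u0 <= w0 by rewrite lexx ltW.
have w0I : u0 <= w0 <= w0 by rewrite lexx ltW.
case: sig_mono => sig_mono.
  have su : sig u0 = u.
    apply/eqP; rewrite eq_le -{1}t0u sig_mono ?end_in//.
    by case/andP: t0I => -> _; case/andP: (sigI _ u0I).
  have sw : sig w0 = w.
    apply/eqP; rewrite eq_le -{2}t1w sig_mono ?end_in//.
    by case/andP: t1I => _ ->; case/andP: (sigI _ w0I) => _ ->.
  have [s' [cs' ls']] := chain_of_increasing qsig sig_surj sigI sig_mono
    (lexx _) (lexx _) cs.
  exists s'; rewrite -{1}su -{1}sw; split => //; first by rewrite /alternates ls'.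
    by rewrite -(size_map (fun b => b.1.2)) -/(labels s') ls' ls size_iota.
  by rewrite ls' ls.
have su : sig w0 = u.
  apply/eqP; rewrite eq_le -{1}t0u sig_mono ?end_in//.
  by case/andP: t0I => _ ->; case/andP: (sigI _ w0I).
have sw : sig u0 = w.
  apply/eqP; rewrite eq_le -{2}t1w sig_mono ?end_in//.
  by case/andP: t1I => -> _; case/andP: (sigI _ u0I) => _ ->.
have [s' [cs' ls']] := chain_of_decreasing qsig sig_surj sigI sig_mono
  (lexx _) (lexx _) cs.
exists s'; rewrite -{1}su -{1}sw; split => //.
- rewrite /alternates ls' rev_sorted (eq_sorted (e' := fun l l' => ty l != ty l'))//.
  by move=> l l'; rewrite eq_sym.
- by rewrite -(size_map (fun b => b.1.2)) -/(labels s') ls' size_rev ls size_iota.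
- by move=> l; rewrite ls' mem_rev ls.
Qed.

(** Each edge brings [M] marks and each of the [size ps - 1] merges loses at most one, so at least
    [size ps * M.-1 + 1] remain. *)
Lemma chain_over_edges M u0 w0 s u ps : (0 < M)%N -> edge F v u0 w0 ->
  chain_of q C ty pt u0 s w0 -> alternates ty s -> labels s = iota 0 M ->
  ps != [::] -> edges u ps ->
  exists s', [/\ chain_of q C ty pt u s' (last u ps), alternates ty s',
    (size ps * M.-1 < size s')%N & {subset labels s' <= iota 0 M}].
Proof.
move=> M0 e0 cs as_ ls; elim: ps u => // w ps IHps u _ /= /andP[/asboolP e1 eps].
have [s1 [cs1 as1 size1 sub1]] := chain_on_edge e0 e1 cs as_ ls.
have [->|ps0] := eqVneq ps [::].
  by exists s1; split => //; rewrite size1 mul1n prednK.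
have [s2 [cs2 as2 size2 sub2]] := IHps w ps0 eps.
have s1_neq0 : s1 != [::] by rewrite -size_eq0 size1 -lt0n.
have s2_neq0 : s2 != [::] by rewrite -size_eq0 -lt0n; exact: leq_ltn_trans size2.
have [s3 [cs3 as3 size3 _ sub3]] := chain_of_merge s1_neq0 s2_neq0 cs1 cs2 as1 as2.
exists s3; split => //; first last.
  by move=> l /sub3; rewrite mem_cat => /orP[/sub1|/sub2].
move: size3 size2; rewrite /= mulSn size1; move: (size ps * M.-1)%N => k; lia.
Qed.

End ChainOverEdges.

Section ArcsAreEdges.
Context {R : realType} {Bd J : topologicalType} (e : R -> Bd) (f : Bd -> J) (v : J).
Hypotheses (hBd : hausdorff_space Bd) (ce : continuous e).
Hypotheses (e01 : e 0 = e 1)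
  (e_inj : forall s t, 0 <= s <= 1 -> 0 <= t <= 1 -> e s = e t ->
    [\/ s = t, s = 0 /\ t = 1 | s = 1 /\ t = 0])
  (e_surj : forall x, exists2 t, 0 <= t <= 1 & e t = x).
Hypothesis f_component : forall x, f x <> v ->
  let K := connected_component (~` (f @^-1` [set v])) x in
  {in K &, injective f} /\ f @` K = ~` [set v].
Local Notation F := (f \o e).

(** The arc over the gap is connected, so it lies in the component of its midpoint. It is open and
    closed there: the rest of the circle is a union of two compact arcs, and closing up the arc adds
    only points over [v]. *)
Lemma edge_of_gap u w : 0 <= u -> u < w -> w <= 1 -> F u = v -> F w = v ->
  (forall t, u < t < w -> F t <> v) -> edge F v u w.
Proof.
move=> u0 uw w1 Fu Fw gap; pose m := (u + w) / 2.
have mI : u < m < w by rewrite /m; apply/andP; split; lra.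
have [] := f_component (gap m mI); set K := connected_component _ _ => Kinj KE.
have KI : K = e @` `]u, w[.
  have iu t : u < t < w -> (e @` `]u, w[) (e t) by exists t => //=; rewrite in_itv.
  have Im : (e @` `]u, w[) (e m) by exact: iu.
  have sub_compl : e @` `]u, w[ `<=` ~` (f @^-1` [set v]).
    by move=> y [t tI <-]; apply: gap; move: tI; rewrite /= in_itv.
  have closed_seg c d : closed (e @` `[c, d]) by exact: closed_image_segment.
  apply/seteqP; split.
    have eq_seg t c : u <= t <= w -> 0 <= c <= 1 -> e t = e c ->
        [\/ t = c, t = u | t = w].
      move=> /andP[ut tw] c01 etc.
      have t01 : 0 <= t <= 1 by rewrite (le_trans u0 ut) (le_trans tw).
      have [->|[t0 _]|[t1 _]] := e_inj t01 c01 etc; first exact: Or31.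
        by apply: Or32; apply/eqP; rewrite eq_le ut t0 u0.
      by apply: Or33; apply/eqP; rewrite eq_le tw t1 w1.
    have KE' : K `&` e @` `]u, w[ = K.
      have Kconn : connected K by exact: component_connected.
      apply: Kconn.
      - by exists (e m); split => //; apply: connected_component_refl; exact: gap.
      - exists (~` (e @` `[0, u] `|` e @` `[w, 1])).
          by apply: closed_openC; exact: closedU.
        apply/seteqP; split => x [Kx].
          move=> [t /=]; rewrite in_itv/= => /andP[ut tw] tx; split => //.
          have uwt : u <= t <= w by rewrite !ltW.
          move=> [] [c /=]; rewrite in_itv/= => /andP[c1 c2] cx.
            have c01 : 0 <= c <= 1 by rewrite c1 (le_trans c2)// (le_trans (ltW uw)).
            have [tc|tu|tw'] := eq_seg t c uwt c01 (etrans tx (esym cx)).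
            - by move: ut; rewrite tc ltNge c2.
            - by move: ut; rewrite tu ltxx.
            - by move: tw; rewrite tw' ltxx.
          have c01 : 0 <= c <= 1 by rewrite c2 (le_trans _ c1)// (le_trans u0 (ltW uw)).
          have [tc|tu|tw'] := eq_seg t c uwt c01 (etrans tx (esym cx)).
          - by move: tw; rewrite tc ltNge c1.
          - by move: ut; rewrite tu ltxx.
          - by move: tw; rewrite tw' ltxx.
        move=> nx; split => //; have [t /andP[t0 t1] tx] := e_surj x.
        exists t => //=; rewrite in_itv/= !ltNge; apply/andP; split; apply/negP => tI.
          by apply: nx; left; exists t => //=; rewrite in_itv/= t0.
        by apply: nx; right; exists t => //=; rewrite in_itv/= tI.
      - exists (e @` `[u, w]) => //; apply/seteqP; split => x [Kx] [t /=].
          rewrite in_itv/= => /andP[ut tw] tx; split => //; exists t => //=.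
          by rewrite in_itv/= !ltW.
        rewrite in_itv/= => /andP[ut tw] tx; split => //; exists t => //=.
        have nx : f x <> v by exact: (connected_component_sub Kx).
        rewrite in_itv/= !lt_neqAle ut tw !andbT; apply/andP; split; apply/eqP => tE.
          by apply: nx; rewrite -tx -tE.
        by apply: nx; rewrite -tx tE.
    by rewrite -KE' => x [].
  apply: connected_component_max => //.
  apply: connected_continuous_connected; last exact: continuous_subspaceT.
  exact/connected_intervalP/interval_is_interval.
split => //.
- move=> s t sI tI Fst.
  have est : e s = e t.
    apply: Kinj => //; rewrite inE KI.
      by exists s => //=; rewrite in_itv.
    by exists t => //=; rewrite in_itv.
  have in01 r : u < r < w -> 0 <= r <= 1.
    by move=> /andP[ur rw]; rewrite (le_trans u0 (ltW ur)) (le_trans (ltW rw)).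
  have [//|[s0 _]|[_ t0]] := e_inj (in01 _ sI) (in01 _ tI) est.
    by case/andP: sI; rewrite s0 ltNge u0.
  by case/andP: tI; rewrite t0 ltNge u0.
- by rewrite -image_comp -KI.
Qed.

Lemma edges_of_zeros u l : 0 <= u -> F u = v -> path <%R u (rcons l 1) ->
  (forall t, t \in l -> F t = v) -> F 1 = v ->
  (forall t, u < t < 1 -> F t = v -> t \in l) ->
  path (fun a b => `[< edge F v a b >]) u (rcons l 1).
Proof.
elim: l u => [|w l IHl] u u0 Fu /=.
  rewrite andbT => u1 _ F1 lz; rewrite andbT; apply/asboolP.
  by apply: edge_of_gap => // t ut /(lz t ut).
move=> /andP[uw pl] lv F1 lz.
have lw : all (<%R w) (rcons l 1) by exact: (order_path_min (@lt_trans _ _) pl).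
have w1 : w <= 1 by apply/ltW/(allP lw); rewrite mem_rcons mem_head.
have Fw : F w = v by apply: lv; rewrite mem_head.
apply/andP; split.
  apply/asboolP; apply: edge_of_gap => // t /andP[ut tw] Ft.
  have : t \in w :: l by apply: lz => //; rewrite ut (lt_le_trans tw).
  rewrite inE => /orP[/eqP tE|tl]; first by rewrite tE ltxx in tw.
  have : w < t by apply: (allP lw); rewrite mem_rcons inE tl orbT.
  by rewrite ltNge (ltW tw).
apply: IHl => //; first exact: le_trans u0 (ltW uw).
  by move=> t tl; apply: lv; rewrite inE tl orbT.
move=> t /andP[wt t1] Ft; have : t \in w :: l.
  by apply: lz => //; rewrite (lt_trans uw).
by rewrite inE => /orP[/eqP tE|//]; rewrite tE ltxx in wt.
Qed.

Lemma edges_of_circle : finite_set (f @^-1` [set v]) ->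
  (`I_3 #<= f @^-1` [set v])%card -> F 0 = v ->
  exists ps, [/\ path (fun a b => `[< edge F v a b >]) 0 ps, last 0 ps = 1 &
    (2 < size ps)%N].
Proof.
move=> finv ge3 F0; have F1 : F 1 = v by rewrite /= -e01.
(* The half-open interval counts each preimage of [v] once, although [e 0 = e 1]. *)
pose Z := [set t : R | 0 <= t < 1 /\ F t = v].
have eZ : e @` Z = f @^-1` [set v].
  apply/seteqP; split => [_ [r [_ Ft] <-]//|x /= fx].
  have [t /andP[t0 t1] tx] := e_surj x.
  move: t1; rewrite le_eqVlt => /orP[/eqP t1|t1].
    by exists 0; [split; rewrite ?lexx ?ltr01|rewrite e01 -t1].
  by exists t => //; split; rewrite ?t0//= tx.
have e_injZ : {in Z &, injective e}.
  move=> s t; rewrite !inE => -[/andP[s0 s1] _] [/andP[t0 t1] _] est.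
  have [||//|[_ t1']|[s1' _]] := e_inj _ _ est; rewrite ?s0 ?t0 ?ltW//.
    by rewrite t1' ltxx in t1.
  by rewrite s1' ltxx in s1.
have finZ : finite_set Z by rewrite -(eq_finite_set (inj_card_eq e_injZ)) eZ.
have Z3 : (`I_3 #<= Z)%card by apply: card_le_trans ge3 _; rewrite -eZ; exact: card_image_le.
have [zs0 zs0E] := proj1 (finite_seqP _) finZ.
pose zs := sort <=%R (undup zs0).
have zsE t : t \in zs <-> Z t by rewrite mem_sort mem_undup zs0E.
have zs_sorted : sorted <%R zs by rewrite sort_lt_sorted undup_uniq.
have zs3 : (2 < size zs)%N.
  have /pcard_leP[g] := Z3.
  suff : (size [seq g i | i <- iota 0 3] <= size zs)%N by rewrite size_map.
  apply: uniq_leq_size.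
    rewrite map_inj_in_uniq ?iota_uniq// => i j; rewrite !mem_iota => iI jI.
    by apply: (@inj _ _ `I_3 g); rewrite inE.
  move=> _ /mapP[i iI ->]; apply/zsE; apply: (@funS _ _ `I_3 Z g).
  by move: iI; rewrite mem_iota.
have z0 : 0 \in zs by apply/zsE; split => //=; rewrite lexx ltr01.
case zsl : zs => [|z l]; first by rewrite zsl in z0.
have zE : z = 0.
  move: z0 zs_sorted; rewrite zsl inE => /orP[/eqP->//|zl] /= pz.
  have : z < 0 by apply: (allP (order_path_min (@lt_trans _ _) pz)).
  have /zsE[/andP[z_ge0 _] _] : z \in zs by rewrite zsl mem_head.
  by rewrite ltNge z_ge0.
exists (rcons l 1); split; last by rewrite size_rcons; rewrite zsl in zs3.
  apply: edges_of_zeros => //.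
  - rewrite rcons_path; move: zs_sorted; rewrite zsl zE /= => -> /=.
    have /zsE[/andP[_ //]] : last 0 l \in zs by rewrite zsl zE mem_last.
  - move=> t tl; have /zsE[] : t \in zs by rewrite zsl inE tl orbT.
    by [].
  - move=> t /andP[t0 t1] Ft; have : t \in zs by apply/zsE; split; rewrite // ltW.
    by rewrite zsl zE inE => /orP[/eqP tE|//]; rewrite tE ltxx in t0.
by rewrite last_rcons.
Qed.

End ArcsAreEdges.

(** * Neither subpolyhedron contains the circle *)

Section RadialProjection.
Context {R : realType} (p : 'rV[R]_2).
Hypothesis p_lt1 : \sum_j p ord0 j ^+ 2 < 1.
Implicit Type x : 'rV[R]_2.

Let p0 := p ord0 ord0.
Let p1 := p ord0 ord_max.
Let d0 x : R := x ord0 ord0 - p0.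
Let d1 x : R := x ord0 ord_max - p1.
Let pd x : R := p0 * d0 x + p1 * d1 x.
Let dd x : R := d0 x * d0 x + d1 x * d1 x.
Let pp := p0 * p0 + p1 * p1.
(** The equation [|p + t (x - p)| ^ 2 = 1] reads [dd t ^ 2 + 2 pd t + pp - 1 = 0]; this is a quarter
    of its discriminant, nonnegative because [p] is in the open disk. *)
Let disc x : R := pd x * pd x + dd x * (1 - pp).

(* The larger root of [|p + t (x - p)| ^ 2 = 1] in [t]. *)
Let root x : R := (Num.sqrt (disc x) - pd x) / dd x.

Definition radial_projection x : 'rV[R]_2 :=
  vec2 (p0 + root x * d0 x) (p1 + root x * d1 x).

Let pp1 : 0 < 1 - pp.
Proof. by move: p_lt1; rewrite sum_sqr2 subr_gt0. Qed.

Let dd_gt0 x : x <> p -> 0 < dd x.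
Proof.
move=> xp; rewrite lt_neqAle addr_ge0 ?mulr_ge0_gt0 -?expr2 ?sqr_ge0// andbT.
rewrite eq_sym; apply/eqP => /eqP; rewrite /dd -!expr2 paddr_eq0 ?sqr_ge0//.
rewrite !sqrf_eq0 !subr_eq0 => /andP[/eqP e0 /eqP e1]; apply: xp.
by rewrite [x]vec2E [p]vec2E e0 e1.
Qed.

Let disc_ge0 x : 0 <= disc x.
Proof.
rewrite /disc addr_ge0//; first by rewrite -expr2 sqr_ge0.
by rewrite mulr_ge0 ?(ltW pp1)// /dd -!expr2 addr_ge0 ?sqr_ge0.
Qed.

Lemma radial_projection_circle x : x <> p -> unit_circle R (radial_projection x).
Proof.
move=> /dd_gt0 d_gt0; rewrite /unit_circle/= sum_sqr2 vec2_0 vec2_1.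
have sE := sqr_sqrtr (disc_ge0 x); rewrite /root; set s := Num.sqrt _ in sE *.
have : (s - pd x) / dd x * dd x = s - pd x by rewrite divfK// gt_eqF.
set t := _ / dd x => tE.
have -> : (p0 + t * d0 x) ^+ 2 + (p1 + t * d1 x) ^+ 2 =
  pp + 2 * t * pd x + t * (t * dd x) by rewrite /pp /pd /dd; ring.
rewrite tE; apply: (mulfI (lt0r_neq0 d_gt0)); rewrite mulr1.
have -> : dd x * (pp + 2 * t * pd x + t * (s - pd x)) =
  dd x * pp + (t * dd x) * (s + pd x) by ring.
rewrite tE; have -> : (s - pd x) * (s + pd x) = s ^+ 2 - pd x * pd x by ring.
by rewrite sE /disc; ring.
Qed.

Lemma radial_projection_id x : unit_circle R x -> radial_projection x = x.
Proof.
rewrite /unit_circle/= sum_sqr2 => x1.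
have xp : x <> p.
  by move=> xp; move: pp1; rewrite /pp /p0 /p1 -xp -!expr2 x1 subrr ltxx.
have d_gt0 := dd_gt0 xp.
(* On the circle this turns the discriminant into the square of [pd x + dd x], and the root becomes
   [1]. *)
have e : 1 - pp = 2 * pd x + dd x by rewrite /pp /pd /dd /d0 /d1; move: x1; lra.
have root1 : root x = 1.
  rewrite /root (_ : disc x = (pd x + dd x) ^+ 2); last by rewrite /disc e; ring.
  rewrite sqrtr_sqr ger0_norm; first by rewrite addrAC subrr add0r divff ?gt_eqF.
  by move: pp1; lra.
by rewrite /radial_projection root1 !mul1r /d0 /d1 !subrKC -vec2E.
Qed.

Lemma radial_projection_cvg (T : topologicalType) (g : T -> 'rV[R]_2) :
  continuous g -> (forall t, g t <> p) ->
  continuous (fun t => radial_projection (g t)).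
Proof.
move=> cg gp.
have ccoord (j : 'I_2) : continuous (fun t => g t ord0 j).
  by move=> t; exact: (cvg_comp g _ (cg t) (@coord_continuous _ _ _ ord0 j (g t))).
have cd0 : continuous (fun t => d0 (g t)).
  by move=> t; exact: (cvgB (ccoord ord0 t) (cvg_cst _)).
have cd1 : continuous (fun t => d1 (g t)).
  by move=> t; exact: (cvgB (ccoord ord_max t) (cvg_cst _)).
have cpd : continuous (fun t => pd (g t)).
  by move=> t; exact: (cvgD (cvgM (cvg_cst _) (cd0 t)) (cvgM (cvg_cst _) (cd1 t))).
have cdd : continuous (fun t => dd (g t)).
  by move=> t; exact: (cvgD (cvgM (cd0 t) (cd0 t)) (cvgM (cd1 t) (cd1 t))).
have cdisc : continuous (fun t => disc (g t)).
  by move=> t; exact: (cvgD (cvgM (cpd t) (cpd t)) (cvgM (cdd t) (cvg_cst _))).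
have croot : continuous (fun t => root (g t)).
  move=> t; have cs : Num.sqrt (disc (g s)) @[s --> t] --> Num.sqrt (disc (g t)).
    exact: (cvg_comp _ _ (cdisc t) (@sqrt_continuous R (disc (g t)))).
  have dn0 : dd (g t) != 0 by rewrite gt_eqF// dd_gt0.
  exact: (@cvgM R T (nbhs t) _ (fun s => Num.sqrt (disc (g s)) - pd (g s))
    (fun s => (dd (g s))^-1) _ _ (cvgB cs (cpd t)) (cvgV dn0 (cdd t))).
apply: vec2_continuous => t.
  exact: (cvgD (cvg_cst _) (cvgM (croot t) (cd0 t))).
exact: (cvgD (cvg_cst _) (cvgM (croot t) (cd1 t))).
Qed.

End RadialProjection.

Section EdgeCoordinate.
Context {R : realType} {J : topologicalType} (F : R -> J) (v : J).
Hypotheses (hJ : hausdorff_space J) (cF : continuous F).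

(** Through one edge [J] is an interval with its ends glued at [v]. The affine coordinate is [0] and
    [1] at these ends, so it descends modulo the integers. *)
Lemma edge_coordinate u w : edge F v u w -> exists2 k : J -> R, modcont k &
  forall t, u <= t <= w -> k (F t) - (t - u) / (w - u) \is a Num.int.
Proof.
move=> e; have [uw Fu Fw Finj FE] := e.
pose I : set R := `[u, w]%classic; pose FI (x : I) := F (set_val x).
have wu : w - u != 0 by rewrite subr_eq0 gt_eqF.
have toI t : u <= t <= w -> t \in I by move=> tI; apply/mem_set; rewrite /I/= in_itv.
have cI : compact [set: I].
  apply: (embedding_compact (@embedding_set_val _ I)).
  rewrite (_ : range _ = I); first exact: segment_compact.
  by apply/seteqP; split => [_ [x _ <-]|x Ix];
    [exact: (set_valP x)|exists (SigSub (mem_set Ix))].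
have cFI : continuous FI by exact: continuous_comp_set_val.
have FIsurj y : exists x, FI x = y.
  have [yv|yv] := pselect (y = v).
    have uI : u <= u <= w by rewrite lexx ltW.
    by exists (SigSub (toI u uI)); rewrite /FI set_valE/= Fu yv.
  have : (F @` `]u, w[) y by rewrite FE.
  move=> [t /=]; rewrite in_itv/= => /andP[ut tw] ty.
  have tI : u <= t <= w by rewrite !ltW.
  by exists (SigSub (toI t tI)); rewrite /FI set_valE.
pose c (x : I) := (set_val x - u) / (w - u).
have cc : continuous c.
  apply: (@continuous_comp_set_val _ _ I (fun t => (t - u) / (w - u))) => t.
  exact: (cvgM (cvgB cvg_id (cvg_cst _)) (cvg_cst _)).
have endZ t : t = u \/ t = w -> (t - u) / (w - u) \is a Num.int.
  by move=> [->|->]; rewrite ?subrr ?mul0r ?rpred0// divff ?rpred1.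
have FIc x y : FI x = FI y -> c x - c y \is a Num.int.
  have inI (z : I) : u <= set_val z <= w.
    by have := set_valP z; rewrite /I/= in_itv.
  rewrite /FI /c; move: (inI x) (inI y).
  move: (set_val x) (set_val y) => s t sI tI Fst.
  have cases r : u <= r <= w -> (r = u \/ r = w) \/ u < r < w.
    move=> /andP[]; rewrite le_eqVlt => /orP[/eqP<- _|ut]; first by left; left.
    by rewrite le_eqVlt => /orP[/eqP->|tw]; [left; right|right; rewrite ut].
  have Fend r : r = u \/ r = w -> F r = v by move=> [->|->].
  have [se|so] := cases s sI; have [te|to] := cases t tI.
  - by rewrite rpredB// endZ.
  - by case: (edge_neq e to); rewrite -Fst Fend.
  - by case: (edge_neq e so); rewrite Fst Fend.
  - by rewrite (Finj _ _ so to Fst) subrr.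
have [k mk kP] := modcont_descend cI hJ cFI FIsurj (continuous_modcont cc) FIc.
by exists k => // t tI; have := kP (SigSub (toI t tI)); rewrite /FI /c set_valE.
Qed.

End EdgeCoordinate.

Lemma interior_point (R : realType) (U : set (unit_disk R)) : open U ->
  U !=set0 -> exists2 p, U p & \sum_j set_val p ord0 j ^+ 2 < 1.
Proof.
move=> oU [z Uz]; have [_ emb] := @embedding_set_val _ (unit_disk R).
have [V oV VE] := proj1 (emb U) oU.
have cz : {for (1 : R), continuous (fun s : R => s *: set_val z)}.
  exact: (cvgZ cvg_id (cvg_cst _)).
have : nbhs (1 : R) [set s | V (s *: set_val z)].
  apply: cz; rewrite scale1r; apply: open_nbhs_nbhs; split => //.
  by move: Uz; rewrite VE.
(* Shrinking towards the centre by a factor [s < 1] within [e] of [1] stays in [U] and enters the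
   open disk. *)
move=> /nbhs_ballP[e /= e0 eV]; pose s := Num.max 0 (1 - e / 2).
have s0 : 0 <= s by rewrite /s le_max lexx.
have s1 : s < 1 by rewrite /s gt_max ltr01; lra.
have se : 1 - e / 2 <= s by rewrite /s le_max lexx orbT.
have Vs : V (s *: set_val z).
  by apply: eV; rewrite /ball/= ger0_norm; lra.
have sumE : \sum_j (s *: set_val z) ord0 j ^+ 2 =
    s ^+ 2 * \sum_j set_val z ord0 j ^+ 2.
  by rewrite mulr_sumr; apply: eq_bigr => j _; rewrite !mxE exprMn.
have z1 : \sum_j set_val z ord0 j ^+ 2 <= 1 := set_valP z.
have z0 : 0 <= \sum_j set_val z ord0 j ^+ 2 by apply: sumr_ge0 => j _; exact: sqr_ge0.
have lt1 : \sum_j (s *: set_val z) ord0 j ^+ 2 < 1.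
  rewrite sumE; move: z0 z1; set m := \sum_j _ => m0 m1; nra.
have Dp : s *: set_val z \in unit_disk R by apply/mem_set; exact: ltW.
by exists (SigSub Dp); rewrite ?VE /= set_val_SigSub.
Qed.

Section CoordinateLift.
Context {R : realType} {J X : topologicalType} (Q : unit_disk R -> X)
  (f : unit_circle R -> J) (G : J -> X).
Hypotheses (cS : compact [set: unit_disk R]) (hX : hausdorff_space X)
  (cQ : continuous Q) (Qsurj : forall x, exists y, Q y = x) (cf : continuous f).
Hypothesis Q_circle : forall x y, set_val x = set_val y -> Q y = G (f x).
Hypothesis Q_fibre : forall x y, Q x = Q y ->
  x = y \/ (unit_circle R (set_val x) /\ unit_circle R (set_val y)).
Hypothesis G_inj : injective G.
Variable A : set X.
Hypotheses (clA : closed A) (A_proper : A <> setT)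
  (liftA : forall u : A -> R, modcont u ->
    exists2 th, continuous th & forall x, th x - u x \is a Num.int).

(* Radial projection away from a point outside [A] retracts [A] to [G @` J]. *)
Lemma coordinate_lift (k : J -> R) : modcont k ->
  exists2 g : X -> R, {within A, continuous g} &
    forall x, A (G (f x)) -> g (G (f x)) - k (f x) \is a Num.int.
Proof.
move=> mk; have [p nAp p1] : exists2 p, ~ A (Q p) & \sum_j set_val p ord0 j ^+ 2 < 1.
  apply: (@interior_point _ (~` (Q @^-1` A))).
    by apply: closed_openC; move/continuous_closedP : cQ; exact.
  apply: contrapT => nex; apply: A_proper; apply/seteqP; split => // x _.
  have [y yx] := Qsurj x; apply: contrapT => nAx; apply: nex; exists y.
  by rewrite /= yx.
have ne (x : Q @^-1` A) : set_val (set_val x) <> set_val p.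
  rewrite [in set_val p]set_valE => /val_inj xp.
  by apply: nAp; rewrite -xp; exact: (set_valP x).
pose rho (x : Q @^-1` A) := radial_projection (set_val p) (set_val (set_val x)).
have rhoC x : rho x \in unit_circle R.
  by apply/mem_set; apply: radial_projection_circle.
pose r x : unit_circle R := SigSub (rhoC x).
have rE x : set_val (r x) = rho x by rewrite set_valE.
have cr : continuous r.
  apply: (continuous_embedding (@embedding_set_val _ (unit_circle R))).
  rewrite (_ : _ \o r = rho); last by apply/funext => x; exact: rE.
  have cv : continuous (fun x : Q @^-1` A => set_val (set_val x) : 'rV[R]_2).
    apply: (@continuous_comp_set_val _ _ (Q @^-1` A) set_val).
    exact: (embedding_continuous (@embedding_set_val _ (unit_disk R))).
  exact: (radial_projection_cvg cv ne).
have cfr : continuous (f \o r) by move=> x; apply: continuous_comp; [exact: cr|exact: cf].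
have rQ x : unit_circle R (set_val (set_val x)) -> G (f (r x)) = Q (set_val x).
  move=> Cx; symmetry; apply: Q_circle.
  by rewrite rE /rho radial_projection_id.
have [||g cg gP] := modcont_descend_within cS hX cQ Qsurj clA liftA
  (u := k \o (f \o r)).
- exact: modcont_comp.
(* Distinct points of a fibre lie on the circle, which the projection fixes, so injectivity of [G]
   applies. *)
- move=> x y xy; suff fr : f (r x) = f (r y) by rewrite /= fr subrr.
  have [/val_inj->//|[Cx Cy]] := Q_fibre xy.
  by apply: G_inj; rewrite (rQ x Cx) (rQ y Cy).
exists g => // x Ax.
have Dx : set_val x \in unit_disk R.
  by apply/mem_set; have := set_valP x; rewrite /unit_circle/unit_disk/= => ->.
pose y : unit_disk R := SigSub Dx.
have yx : set_val y = set_val x by rewrite set_valE.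
have Qy : Q y = G (f x) by exact: Q_circle.
have Ay : y \in Q @^-1` A by apply/mem_set; rewrite /= Qy.
have := gP (SigSub Ay); rewrite set_val_SigSub /= Qy.
suff -> : f (r (SigSub Ay)) = f x by [].
apply: G_inj; rewrite rQ set_val_SigSub/= ?Qy//.
by rewrite yx; exact: (set_valP x).
Qed.

End CoordinateLift.

Section EdgeNotCovered.
Context {R : realType} {J X : topologicalType} (F : R -> J) (v : J) (G : J -> X)
  (A : set X).
Hypotheses (hJ : hausdorff_space J) (cF : continuous F) (cG : continuous G)
  (clA : closed A).
Hypothesis liftA : forall k : J -> R, modcont k ->
  exists2 g : X -> R, {within A, continuous g} &
    forall y, A (G y) -> g (G y) - k y \is a Num.int.

(** On a covered edge the lifted coordinate takes the same value at both ends, which [F] sends to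
    [v], while the affine coordinate grows by [1]. Their difference is continuous and integer
    valued, so it cannot change. *)
Lemma edge_not_covered u w : edge F v u w ->
  exists2 t, u < t < w & ~ A (G (F t)).
Proof.
move=> e; have [uw Fu Fw _ _] := e; apply: contrapT => nex.
have cGF : continuous (G \o F).
  by move=> t; apply: continuous_comp; [exact: cF|exact: cG].
have clZ : closed ((G \o F) @^-1` A) by move/continuous_closedP : cGF; exact.
(* [A] is closed, so it contains the ends too; [z] is taken towards the midpoint to remain strictly
   inside the interval. *)
have inZ t : u <= t <= w -> A (G (F t)).
  move=> /andP[ut tw]; apply: clZ => N /nbhs_ballP[eps /= eps0 epsN].
  have [z uzw tz] : exists2 z, u < z < w & `|t - z| < eps.
    have [tm|mt] := leP t ((u + w) / 2).
      pose z := Num.min ((u + w) / 2 + (w - u) / 4) (t + eps / 2).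
      exists z; have : z <= (u + w) / 2 + (w - u) / 4 by rewrite /z ge_min lexx.
        have : t < z by rewrite /z lt_min; apply/andP; split; lra.
        by move=> *; apply/andP; split; lra.
      move=> _; have : z <= t + eps / 2 by rewrite /z ge_min lexx orbT.
      have : t < z by rewrite /z lt_min; apply/andP; split; lra.
      by move=> *; rewrite ltr0_norm; lra.
    pose z := Num.max ((u + w) / 2 - (w - u) / 4) (t - eps / 2).
    exists z; have : (u + w) / 2 - (w - u) / 4 <= z by rewrite /z le_max lexx.
      have : z < t by rewrite /z gt_max; apply/andP; split; lra.
      by move=> *; apply/andP; split; lra.
    move=> _; have : t - eps / 2 <= z by rewrite /z le_max lexx orbT.
    have : z < t by rewrite /z gt_max; apply/andP; split; lra.
    by move=> *; rewrite gtr0_norm; lra.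
  exists z; split; last exact: epsN.
  by apply: contrapT => nA; apply: nex; exists z.
have [k mk kF] := edge_coordinate hJ cF e.
have [g cg gk] := liftA mk.
pose h t := g (G (F t)) - (t - u) / (w - u).
have wu : w - u != 0 by rewrite subr_eq0 gt_eqF.
have : h u = h w.
  apply: continuous_int_cst (ltW uw) _ _.
    apply: within_continuousB.
      apply: (continuous_within_image cg cGF) => t /=; rewrite in_itv/=.
      exact: inZ.
    apply: continuous_subspaceT => t.
    exact: (cvgM (cvgB cvg_id (cvg_cst _)) (cvg_cst _)).
  move=> t tI; have := gk _ (inZ t tI); have := kF t tI => H1 H2.
  have -> : h t = (g (G (F t)) - k (F t)) + (k (F t) - (t - u) / (w - u)).
    by rewrite /h; ring.
  by rewrite rpredD.
rewrite /h Fu Fw subrr mul0r divff// subr0 => /eqP.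
by rewrite eq_sym subr_eq addrC -subr_eq subrr eq_sym oner_eq0.
Qed.

End EdgeNotCovered.

(** * Alternations are bounded *)

Section EdgePieces.
Context {R : realType} {J X : topologicalType} (hJ : plStructure R J)
  (hX : plStructure R X) (G : J -> X) (F : R -> J) (v : J) (u0 w0 : R) (A : set X).
Hypotheses (plG : pl_map hJ hX G) (cF : continuous F) (e : edge F v u0 w0)
  (pA : subpolyhedron hX A).

(** [J] is a circle, so it takes two missed points, [F a1] and [F a2], to separate [F b1] from
    [F b2]. The closed arcs [Z] and [Z'] between them are disjoint over [A], so membership in [Z] is
    a continuous integer function on the convex set [K], hence constant. *)
Lemma inner_arc_separated (K : set 'rV[R]_(pl_dim hJ + pl_dim hX)) (y : K -> J)
    b1 a1 b2 a2 : segment_closed K -> (forall w, hJ (y w) = lsubmx (set_val w)) ->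
  (forall w, A (G (y w))) -> u0 < b1 -> b1 < a1 -> a1 < b2 -> b2 < a2 -> a2 < w0 ->
  ~ A (G (F a1)) -> ~ A (G (F a2)) ->
  ~ ((exists w, y w = F b1) /\ exists w, y w = F b2).
Proof.
move=> Kconv hy Ay ub1 ba1 ab ba2 aw nA1 nA2 [[w1 yw1] [w2 yw2]].
have [uw Fu Fw Finj FE] := e; have hausJ := pl_hausdorff hJ.
have cy : continuous y.
  apply: (continuous_embedding (pl_chart_embedding hJ)).
  have cl : continuous (lsubmx : 'rV[R]_(pl_dim hJ + pl_dim hX) -> 'rV[R]_(pl_dim hJ)).
    move=> t U /nbhs_ballP[eps /= e0 eU]; apply/nbhs_ballP; exists eps => //= s [_ ts].
    by apply: eU; split=> // i j; rewrite !mxE; exact: ts.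
  rewrite (_ : _ \o y = lsubmx \o set_val); last by apply/funext => w; exact: hy.
  exact: continuous_comp_set_val.
pose Z := F @` `[a1, a2]; pose Z' := F @` `[u0, a1] `|` F @` `[a2, w0].
have clZ : closed Z by exact: closed_image_segment.
have clZ' : closed Z' by apply: closedU; exact: closed_image_segment.
have ZZ' z : Z z \/ Z' z.
  have [zv|zv] := pselect (z = v).
    right; left; exists u0; rewrite ?zv//= in_itv/= lexx; lra.
  have : (F @` `]u0, w0[) z by rewrite FE.
  move=> [t /=]; rewrite in_itv/= => /andP[ut tw] tz.
  have [ta|at_] := leP t a1.
    by right; left; exists t => //=; rewrite in_itv/= ta ltW.
  have [ta2|at2] := leP a2 t.
    by right; right; exists t => //=; rewrite in_itv/= ta2 ltW.
  by left; exists t => //=; rewrite in_itv/= !ltW.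
have disj z : A (G z) -> Z z -> ~ Z' z.
  move=> Az [t /=]; rewrite in_itv/= => /andP[a1t ta2] tz.
  have ta1 : t <> a1 by move=> ta; apply: nA1; rewrite -ta tz.
  have ta2' : t <> a2 by move=> ta; apply: nA2; rewrite -ta tz.
  have tI : u0 < t < w0 by apply/andP; split; lra.
  have a1t' : a1 < t by rewrite lt_neqAle a1t andbT; apply/eqP => /esym.
  have ta2s : t < a2 by rewrite lt_neqAle ta2 andbT; exact/eqP.
  have neq s : u0 <= s <= w0 -> s <> t -> F s <> z.
    move=> /andP[us sw] st Fs.
    move: us; rewrite le_eqVlt => /orP[/eqP us|us].
      by apply: (edge_neq e tI); rewrite tz -Fs -us.
    move: sw; rewrite le_eqVlt => /orP[/eqP sw|sw].
      by apply: (edge_neq e tI); rewrite tz -Fs sw.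
    by apply: st; apply: Finj => //; [rewrite us|rewrite Fs].
  move=> [] [s /=]; rewrite in_itv/= => /andP[s1 s2]; apply: neq.
  - by apply/andP; split; lra.
  - by move=> st; move: s2 a1t'; rewrite st; lra.
  - by apply/andP; split; lra.
  - by move=> st; move: s1 ta2s; rewrite st; lra.
pose g (w : K) : R := (`[< Z (y w) >] : bool)%:R.
have cg : continuous g.
  move=> w; have loc c : closed c -> ~ c (y w) -> \forall w' \near w, ~ c (y w').
    move=> clc ncw; have N : nbhs (y w) (~` c).
      by apply: open_nbhs_nbhs; split => //; exact: closed_openC.
    exact: (cy w _ N).
  have near_eq : \forall w' \near w, g w' = g w.
    have [Zw|nZw] := pselect (Z (y w)).
      apply: filterS (loc _ clZ' (disj _ (Ay w) Zw)) => w' nZ'.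
      by rewrite /g !asboolT//; case: (ZZ' (y w')).
    by apply: filterS (loc _ clZ nZw) => w' nZ'; rewrite /g !asboolF.
  move=> N /nbhs_singleton Ng; apply: filterS near_eq => w' gw'.
  by rewrite /= gw'.
have gZ w : g w \is a Num.int by exact: natr_int.
have := convex_continuous_int_cst Kconv cg gZ w1 w2.
have b1I : u0 < b1 < w0 by apply/andP; split; lra.
have nZ1 : ~ Z (F b1).
  move=> [t /=]; rewrite in_itv/= => /andP[a1t ta2] tb.
  have tI : u0 < t < w0 by apply/andP; split; lra.
  by move: a1t; rewrite (Finj _ _ tI b1I tb); lra.
have Z2 : Z (F b2) by exists b2 => //=; rewrite in_itv/= !ltW.
by rewrite /g yw1 yw2 asboolF// asboolT// => /eqP; rewrite eq_sym oner_eq0.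
Qed.

(** A polytope of the graph of [G], cut by the preimage of a polytope of [A], is a convex set of
    graph points. So the part of [J] inside [A] is a finite union of connected pieces. *)
Lemma edge_pieces : exists (N : nat) (P : 'I_N -> set R),
  (forall t, A (G (F t)) -> exists i, P i t) /\
  forall i b1 a1 b2 a2, u0 < b1 -> b1 < a1 -> a1 < b2 -> b2 < a2 -> a2 < w0 ->
    P i b1 -> P i b2 -> A (G (F a1)) \/ A (G (F a2)).
Proof.
have [_ [ss graphE]] := plG; have [ss' AE] := pA.
pose pr := [seq (s, s') | s <- ss, s' <- ss'].
pose K (p : seq _ * seq _) : set 'rV[R]_(pl_dim hJ + pl_dim hX) :=
  [set w | polytope p.1 w /\ polytope p.2 (rsubmx w)].
pose x t := row_mx (hJ (F t)) (hX (G (F t))).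
exists (size pr), (fun i => [set t | K (nth ([::], [::]) pr i) (x t)]); split => [t At|].
  have : range (fun y => row_mx (hJ y) (hX (G y))) (x t) by exists (F t).
  rewrite graphE => -[s /= sS xs].
  have : (hX @` A) (hX (G (F t))) by exists (G (F t)).
  rewrite AE => -[s' /= s'S xs'].
  have pS : (s, s') \in pr by exact: allpairs_f.
  have iS : (index (s, s') pr < size pr)%N by rewrite index_mem.
  by exists (Ordinal iS); rewrite /= nth_index//; split => //=; rewrite row_mxKr.
move=> i b1 a1 b2 a2 ub1 ba1 ab ba2 aw; set p := nth _ _ _.
move=> K1 K2; have {}K1 : K p (x b1) := K1; have {}K2 : K p (x b2) := K2.
have [pS pS'] : p.1 \in ss /\ p.2 \in ss'.
  have /allpairsP[[s s'] /= [sS s'S ->]] // : p \in pr by exact: mem_nth.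
have Kconv : segment_closed (K p).
  move=> z z' t [z1 z2] [z1' z2'] t01; split; first exact: segment_closed_polytope.
  by rewrite linearD linearZ linearB; exact: segment_closed_polytope.
have ex (w : K p) : exists y, [/\ hJ y = lsubmx (set_val w) & A (G y)].
  have [w1 w2] : K p (set_val w) := set_valP w.
  have : (\bigcup_(s in [set` ss]) polytope s) (set_val w).
    by exists p.1.
  rewrite -graphE => -[y _ yw]; exists y; rewrite -yw row_mxKl; split => //.
  have : (hX @` A) (rsubmx (set_val w)).
    by rewrite AE; exists p.2.
  rewrite -yw row_mxKr => -[a Aa ha].
  by case: (pl_chart_embedding hX) => inj_h _; rewrite -(inj_h _ _ ha).
have [y yP] := choice ex.
apply: contrapT => /not_orP[nA1 nA2].
apply: (@inner_arc_separated (K p) y b1 a1 b2 a2) => // [w|w|].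
- by case: (yP w).
- by case: (yP w).
- have inj_h : injective hJ by case: (pl_chart_embedding hJ).
  by split; [exists (SigSub (mem_set K1 : _ \in K p))|
    exists (SigSub (mem_set K2 : _ \in K p))];
    apply: inj_h; rewrite (proj1 (yP _)) set_val_SigSub row_mxKl.
Qed.

End EdgePieces.

Section AlternationBound.
Context {R : realType} {X : Type} (q : R -> X) (C : bool -> set X) (a b : R).
Hypothesis coverC : forall x c, C c x \/ C (~~ c) x.

(** Each counted marker of colour [true] lies in a piece and is followed by a point missing
    [C true]. The separation hypothesis forbids two of them in one piece, so the pieces bound their
    number. *)
Lemma alternation_size_bound N (P : 'I_N -> set R) T :
  (forall t, C true (q t) -> exists i, P i t) ->
  (forall i b1 a1 b2 a2, a < b1 -> b1 < a1 -> a1 < b2 -> b2 < a2 -> a2 < b ->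
    P i b1 -> P i b2 -> C true (q a1) \/ C true (q a2)) ->
  alternation q C a b T -> (size T <= 2 * N + 5)%N.
Proof.
move=> Pcover Psep altT; have /andP[sT /allP mT] := altT.
pose p l := nth (a, true) T l.
have mp l : (l < size T)%N -> marker q C a b (p l).
  by move=> lT; apply/asboolP/mT; exact: mem_nth.
have typ l : (l < size T)%N -> (p l).2 = (p 0%N).2 (+) odd l.
  by move=> lT; exact: (alternation_type altT lT).
have plt i j : (i < j)%N -> (j < size T)%N -> (p i).1 < (p j).1.
  move=> ij jT; have trT : transitive (fun x y : R * bool => x.1 < y.1).
    by move=> x y z; exact: lt_trans.
  apply: (sorted_ltn_nth trT (a, true) (s := T)) => //.
    by apply: sub_sorted sT => x y /andP[].
  by rewrite inE (ltn_trans ij).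
pose e := nat_of_bool (~~ (p 0%N).2).
have e1 : (e <= 1)%N by rewrite /e; case: (p 0%N).2.
(* Two markers are set aside for the offset [e] of the first one coloured [true] and for a [false]
   one after the last one counted. *)
pose n := (size T - 2)./2.
have kT k : (k < n)%N -> ((2 * k + e).+1 < size T)%N by rewrite /n; lia.
have tyb k : (k < n)%N -> (p (2 * k + e)%N).2 = true.
  move=> /kT kT'; rewrite typ; last by lia.
  by rewrite oddD mul2n odd_double /e; case: (p 0%N).2.
have tya k : (k < n)%N -> (p (2 * k + e).+1).2 = false.
  move=> /kT kT'; rewrite typ// oddS oddD mul2n odd_double /e.
  by case: (p 0%N).2.
(* The option type makes the choice total; [None] is only the default for [k >= n]. *)
have ex k : exists i : option 'I_N, (k < n)%N ->
    if i is Some i then P i (p (2 * k + e)%N).1 else False.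
  have [kn|kn] := pselect (k < n)%N; last by exists None.
  have kT' := kT _ kn; have lT : (2 * k + e < size T)%N by lia.
  have [_ _ nC] := mp _ lT; rewrite tyb// in nC.
  have Cq : C true (q (p (2 * k + e)%N).1).
    by have [//|/nC] := coverC (q (p (2 * k + e)%N).1) true.
  by have [i Pi] := Pcover _ Cq; exists (Some i).
have [f fP] := choice ex.
have f_inj : {in iota 0 n &, injective f}.
  move=> j k; rewrite !mem_iota /= !add0n => jn kn fjk.
  wlog jk : j k jn kn fjk / (j < k)%N => [th|].
    by have [jk|kj|//] := ltngtP j k; [exact: th|apply/esym; exact: th].
  have := fP j jn; have := fP k kn; rewrite fjk; case: (f k) => // i Pk Pj.
  have kT' := kT _ kn; have jT' := kT _ jn.
  have [ab1 _ _] := mp (2 * j + e)%N ltac:(lia).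
  have [_ ba2 na2] := mp _ kT'; have [_ _ na1] := mp _ jT'.
  rewrite tya// in na1; rewrite tya// in na2.
  by have [|||//|//] := Psep i _ (p (2 * j + e).+1).1 _ (p (2 * k + e).+1).1
    ab1 _ _ _ ba2 Pj Pk; apply: plt; lia.
have : (size (map f (iota 0 n)) <= size (enum {: option 'I_N}))%N.
  apply: uniq_leq_size; first by rewrite map_inj_in_uniq ?iota_uniq.
  by move=> i _; rewrite mem_enum.
by rewrite size_map size_iota -cardE card_option card_ord /n; lia.
Qed.

Lemma maximal_alternation N :
  (forall T, alternation q C a b T -> (size T <= N)%N) ->
  exists2 T, alternation q C a b T &
    forall T', alternation q C a b T' -> (size T' <= size T)%N.
Proof.
move=> bound; pose Pn k := `[< exists2 T, alternation q C a b T & size T = k >].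
have P0 : exists k, Pn k by exists 0%N; apply/asboolP; exists [::].
have Pmax k : Pn k -> (k <= N)%N by move=> /asboolP[T /bound + <-].
have [k /asboolP[T altT <-] maxk] := ex_maxnP P0 Pmax.
by exists T => // T' altT'; apply: maxk; apply/asboolP; exists T'.
Qed.

End AlternationBound.

(** * The disk, and unsplittability of the dunce hat *)

Lemma unit_disk_compact (R : realType) : compact (unit_disk R).
Proof.
have clD : closed (unit_disk R).
  apply: (proj1 (continuous_closedP (fun t : 'rV[R]_2 => \sum_j t ord0 j ^+ 2)) _
    _ (@closed_le _ 1)).
  apply: continuous_big => [|j _]; first exact: add_continuous.
  move=> t; have ct := @coord_continuous R 1 2 ord0 j t; exact: (cvgM ct ct).
have cube : compact [set v : 'rV[R]_2 | forall j, `[-1, 1]%classic (v ord0 j)].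
  by apply: (@rV_compact R _ (fun=> _)) => _; exact: segment_compact.
apply: (subclosed_compact clD cube) => t /= t1 j; rewrite in_itv/= -ler_norml.
rewrite -(@ler_sqr _ _ 1) ?nnegrE// real_normK ?num_real// expr1n.
apply: le_trans t1; rewrite (bigD1 j)//= lerDl.
by apply: sumr_ge0 => i _; exact: sqr_ge0.
Qed.

Lemma segment_closed_unit_disk (R : realType) : segment_closed (unit_disk R).
Proof.
move=> x y t; rewrite /unit_disk/= !sum_sqr2 !mxE.
set a := x _ _; set b := x _ _; set c := y _ _; set d := y _ _.
move=> x1 y1 /andP[t0 t1].
have -> : (a + t * (c - a)) ^+ 2 + (b + t * (d - b)) ^+ 2 =
  (1 - t) * (a ^+ 2 + b ^+ 2) + t * (c ^+ 2 + d ^+ 2) -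
  t * (1 - t) * ((c - a) ^+ 2 + (d - b) ^+ 2) by ring.
have H1 : 0 <= t * (1 - t) * ((c - a) ^+ 2 + (d - b) ^+ 2).
  by rewrite !mulr_ge0 ?subr_ge0// addr_ge0 ?sqr_ge0.
have H2 : (1 - t) * (a ^+ 2 + b ^+ 2) <= 1 - t.
  by rewrite -[leRHS]mulr1 ler_wpM2l// subr_ge0.
have H3 : t * (c ^+ 2 + d ^+ 2) <= t by rewrite -[leRHS]mulr1 ler_wpM2l.
lra.
Qed.

Lemma alternation_ge2 (R : realType) (X : Type) (q : R -> X) (C : bool -> set X)
    (a b : R) (T : seq (R * bool)) :
  (forall x c, C c x \/ C (~~ c) x) ->
  (forall c, exists2 t, a < t < b & ~ C c (q t)) ->
  (forall T', alternation q C a b T' -> (size T' <= size T)%N) ->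
  (1 < size T)%N.
Proof.
move=> coverC missed maxT.
have [t /andP[at_ tb] nt] := missed true; have [s /andP[as_ sb] ns] := missed false.
have [st|ts|ts] := ltgtP s t.
- apply: (maxT [:: (s, true); (t, false)]).
  by rewrite /alternation /= /switches/= st/=; apply/and3P; split=> //;
    apply/asboolP.
- apply: (maxT [:: (t, false); (s, true)]).
  by rewrite /alternation /= /switches/= ts/=; apply/and3P; split=> //;
    apply/asboolP.
- by case: (coverC (q s) true); rewrite // ts.
Qed.

Theorem mainTheorem2 (R : realType) (X : dunceHat R) (P : dunceHatPL X) :
  finitely_unsplittable (hat_pl P).
Proof.
move=> [A [B [[pA nA] [pB nB] AB finA finB]]].
have [phi [phi_emb phi_surj] bdryE] := diskP X.
have [phi_inj _] := phi_emb; have cphi := embedding_continuous phi_emb.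
pose G := adj_circle (@attach R X); pose Q x := adj_disk (@attach R X) (phi x).
have [cG _] : pl_map (circle_pl P) (hat_pl P) G := adj_circle_pl P.
have [cadj _] := adj_disk_pl P.
have hausX := pl_hausdorff (hat_pl P); have hausJ := pl_hausdorff (circle_pl P).
have hausD := pl_hausdorff (disk_pl P).
have cQ : continuous Q.
  by move=> x; apply: continuous_comp; [exact: cphi|exact: cadj].
have G_inj : injective G by exact: adj_circle_inj.
have phi_bdry x : bdry (phi x) <-> unit_circle R (set_val x).
  rewrite bdryE; split => [[y Cy /phi_inj <-//]|Cx]; by exists x.
pose to_bdry x (Cx : unit_circle R (set_val x)) : @bdry R X :=
  SigSub (mem_set (proj2 (phi_bdry x) Cx)).
have Q_fibre x y : Q x = Q y ->
    x = y \/ (unit_circle R (set_val x) /\ unit_circle R (set_val y)).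
  by move=> /adj_disk_inj[/phi_inj->|[/phi_bdry Cx /phi_bdry Cy]]; [left|right].
have bdry_phi (b : @bdry R X) : exists2 x, unit_circle R (set_val x) & phi x = set_val b.
  have bP d : bdry d -> exists2 x, unit_circle R (set_val x) & phi x = d.
    by rewrite bdryE => -[x]; exists x.
  exact: bP (set_valP b).
(* The boundary is parametrized from a preimage of the distinguished point, so that the unit
   interval is cut into whole edges. *)
have [z Cz attach_z] : exists2 z, unit_circle R (set_val z) &
    forall Cz, attach (to_bdry z Cz) = @basept R X.
  have [b attach_b] : (@attach R X @^-1` [set @basept R X]) !=set0.
    apply/set0P/eqP => pre0; have := attach_ge3 X; rewrite pre0 card_le0.
    by move=> /eqP/seteqP[/(_ 0%N isT)].
  have [x Cx xb] := bdry_phi b; exists x => // Cz; rewrite -[RHS]attach_b.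
  by congr attach; apply: val_inj; rewrite -!set_valE set_val_SigSub.
have [E [cE CE [E0 E1] E_inj E_surj]] := circle_parametrization Cz.
pose e t := to_bdry (E t) (CE t).
have eE t : set_val (e t) = phi (E t) by rewrite set_val_SigSub.
have ce : continuous e.
  apply: (continuous_embedding (@embedding_set_val _ (@bdry R X))).
  rewrite (_ : _ \o e = phi \o E); last by apply/funext => t; exact: eE.
  by move=> t; apply: continuous_comp; [exact: cE|exact: cphi].
pose F := @attach R X \o e.
have cF : continuous F.
  by move=> t; apply: continuous_comp; [exact: ce|exact: (@attach_continuous R X)].
have qE : Q \o E = G \o F.
  by apply/funext => t; rewrite /= /Q -eE adj_glue.
have F0 : F 0 = @basept R X by rewrite /F /= /e; move: (CE 0); rewrite E0; exact: attach_z.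
have e01 : e 0 = e 1 by apply: val_inj; rewrite -!set_valE !eE E0 E1.
have e_inj s t : 0 <= s <= 1 -> 0 <= t <= 1 -> e s = e t ->
    [\/ s = t, s = 0 /\ t = 1 | s = 1 /\ t = 0].
  move=> s01 t01 /(congr1 set_val); rewrite !eE => /phi_inj.
  exact: E_inj.
have e_surj b : exists2 t, 0 <= t <= 1 & e t = b.
  have [x Cx xb] := bdry_phi b; have [t t01 tx] := E_surj x Cx.
  by exists t => //; apply: val_inj; rewrite -!set_valE eE tx.
have f_component (x : @bdry R X) : attach x <> @basept R X ->
    let K := connected_component (~` (@attach R X @^-1` [set @basept R X])) x in
    {in K &, injective (@attach R X)} /\ @attach R X @` K = ~` [set @basept R X].
  move=> /attach_component/= [[K_inj _] KE]; split => // y y' Ky Ky' yy'.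
  have := K_inj (SigSub Ky) (SigSub Ky'); rewrite !set_val_SigSub => /(_ yy').
  by move=> /(congr1 set_val); rewrite !set_val_SigSub.
have hausB := embedding_hausdorff (@embedding_set_val _ (@bdry R X)) hausD.
have [ps [psE lastps size_ps]] := edges_of_circle hausB ce e01 e_inj e_surj
  f_component (attach_finite X) (attach_ge3 X) F0.
have edges_le u l : path (fun a b => `[< edge F (@basept R X) a b >]) u l -> u <= last u l.
  elim: l u => //= x l IHl u /andP[/asboolP[/ltW ux _ _ _ _] /IHl].
  exact: le_trans.
(* The first edge will carry the maximal alternation that is copied to all the others. *)
have [w e1 w1] : exists2 w, edge F (@basept R X) 0 w & w <= 1.
  case: ps psE size_ps lastps => // w ps /= /andP[/asboolP e1 /edges_le w1] _ <-.
  by exists w.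
have [_ _ _ _ FE] := e1.
have Fsurj y : exists t, F t = y.
  have [->|yv] := pselect (y = @basept R X); first by exists 0.
  by have : (F @` `]0, w[) y by [rewrite FE]; move=> [t _ ty]; exists t.
have Qsurj x : exists y, Q y = x.
  have [[d ->]|[y ->]] := adjunction_cover x.
    have : range phi d by rewrite phi_surj.
    by move=> [y _ <-]; exists y.
  have [t <-] := Fsurj y; exists (E t); exact: (congr1 (@^~ t) qE).
have cS := compact_set_type (@unit_disk_compact R).
pose C c := if c then A else B.
have pC c : subpolyhedron (hat_pl P) (C c) by case: c.
have clC c : closed (C c) := subpolyhedron_closed (pC c).
have coverC x c : C c x \/ C (~~ c) x.
  have : (A `|` B) x by rewrite AB.
  by case: c => -[]; [left|right|right|left].
have liftC c (u : C c -> R) : modcont u ->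
    exists2 th, continuous th & forall x, th x - u x \is a Num.int.
  by apply: lift_subpolyhedron (pC c) _; case: c {u}.
have circle_in_disk (x : unit_circle R) : set_val x \in unit_disk R.
  by apply/mem_set; have := set_valP x; rewrite /unit_circle/unit_disk/= => ->.
pose d x : unit_disk R := SigSub (circle_in_disk x).
have dE x : set_val (d x) = set_val x by rewrite set_val_SigSub.
have Cd x : unit_circle R (set_val (d x)) by rewrite dE; exact: (set_valP x).
(* The attaching map transported to the standard circle, where radial projection lands. *)
pose f x := attach (to_bdry (d x) (Cd x)).
have cf : continuous f.
  have cd : continuous d.
    apply: (continuous_embedding (@embedding_set_val _ (unit_disk R))).
    rewrite (_ : _ \o d = set_val); last by apply/funext => x; exact: dE.
    exact: (embedding_continuous (@embedding_set_val _ (unit_circle R))).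
  have cb : continuous (fun x => to_bdry (d x) (Cd x)).
    apply: (continuous_embedding (@embedding_set_val _ (@bdry R X))).
    rewrite (_ : _ \o _ = phi \o d); last first.
      by apply/funext => x; rewrite /= set_val_SigSub.
    by move=> x; apply: continuous_comp; [exact: cd|exact: cphi].
  by move=> x; apply: continuous_comp; [exact: cb|exact: (@attach_continuous R X)].
have Q_circle x y : set_val x = set_val y -> Q y = G (f x).
  rewrite -dE [in LHS]set_valE [in RHS]set_valE => /val_inj <-.
  by rewrite /Q /G /f -adj_glue set_val_SigSub.
have f_surj y : exists x, f x = y.
  have [t <-] := Fsurj y; exists (SigSub (mem_set (CE t))).
  apply: G_inj; rewrite -[RHS](congr1 (@^~ t) qE); symmetry; apply: Q_circle.
  by rewrite set_val_SigSub.
have nC c : C c <> setT by case: c.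
have liftJ c (k : circle X -> R) : modcont k ->
    exists2 g : hat_space X -> R, {within C c, continuous g} &
      forall y, C c (G y) -> g (G y) - k y \is a Num.int.
  move=> mk; have [g cg gk] := coordinate_lift cS hausX cQ Qsurj cf Q_circle
    Q_fibre G_inj (clC c) (nC c) (liftC c) mk.
  by exists g => // y; have [x <-] := f_surj y; exact: gk.
have missed c : exists2 t, 0 < t < w & ~ C c ((G \o F) t).
  have := @edge_not_covered _ _ _ F _ G (C c) hausJ cF cG (clC c) (liftJ c) _ _ e1.
  exact.
(* The pieces of [A] alone bound the alternations, since every second marker misses [A]. *)
have [N [pieces [Pcover Psep]]] := edge_pieces (adj_circle_pl P) cF e1 pA.
have [T altT maxT] := maximal_alternation
  (fun T => alternation_size_bound (C := C) coverC Pcover Psep (T := T)).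
have sizeT := alternation_ge2 coverC missed maxT.
have cGF : continuous (G \o F).
  by move=> t; apply: continuous_comp; [exact: cF|exact: cG].
have clCq c : closed [set t | C c ((G \o F) t)].
  by move/continuous_closedP : cGF; apply.
have T0 := ltnW sizeT.
have [s [cs ls]] := alternation_chain clCq coverC altT maxT T0.
have typ := alternation_type altT.
have as_ : alternates (fun l => (nth (0, true) T l).2) s.
  rewrite /alternates ls; apply/(sortedP 0%N) => i; rewrite size_iota => iT.
  rewrite !nth_iota// ?(ltnW iT)// !add0n typ ?(ltnW iT)// [X in _ != X]typ//=.
  by rewrite addbN; case: (_ (+) _).
have ps0 : ps != [::] by case: ps size_ps {psE lastps}.
have [s' [cs' as' size_s' ls']] := chain_over_edges hausJ cF T0 e1 cs as_ ls ps0 psE.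
rewrite lastps -qE in cs'.
have marker_T l : (l < size T)%N -> marker (Q \o E) C 0 w (nth (0, true) T l).
  by rewrite qE => lT; have /andP[_ /allP] := altT; move=> /(_ _ (mem_nth _ lT))/asboolP.
apply: (no_long_alternating_chain cS _ hausX cQ Qsurj cE _ E_inj _ _ clC coverC liftC
  sizeT typ _ _ _ cs' as' _ _).
- exact: embedding_hausdorff (@embedding_set_val _ _) (@norm_hausdorff _ _).
- by rewrite E0 E1.
- move=> x y /Q_fibre[|[/E_surj[u u01 <-] /E_surj[v v01 <-]]]; first by left.
  by right; exists u, v.
- by move=> u; exact: lift_convex (@unit_disk_compact R) (@segment_closed_unit_disk R).
- by move=> l /marker_T[].
- move=> l /marker_T[l0 lw _]; exists (nth (0, true) T l).1 => //.
  by rewrite (ltW l0)/= (le_trans (ltW lw)).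
- move=> l /marker_T[l0 lw _]; rewrite qE => /G_inj; rewrite [in RHS]F0.
  by apply: (edge_neq e1); rewrite l0.
- by move=> l /ls'; rewrite mem_iota.
- by apply: leq_ltn_trans size_s'; rewrite leq_mul2r size_ps orbT.
Qed.
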